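(* Let $C$ be a compact Riemann surface, $E$ a fixed rank 2 unstable holomorphic vector bundle on $C$, $\mathcal{E}$ the associated locally free sheaf, $x_0\in C$, and $\varepsilon_0:\mathbb{C}\to D_{E,x_0}$ a fixed linear isomorphism. Then: (1) The map $A\mapsto h_A$ induces a bijection between the set of isomorphism classes of non-degenerate holomorphic affine rank 2 bundles $A$ on $C$ with $L(A)\simeq E$ and the quotient $H^1(C,\mathcal{E})_0/\mathrm{Aut}(E)$. (2) For an $x_0$-framed affine bundle $(A,\varepsilon)$ with $L(A)\simeq E$ choose an isomorphism $f:L(A)\to E$ such that $f\circ\varepsilon=\varepsilon_0$. The map $(A,\varepsilon)\mapsto H^1(f)(h_A)$ induces a bijection between the set of isomorphism classes of $x_0$-framed (respectively, $x_0$-framed non-degenerate) holomorphic affine rank 2 bundles $(A,\varepsilon)$ on $C$ with $L(A)\simeq E$ and the quotient $H^1(C,\mathcal{E})/\mathrm{Aut}(E)_0$ (respectively, $H^1(C,\mathcal{E})_0/\mathrm{Aut}(E)_0$).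
   Context: Affine bundles. A holomorphic affine bundle of rank $r$ on a complex manifold $X$ is a holomorphic map $\pi:A\to X$ with a maximal atlas of local trivialisations $\pi^{-1}(U)\simeq U\times\mathbb{C}^r$ over $U$ whose fibrewise transition maps belong to the group $\mathrm{Aff}(r,\mathbb{C})$ of affine transformations of $\mathbb{C}^r$. Isomorphisms are biholomorphisms over $X$ which are affine on fibres. The linearisation $L(A)$ is the holomorphic rank $r$ vector bundle whose fibre at $x$ is the vector space of translations of $A_x$; $\mathcal{L}(A)$ is its sheaf of sections. An isomorphism $\psi:A\to A'$ induces a vector bundle isomorphism $L(\psi):L(A)\to L(A')$ (its fibrewise linear part). Let $P_A$ be the principal $\mathrm{Aff}(r,\mathbb{C})$-bundle of affine frames of $A$, $\tilde\rho(z\mapsto Mz+\zeta)=\begin{pmatrix}1&0\\ \zeta&M\end{pmatrix}\in \mathrm{GL}(r+1,\mathbb{C})$, $\tilde L(A)=P_A\times_{\tilde\rho}\mathbb{C}^{r+1}$, with sheaf of sections $\tilde{\mathcal{L}}(A)$; projection on the first coordinate of $\mathbb{C}^{r+1}$ induces an epimorphism $\varphi_A:\tilde{\mathcal{L}}(A)\to\mathcal{O}_X$ with kernel $\mathcal{L}(A)$. The cohomology invariant is $h_A:=\delta(1)\in H^1(X,\mathcal{L}(A))$, where $\delta$ is the connecting morphism of $0\to\mathcal{L}(A)\to\tilde{\mathcal{L}}(A)\to\mathcal{O}_X\to0$. Unstable bundles. A rank 2 bundle $E$ on $C$ is unstable if it is not semistable. $D_E\subset E$ is its maximal destabilising line subbundle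 (the first term of the Harder–Narasimhan filtration), $Q_E=E/D_E$, $p_E:E\to Q_E$ the canonical projection, and $\mathcal{D}_E,\mathcal{Q}_E$ are the associated sheaves. Every automorphism of $E$ preserves $D_E$; $\mathrm{Aut}(E)_0\subset\mathrm{Aut}(E)$ is the closed subgroup of automorphisms inducing the identity on $D_E$. Put $H^1(C,\mathcal{E})_0=\{h\in H^1(C,\mathcal{E})\mid H^1(p_E)(h)\neq0\}$ (cohomology classes with non-zero image in $H^1(C,\mathcal{Q}_E)$). A rank 2 affine bundle $A$ on $C$ with $L(A)$ unstable is non-degenerate if $H^1(p_{L(A)})(h_A)\neq0$ in $H^1(C,\mathcal{Q}_{L(A)})$. An $x_0$-framing of such an $A$ is a linear isomorphism $\varepsilon:\mathbb{C}\to D_{L(A),x_0}$; an $x_0$-framed affine bundle is a pair $(A,\varepsilon)$, and an isomorphism $(A,\varepsilon)\to(A',\varepsilon')$ is an affine bundle isomorphism $\psi:A\to A'$ with $L(\psi)\circ\varepsilon=\varepsilon'$. In (1) the induced map sends the class of $A$ to the orbit of $H^1(f)(h_A)$ for any isomorphism $f:L(A)\to E$. *)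

(* Defs.v *)
From HB Require Import structures.
From mathcomp Require Import all_boot all_order all_algebra complex.
From mathcomp Require Import all_classical all_reals topology normedtype derive.

Set Implicit Arguments.
Unset Strict Implicit.
Unset Printing Implicit Defensive.

Import Order.TTheory GRing.Theory Num.Theory numFieldNormedType.Exports.
Local Open Scope classical_set_scope.
Local Open Scope ring_scope.

(** * Compact Riemann surfaces

   The field of complex numbers is [R[i]] for [R : realType]; [R[i]^o] is the
   same type seen as a normed space over itself, so that
   [derivable (f : R[i]^o -> R[i]^o) z 1] is complex differentiability at z. *)

Record chart (R : realType) (T : topologicalType) := Chart {
  cdom : set T;
  cfwd : T -> R[i]^o;
  cbwd : R[i]^o -> T;
  cdom_open : open cdom;
  cimg_open : open (cfwd @` cdom);
  cfwdK : forall x, cdom x -> cbwd (cfwd x) = x;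
  cfwd_cont : forall x, cdom x -> {for x, continuous cfwd};
  cbwd_cont : forall x, cdom x -> {for cfwd x, continuous cbwd} }.

Record compact_riemann_surface (R : realType) := CompactRiemannSurface {
  rs_sort :> topologicalType;
  rs_atlas : set (chart R rs_sort);
  rs_cover : forall x, exists2 c, rs_atlas c & cdom c x;
  rs_compat : forall c c', rs_atlas c -> rs_atlas c' ->
    forall x, cdom c x -> cdom c' x ->
    derivable (cfwd c' \o cbwd c) (cfwd c x) 1;
  rs_hausdorff : hausdorff_space rs_sort;
  rs_compact : compact [set: rs_sort];
  rs_connected : connected [set: rs_sort] }.

Section Holomorphic.
Context {R : realType} {X : compact_riemann_surface R}.

Definition holo_at (f : X -> R[i]) (x : X) : Prop :=
  forall c, rs_atlas c -> cdom c x ->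
  derivable (f \o cbwd c : R[i]^o -> R[i]^o) (cfwd c x) 1.

(* Only used for open U. *)
Definition holo (U : set X) (f : X -> R[i]) : Prop :=
  forall x, U x -> holo_at f x.

Definition mxholo (U : set X) m n (M : X -> 'M[R[i]]_(m, n)) : Prop :=
  forall i j, holo U (fun x => M x i j).

Lemma holo_at_cst (a : R[i]) x : holo_at (fun=> a) x.
Proof. by move=> c _ _; exact: derivable_cst. Qed.

Lemma holo_atD f g x :
  holo_at f x -> holo_at g x -> holo_at (fun y => f y + g y) x.
Proof.
move=> hf hg c ca cx.
exact: (derivableD (hf c ca cx) (hg c ca cx)).
Qed.

Lemma holo_atM f g x :
  holo_at f x -> holo_at g x -> holo_at (fun y => f y * g y) x.
Proof.
move=> hf hg c ca cx.
exact: (@derivableM R[i] R[i]^o _ _ _ _ (hf c ca cx) (hg c ca cx)).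
Qed.

Lemma holo_at_local (U : set X) f g x : open U -> U x ->
  (forall y, U y -> f y = g y) -> holo_at f x -> holo_at g x.
Proof.
move=> oU Ux fg hf c ca cx.
have UN : nbhs (cbwd c (cfwd c x)) U by rewrite cfwdK//; exact: open_nbhs_nbhs.
have cU : \forall z \near cfwd c x, U (cbwd c z) by exact: (cbwd_cont cx) UN.
apply: near_eq_derivable (hf c ca cx).
by near=> z; apply: fg; near: z.
Unshelve. all: by end_near. Qed.

Lemma mxholo_cst (U : set X) m n (M : 'M[R[i]]_(m, n)) : mxholo U (fun=> M).
Proof. by move=> i j x _; exact: holo_at_cst. Qed.

Lemma mxholo_local (U V : set X) m n (M N : X -> 'M[R[i]]_(m, n)) :
  open V -> V `<=` U -> (forall y, V y -> M y = N y) -> mxholo U M -> mxholo V N.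
Proof.
move=> oV VU MN hM i j x Vx; apply: (holo_at_local oV Vx _ (hM i j x (VU x Vx))).
by move=> y Vy /=; rewrite MN.
Qed.

Lemma holo_at_sum (I : Type) (r : seq I) (F : I -> X -> R[i]) x :
  (forall i, holo_at (F i) x) -> holo_at (fun y => \sum_(i <- r) F i y) x.
Proof.
move=> hF; elim: r => [|i r IH].
  rewrite (_ : (fun y => _) = fun=> 0); first exact: holo_at_cst.
  by apply/funext => y; rewrite big_nil.
rewrite (_ : (fun y => _) = fun y => F i y + \sum_(j <- r) F j y).
  exact: (holo_atD (hF i) IH).
by apply/funext => y; rewrite big_cons.
Qed.

Lemma mxholoM (U : set X) m n p (M : X -> 'M[R[i]]_(m, n))
    (N : X -> 'M[R[i]]_(n, p)) :
  mxholo U M -> mxholo U N -> mxholo U (fun x => M x *m N x).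
Proof.
move=> hM hN i j x Ux.
rewrite (_ : (fun y => _) = fun y => \sum_k M y i k * N y k j).
  by apply: holo_at_sum => k; exact: (holo_atM (hM i k x Ux) (hN k j x Ux)).
by apply/funext => y; rewrite mxE.
Qed.

Lemma mxholoD (U : set X) m n (M N : X -> 'M[R[i]]_(m, n)) :
  mxholo U M -> mxholo U N -> mxholo U (fun x => M x + N x).
Proof.
move=> hM hN i j x Ux.
rewrite (_ : (fun y => _) = fun y => M y i j + N y i j).
  exact: (holo_atD (hM i j x Ux) (hN i j x Ux)).
by apply/funext => y; rewrite mxE.
Qed.

Lemma mxholoS (U V : set X) m n (M : X -> 'M[R[i]]_(m, n)) :
  V `<=` U -> mxholo U M -> mxholo V M.
Proof. by move=> VU hM i j x /VU; exact: hM. Qed.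

End Holomorphic.

(** * Affine and vector bundles

   A bundle over X is given by the family [F : X -> Type] of its fibres; its
   total space is {x : X & F x}.  A local trivialisation over an open set U is
   a map [tmap] identifying F x with C^r for x in U (its values outside U are
   irrelevant). *)

Record ltriv (R : realType) (X : compact_riemann_surface R) (F : X -> Type)
    (r : nat) := LTriv {
  tdom : set X;
  tmap : forall x, F x -> 'cV[R[i]]_r;
  tdom_open : open tdom;
  tmap_bij : forall x, tdom x -> bijective (@tmap x) }.

Section Bundles.
Context {R : realType} {X : compact_riemann_surface R}.

(* In the trivialisations t and t' the fibrewise map f reads
   (x, z) |-> (x, N(x) z) with N holomorphic. *)
Definition lin_in (F F' : X -> Type) r s (f : forall x, F x -> F' x)
    (t : ltriv F r) (t' : ltriv F' s) : Prop :=
  exists2 N : X -> 'M[R[i]]_(s, r), mxholo (tdom t `&` tdom t') N &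
    forall x, tdom t x -> tdom t' x -> forall v,
    tmap t' (f x v) = N x *m tmap t v.

(* Likewise, (x, z) |-> (x, N(x) z + b(x)) with N and b holomorphic. *)
Definition aff_in (F F' : X -> Type) r s (f : forall x, F x -> F' x)
    (t : ltriv F r) (t' : ltriv F' s) : Prop :=
  exists (N : X -> 'M[R[i]]_(s, r)) (b : X -> 'cV[R[i]]_s),
    [/\ mxholo (tdom t `&` tdom t') N, mxholo (tdom t `&` tdom t') b &
    forall x, tdom t x -> tdom t' x -> forall v,
    tmap t' (f x v) = N x *m tmap t v + b x].

(* The matrices in the transition maps are automatically invertible, since
   trivialisations are fibrewise bijective. *)
Definition lin_compat (F : X -> Type) r (t t' : ltriv F r) : Prop :=
  lin_in (fun x => @id (F x)) t t'.

Definition aff_compat (F : X -> Type) r (t t' : ltriv F r) : Prop :=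
  aff_in (fun x => @id (F x)) t t'.

End Bundles.

Record abundle (R : realType) (X : compact_riemann_surface R) (r : nat) :=
  ABundle {
  afib :> X -> Type;
  aatlas : set (ltriv afib r);
  acover : forall x, exists2 t, aatlas t & tdom t x;
  acompat : forall t t', aatlas t -> aatlas t' -> aff_compat t t';
  amax : forall t,
    (forall t', aatlas t' -> aff_compat t t' /\ aff_compat t' t) -> aatlas t }.

Record vbundle (R : realType) (X : compact_riemann_surface R) (r : nat) :=
  VBundle {
  vfib : X -> Type;
  vatlas : set (ltriv vfib r);
  vcover : forall x, exists2 t, vatlas t & tdom t x;
  vcompat : forall t t', vatlas t -> vatlas t' -> lin_compat t t' }.

Arguments aatlas {R X r}.
Arguments vatlas {R X r}.

Lemma bij_of_inj_surj (T U : Type) (f : T -> U) :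
  injective f -> (forall y, exists x, f x = y) -> bijective f.
Proof.
move=> fi fs; pose g y := projT1 (cid (fs y)).
have gK : cancel g f by move=> y; rewrite /g; case: cid.
by exists g => // x; apply: fi; rewrite gK.
Qed.

Lemma bij_surj (T U : Type) (f : T -> U) (y : U) :
  bijective f -> exists x, f x = y.
Proof. by case=> g _ gK; exists (g y). Qed.

(** ** The vector space structure of the fibres

   The fibre of a vector bundle carries the unique vector space structure for
   which all trivialisations are linear; it is transported from C^r by some
   trivialisation around x, and [tmapD], [tmapZ], [tmap0] show that it does not
   depend on the choice. *)

Definition fibre (R : realType) (X : compact_riemann_surface R) r
  (E : vbundle X r) (x : X) := vfib E x.

Section Fibre.
Context {R : realType} {X : compact_riemann_surface R} {r : nat}.
Variables (E : vbundle X r) (x : X).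

Let t0 := projT1 (cid2 (vcover E x)).
Let t0_atlas : vatlas E t0. Proof. by rewrite /t0; case: cid2. Qed.
Let t0_dom : tdom t0 x. Proof. by rewrite /t0; case: cid2. Qed.

Definition coord : fibre E x -> 'cV[R[i]]_r := @tmap _ _ _ _ t0 x.

Lemma coord_surj z : exists v, coord v = z.
Proof. exact/bij_surj/tmap_bij. Qed.

Definition coordV z : fibre E x := projT1 (cid (coord_surj z)).

Lemma coordVK : cancel coordV coord.
Proof. by move=> z; rewrite /coordV; case: cid. Qed.

Lemma coordK : cancel coord coordV.
Proof.
have /bij_inj ci : bijective coord by exact: tmap_bij.
by move=> v; apply: ci; rewrite coordVK.
Qed.

HB.instance Definition _ := Choice.copy (fibre E x) (can_type coordK).

Definition fibre_add (v w : fibre E x) := coordV (coord v + coord w).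
Definition fibre_opp (v : fibre E x) := coordV (- coord v).
Definition fibre_zero : fibre E x := coordV 0.
Definition fibre_scale (a : R[i]) (v : fibre E x) := coordV (a *: coord v).

Fact fibre_addA : associative fibre_add.
Proof. by move=> u v w; rewrite /fibre_add !coordVK addrA. Qed.
Fact fibre_addC : commutative fibre_add.
Proof. by move=> u v; rewrite /fibre_add addrC. Qed.
Fact fibre_add0 : left_id fibre_zero fibre_add.
Proof. by move=> u; rewrite /fibre_add coordVK add0r coordK. Qed.
Fact fibre_addN : left_inverse fibre_zero fibre_opp fibre_add.
Proof. by move=> u; rewrite /fibre_add coordVK addNr. Qed.

HB.instance Definition _ := GRing.isZmodule.Build (fibre E x)
  fibre_addA fibre_addC fibre_add0 fibre_addN.

Fact fibre_scaleA a b v : fibre_scale a (fibre_scale b v) = fibre_scale (a * b) v.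
Proof. by rewrite /fibre_scale coordVK scalerA. Qed.
Fact fibre_scale1 : left_id 1 fibre_scale.
Proof. by move=> v; rewrite /fibre_scale scale1r coordK. Qed.
Fact fibre_scaleDr : right_distributive fibre_scale +%R.
Proof.
by move=> a u v; rewrite /fibre_scale /GRing.add/= /fibre_add !coordVK scalerDr.
Qed.
Fact fibre_scaleDl v : {morph fibre_scale^~ v : a b / a + b}.
Proof.
by move=> a b; rewrite /fibre_scale {2}/GRing.add/= /fibre_add !coordVK scalerDl.
Qed.

HB.instance Definition _ := GRing.Zmodule_isLmodule.Build R[i] (fibre E x)
  fibre_scaleA fibre_scale1 fibre_scaleDr fibre_scaleDl.

Section Linear.
Variable t : ltriv (vfib E) r.
Hypotheses (ta : vatlas E t) (tx : tdom t x).

Let tE : exists N : 'M_r, forall v : fibre E x, tmap t v = N *m coord v.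
Proof.
have [N _ h] := vcompat t0_atlas ta.
by exists (N x) => v; exact: h.
Qed.

Lemma tmapD (v w : fibre E x) : tmap t (v + w : fibre E x) = tmap t v + tmap t w.
Proof. by case: tE => N h; rewrite !h -mulmxDr coordVK. Qed.

Lemma tmapZ (a : R[i]) (v : fibre E x) :
  tmap t (a *: v : fibre E x) = a *: tmap t v.
Proof. by case: tE => N h; rewrite !h scalemxAr coordVK. Qed.

Lemma tmap0 : tmap t (0 : fibre E x) = 0.
Proof. by case: tE => N h; rewrite !h coordVK mulmx0. Qed.

Lemma tmapB (v w : fibre E x) : tmap t (v - w : fibre E x) = tmap t v - tmap t w.
Proof. by rewrite -scaleN1r tmapD tmapZ scaleN1r. Qed.

Lemma tmap_inj (v w : fibre E x) : tmap t v = tmap t w -> v = w.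
Proof. by move=> vw; apply: (bij_inj (tmap_bij tx)). Qed.

End Linear.
End Fibre.

Lemma eq_mulmx_cV (K : pzSemiRingType) m n (M N : 'M[K]_(m, n)) :
  (forall v : 'cV_n, M *m v = N *m v) -> M = N.
Proof.
move=> MN; apply/matrixP => i j; have := MN (delta_mx j 0).
by rewrite -!colE => /matrixP /(_ i 0); rewrite !mxE.
Qed.

Section Local.
Context {R : realType} {X : compact_riemann_surface R}.

Lemma lin_in_local (F F' : X -> Type) r s (f : forall x, F x -> F' x)
    (t : ltriv F r) (t' : ltriv F' s) :
  (forall x, tdom t x -> tdom t' x ->
    exists (W : set X) (N : X -> 'M[R[i]]_(s, r)),
    [/\ open W, W x, mxholo W N &
      forall y, W y -> tdom t y -> tdom t' y ->
      forall v, tmap t' (f y v) = N y *m tmap t v]) ->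
  lin_in f t t'.
Proof.
move=> loc; pose U := tdom t `&` tdom t'.
have pt x : exists N : 'M_(s, r), U x ->
    forall v, tmap t' (f x v) = N *m tmap t v.
  have [Ux|nUx] := pselect (U x); last by exists 0.
  have [W [N [_ Wx _ h]]] := loc x Ux.1 Ux.2.
  by exists (N x) => _ v; exact: h Ux.1 Ux.2 _.
pose M x := projT1 (cid (pt x)).
have ME x : U x -> forall v, tmap t' (f x v) = M x *m tmap t v.
  by rewrite /M; case: cid.
exists M => [i j x Ux|x tx t'x v]; last exact: ME.
have [W [N [oW Wx hN h]]] := loc x Ux.1 Ux.2.
have oU : open U by apply: openI; exact: tdom_open.
apply: (holo_at_local (openI oW oU) _ _ (hN i j x Wx)) => // y [Wy Uy].
suff -> : N y = M y by [].
apply: eq_mulmx_cV => z.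
have [v <-] := bij_surj z (tmap_bij Uy.1).
by rewrite -h ?ME//; case: Uy.
Qed.

(** A holomorphic local trivialisation of E, not necessarily in its atlas. *)
Definition vtriv r (E : vbundle X r) (t : ltriv (vfib E) r) : Prop :=
  forall t', vatlas E t' -> lin_compat t t' /\ lin_compat t' t.

Lemma vtriv_compat r (E : vbundle X r) (t t' : ltriv (vfib E) r) :
  vtriv t -> vtriv t' -> lin_compat t t'.
Proof.
move=> ht ht'; apply: lin_in_local => x tx t'x.
have [u ua ux] := vcover E x.
have [[N hN NE] _] := ht u ua; have [_ [N' hN' NE']] := ht' u ua.
exists (tdom t `&` tdom t' `&` tdom u), (fun x => N' x *m N x); split => //.
- by do 2![apply: openI; last exact: tdom_open]; exact: tdom_open.
- apply: mxholoM.
    by apply: mxholoS hN' => y [[? ?] ?].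
  by apply: mxholoS hN => y [[? ?] ?].
- move=> y [_ uy] ty t'y v.
  by rewrite NE'// NE// mulmxA.
Qed.

End Local.

(** ** The trivial bundle; [O_X] is the case of rank 1 *)

Section Trivial.
Context {R : realType} (X : compact_riemann_surface R) (r : nat).

Definition trivial_ltriv : ltriv (fun _ : X => 'cV[R[i]]_r) r :=
  @LTriv _ _ _ _ setT (fun _ => id) openT
    (fun x _ => @Bijective _ _ id id (fun _ => erefl) (fun _ => erefl)).

Fact trivial_cover (x : X) :
  exists2 t, [set trivial_ltriv] t & tdom t x.
Proof. by exists trivial_ltriv. Qed.

Fact trivial_compat t t' : [set trivial_ltriv] t -> [set trivial_ltriv] t' ->
  lin_compat t t'.
Proof.
move=> -> ->; exists (fun=> 1%:M); first exact: mxholo_cst.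
by move=> x _ _ v; rewrite mul1mx.
Qed.

Definition trivial_bundle : vbundle X r := VBundle trivial_cover trivial_compat.

End Trivial.

(** ** The linearisation L(A) *)

Section Linearisation.
Context {R : realType} {X : compact_riemann_surface R} {r : nat}.
Variable A : abundle X r.

Definition is_translation x (u : A x -> A x) : Prop :=
  forall t, aatlas A t -> tdom t x ->
  exists v, forall a, tmap t (u a) = tmap t a + v.

Record translation (x : X) := Translation {
  tr_fun :> A x -> A x;
  tr_funP : is_translation tr_fun }.

Lemma translation_eq x (u u' : translation x) : u =1 u' -> u = u'.
Proof.
case: u u' => [u up] [u' up'] /= uu'.
move: up up'; rewrite (funext uu') => up up'.
by rewrite (Prop_irrelevance up up').
Qed.

Fact abase_subproof x : exists a : A x, True.
Proof.
by have [t _ tx] := acover A x; have [a _] := bij_surj 0 (tmap_bij tx); exists a.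
Qed.

Definition abase x : A x := projT1 (cid (abase_subproof x)).

(* The translation vector of u in the affine coordinates t; the choice of
   [abase] does not matter. *)
Definition tr_vec (t : ltriv A r) x (u : translation x) : 'cV[R[i]]_r :=
  tmap t (u (abase x)) - tmap t (abase x).

Lemma tr_vecE t x (u : translation x) a : aatlas A t -> tdom t x ->
  tmap t (u a) = tmap t a + tr_vec t u.
Proof.
move=> ta tx; have [v h] := tr_funP u ta tx.
by rewrite /tr_vec !h [_ + v - _]addrAC subrr add0r.
Qed.

Fact tr_vec_bij t : aatlas A t -> forall x, tdom t x -> bijective (@tr_vec t x).
Proof.
move=> ta x tx; apply: bij_of_inj_surj => [u u' uu'|z].
  apply: translation_eq => a; apply: (bij_inj (tmap_bij tx)).
  by rewrite !tr_vecE// uu'.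
pose w (a : A x) := projT1 (cid (bij_surj (tmap t a + z) (tmap_bij tx))).
have wE (a : A x) : tmap t (w a) = tmap t a + z by rewrite /w; case: cid.
have wP : is_translation w.
  move=> t' t'a t'x; have [M [b [_ _ h]]] := acompat ta t'a.
  exists (M x *m z) => a; rewrite h// [in RHS]h// wE mulmxDr.
  by rewrite -!addrA [_ *m z + _]addrC.
by exists (Translation wP); rewrite /tr_vec/= wE addrC addKr.
Qed.

Definition lin_ltriv t (ta : aatlas A t) : ltriv translation r :=
  LTriv (tdom_open t) (tr_vec_bij ta).

Definition lin_atlas : set (ltriv translation r) :=
  [set l | exists t (ta : aatlas A t), l = lin_ltriv ta].

Fact lin_cover x : exists2 l, lin_atlas l & tdom l x.
Proof.
have [t ta tx] := acover A x.
by exists (lin_ltriv ta) => //; exists t, ta.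
Qed.

Fact lin_atlas_compat l l' : lin_atlas l -> lin_atlas l' -> lin_compat l l'.
Proof.
move=> [t [ta ->]] [t' [t'a ->]]; have [M [b [hM hb h]]] := acompat ta t'a.
exists M => // x /= tx t'x u.
by rewrite /tr_vec !h// mulmxBr opprD addrACA subrr addr0.
Qed.

Definition linearisation : vbundle X r := VBundle lin_cover lin_atlas_compat.

End Linearisation.

(** ** The bundle P_A x_rho C^(1+r) associated with the affine frame bundle *)

Section Associated.
Context {R : realType} {X : compact_riemann_surface R} {r : nat}.
Variable A : abundle X r.

(* An affine frame at x is an affine isomorphism C^r -> A_x. *)
Record aframe (x : X) := AFrame {
  fr :> 'cV[R[i]]_r -> A x;
  frP : forall t, aatlas A t -> tdom t x ->
    exists M b, M \in unitmx /\ forall z, tmap t (fr z) = M *m z + b }.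

(* The representation z |-> M z + b  of Aff(r) on C^(1+r). *)
Definition aff_rho (M : 'M[R[i]]_r) (b : 'cV[R[i]]_r) : 'M[R[i]]_(1 + r) :=
  block_mx 1%:M 0 b M.

(* The class of (p, v) in P_A x_rho C^(1+r), i.e. its class modulo
   (p o g, w) ~ (p, rho(g) w). *)
Definition assoc_class x (p : aframe x) (v : 'cV[R[i]]_(1 + r)) :
    aframe x -> 'cV[R[i]]_(1 + r) -> Prop :=
  fun q w => exists M b,
    [/\ M \in unitmx, forall z, q z = p (M *m z + b) & v = aff_rho M b *m w].

Definition assoc_fib (x : X) :=
  {c : aframe x -> 'cV[R[i]]_(1 + r) -> Prop | exists p v, c = assoc_class p v}.

Lemma aframe_eq x (p q : aframe x) : p =1 q -> p = q.
Proof.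
case: p q => [p pP] [q qP] /= pq.
move: pP qP; rewrite (funext pq) => pP qP.
by rewrite (Prop_irrelevance pP qP).
Qed.

Lemma aff_rhoM M b M' b' : aff_rho M b *m aff_rho M' b' = aff_rho (M *m M') (M *m b' + b).
Proof.
rewrite /aff_rho mulmx_block !mul1mx ?mul0mx ?mulmx0 ?mulmx1 ?addr0 ?add0r//.
by rewrite [b + _]addrC.
Qed.

Lemma aff_rho1 : aff_rho 1%:M 0 = 1%:M.
Proof. by rewrite /aff_rho -scalar_mx_block. Qed.

Lemma assoc_class_refl x (p : aframe x) v : assoc_class p v p v.
Proof.
exists 1%:M, 0; split; first exact: unitmx1.
  by move=> z; rewrite mul1mx addr0.
by rewrite aff_rho1 mul1mx.
Qed.

Lemma assoc_class_sym x (p q : aframe x) v w :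
  assoc_class p v q w -> assoc_class q w p v.
Proof.
move=> [M [b [Mu qp ->]]].
exists (invmx M), (- (invmx M *m b)); split; first by rewrite unitmx_inv.
  by move=> z; rewrite qp mulmxBr !mulmxA mulmxV// !mul1mx subrK.
by rewrite mulmxA aff_rhoM mulVmx// subrr aff_rho1 mul1mx.
Qed.

Lemma assoc_class_trans x (p q s : aframe x) u v w :
  assoc_class p u q v -> assoc_class q v s w -> assoc_class p u s w.
Proof.
move=> [M [b [Mu qp ->]]] [M' [b' [M'u sq ->]]].
exists (M *m M'), (M *m b' + b); split; first by rewrite unitmx_mul Mu.
  by move=> z; rewrite sq qp mulmxDr mulmxA addrA.
by rewrite mulmxA aff_rhoM.
Qed.

Lemma assoc_class_eq x (p q : aframe x) v w :
  assoc_class p v q w -> assoc_class p v = assoc_class q w.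
Proof.
move=> pq; apply/funext => s; apply/funext => u; apply/propext; split.
  exact/assoc_class_trans/assoc_class_sym.
exact: assoc_class_trans.
Qed.

Lemma acompat_unit t t' x M b : aatlas A t -> aatlas A t' ->
  tdom t x -> tdom t' x ->
  (forall a : A x, tmap t' a = M *m tmap t a + b) -> M \in unitmx.
Proof.
move=> ta t'a tx t'x h; have [N [c [_ _ g]]] := acompat t'a ta.
suff /mulmx1_unit[] : N x *m M = 1%:M by [].
apply: eq_mulmx_cV => z; rewrite mul1mx.
have e (a : A x) : tmap t a = N x *m M *m tmap t a + (N x *m b + c x).
  by rewrite [LHS](g x t'x tx a) h mulmxDr mulmxA addrA.
have [a <-] := bij_surj z (tmap_bij tx); have [o oE] := bij_surj 0 (tmap_bij tx).
have := e o; rewrite oE mulmx0 add0r => c0.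
by rewrite [RHS]e -c0 addr0.
Qed.

Fact frame_of_subproof t x : aatlas A t -> tdom t x ->
  exists q : aframe x, cancel (@tmap _ _ _ _ t x) q.
Proof.
move=> ta tx; pose q z := projT1 (cid (bij_surj z (tmap_bij tx))).
have qK z : tmap t (q z) = z by rewrite /q; case: cid.
have qP : forall t', aatlas A t' -> tdom t' x ->
    exists M b, M \in unitmx /\ forall z, tmap t' (q z) = M *m z + b.
  move=> t' t'a t'x; have [M [b [_ _ h]]] := acompat ta t'a.
  exists (M x), (b x); split; first by apply: (acompat_unit ta t'a tx t'x) => a; exact: h.
  by move=> z; rewrite h// qK.
exists (AFrame qP) => a /=.
by apply: (bij_inj (tmap_bij tx)); rewrite qK.
Qed.

Lemma frames_transitive x (p q : aframe x) v : exists w, assoc_class p v q w.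
Proof.
have [t ta tx] := acover A x.
have [M [b [Mu pE]]] := frP p ta tx; have [N [c [Nu qE]]] := frP q ta tx.
pose K := invmx M *m N; pose d := invmx M *m (c - b).
have Ku : K \in unitmx by rewrite unitmx_mul unitmx_inv Mu.
exists (aff_rho (invmx K) (- (invmx K *m d)) *m v), K, d; split => //.
  move=> z; apply: (bij_inj (tmap_bij tx)); rewrite pE qE.
  by rewrite /K /d mulmxDr !mulmxA mulmxV// !mul1mx addrA subrK.
by rewrite mulmxA aff_rhoM mulmxV// mulmxN mulmxA mulmxV// mul1mx addrC subrr aff_rho1 mul1mx.
Qed.

(* In the trivialisation of A by t, the class of (p, v) has the coordinates v,
   where p is the affine frame inverse to [tmap t]. *)
Definition assoc_coord (t : ltriv A r) x (c : assoc_fib x) : 'cV[R[i]]_(1 + r) :=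
  xget 0 [set v | exists2 q : aframe x, cancel (@tmap _ _ _ _ t x) q & sval c q v].

Lemma assoc_coordP t x (c : assoc_fib x) (q : aframe x) :
  tdom t x -> cancel (@tmap _ _ _ _ t x) q ->
  forall v, assoc_coord t c = v <-> sval c q v.
Proof.
move=> tx qK; case: c => c [p [u cE]]; rewrite /assoc_coord/=.
have qu (q' : aframe x) : cancel (@tmap _ _ _ _ t x) q' -> q' = q.
  move=> q'K; apply: aframe_eq => z.
  by have [a <-] := bij_surj z (tmap_bij tx); rewrite q'K qK.
have uniq_c v w : c q v -> c q w -> v = w.
  rewrite cE => /assoc_class_sym h1 /(assoc_class_trans h1) [M [b [_ qq ->]]].
  have [t1 ta1 tx1] := acover A x; have [K [d [Ku qE]]] := frP q ta1 tx1.
  have Mz z : z = M *m z + b.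
    have := congr1 (@tmap _ _ _ _ t1 x) (qq z); rewrite !qE => /addIr.
    by move=> /(congr1 (mulmx (invmx K))); rewrite !mulmxA mulVmx// !mul1mx.
  have b0 : b = 0 by have := Mz 0; rewrite mulmx0 add0r.
  have -> : M = 1%:M.
    by apply: eq_mulmx_cV => z; rewrite mul1mx [RHS]Mz b0 addr0.
  by rewrite b0 aff_rho1 mul1mx.
have [w cw] : exists w, c q w by rewrite cE; exact: frames_transitive.
have gw : xget 0 [set v | exists2 q0 : aframe x,
    cancel (@tmap _ _ _ _ t x) q0 & c q0 v] = w.
  apply: xget_unique => [|v [q' q'K]]; first by exists q.
  by rewrite (qu _ q'K) => cv; exact: uniq_c cv cw.
rewrite gw => v; split => [<-//|cv]; exact: uniq_c cw cv.
Qed.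

Fact assoc_coord_bij t : aatlas A t ->
  forall x, tdom t x -> bijective (@assoc_coord t x).
Proof.
move=> ta x tx; have [q qK] := frame_of_subproof ta tx.
apply: bij_of_inj_surj => [c c' cc'|v].
  have /(assoc_coordP _ tx qK) h := erefl (assoc_coord t c).
  have /(assoc_coordP _ tx qK) := erefl (assoc_coord t c'); rewrite -cc'.
  move: (assoc_coord t c) h => v.
  case: c c' {cc'} => [c [p [u cE]]] [c' [p' [u' cE']]] /= h h'.
  apply: eq_exist; rewrite cE in h *; rewrite cE' in h' *.
  by rewrite (assoc_class_eq h) (assoc_class_eq h').
have cP : exists p w, assoc_class q v = assoc_class p w by exists q, v.
exists (exist (fun c => exists p w, c = assoc_class p w) _ cP); apply/(assoc_coordP _ tx qK) => /=.
exact: assoc_class_refl.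
Qed.

Definition assoc_ltriv t (ta : aatlas A t) : ltriv assoc_fib (1 + r) :=
  LTriv (tdom_open t) (assoc_coord_bij ta).

Definition assoc_atlas : set (ltriv assoc_fib (1 + r)) :=
  [set l | exists t (ta : aatlas A t), l = assoc_ltriv ta].

Fact assoc_cover x : exists2 l, assoc_atlas l & tdom l x.
Proof.
have [t ta tx] := acover A x.
by exists (assoc_ltriv ta) => //; exists t, ta.
Qed.

Lemma mxholo_aff_rho (U : set X) (M : X -> 'M[R[i]]_r) (b : X -> 'cV[R[i]]_r) :
  mxholo U M -> mxholo U b -> mxholo U (fun x => aff_rho (M x) (b x)).
Proof.
move=> hM hb i j x Ux; rewrite /aff_rho /block_mx.
rewrite (_ : (fun y => _) = fun y => match fintype.split i, fintype.split j with
  | inl k, inl l => (1%:M : 'M[R[i]]_1) k l | inl k, inr l => 0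
  | inr k, inl l => b y k l | inr k, inr l => M y k l end).
  case: (fintype.split i) => k; case: (fintype.split j) => l.
  - exact: (@holo_at_cst _ _ ((1%:M : 'M[R[i]]_1) k l)).
  - exact: (@holo_at_cst _ _ 0).
  - exact: (hb k l x Ux).
  - exact: (hM k l x Ux).
apply/funext => y; rewrite !mxE.
by case: (fintype.split i) => k; rewrite !mxE; case: (fintype.split j) => l; rewrite ?mxE.
Qed.

Fact assoc_atlas_compat l l' : assoc_atlas l -> assoc_atlas l' -> lin_compat l l'.
Proof.
move=> [t [ta ->]] [t' [t'a ->]]; have [M [b [hM hb h]]] := acompat ta t'a.
exists (fun x => aff_rho (M x) (b x)); first exact: mxholo_aff_rho.
move=> x /= tx t'x c.
have [q qK] := frame_of_subproof ta tx; have [q' q'K] := frame_of_subproof t'a t'x.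
apply/(assoc_coordP _ t'x q'K).
have /(assoc_coordP _ tx qK) := erefl (assoc_coord t c).
move: (assoc_coord t c) => v; case: c => c [p [u cE]] /=; rewrite !cE => hv.
apply: (assoc_class_trans hv); apply: assoc_class_sym.
exists (M x), (b x); split => //.
  by apply: (acompat_unit ta t'a tx t'x) => a; exact: h.
move=> z; have [a <-] := bij_surj z (tmap_bij tx).
by rewrite qK -h// q'K.
Qed.

Definition assoc_bundle : vbundle X (1 + r) :=
  VBundle assoc_cover assoc_atlas_compat.

End Associated.

(** ** Morphisms *)

Section Morphisms.
Context {R : realType} {X : compact_riemann_surface R}.

(* Holomorphic maps over X which are linear on the fibres. *)
Record vmorph r s (E : vbundle X r) (E' : vbundle X s) := VMorph {
  vm_fun :> forall x, fibre E x -> fibre E' x;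
  vm_holo : forall t t', vatlas E t -> vatlas E' t' -> lin_in vm_fun t t' }.

Record viso r (E E' : vbundle X r) := VIso {
  vi_fun :> vmorph E E';
  vi_inv : vmorph E' E;
  vi_funK : forall x, cancel (vi_fun x) (vi_inv x);
  vi_invK : forall x, cancel (vi_inv x) (vi_fun x) }.

(* Biholomorphic maps over X which are affine on the fibres. *)
Record aiso r (A A' : abundle X r) := AIso {
  ai_fun :> forall x, A x -> A' x;
  ai_inv : forall x, A' x -> A x;
  ai_funK : forall x, cancel (@ai_fun x) (@ai_inv x);
  ai_invK : forall x, cancel (@ai_inv x) (@ai_fun x);
  ai_holo : forall t t', aatlas A t -> aatlas A' t' -> aff_in ai_fun t t';
  ai_inv_holo : forall t t', aatlas A t -> aatlas A' t' -> aff_in ai_inv t' t }.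

Section LinPart.
Context {r : nat} {A A' : abundle X r}.
Variables (psi : aiso A A') (x : X).

Fact lin_part_subproof (u : translation A x) :
  is_translation (fun a => psi x (u (ai_inv psi a))).
Proof.
move=> t' t'a t'x; have [t ta tx] := acover A x.
have [N [b [_ _ h]]] := ai_holo psi ta t'a.
have [v uE] := tr_funP u ta tx.
exists (N x *m v) => a; rewrite h// uE mulmxDr addrAC -h//.
by rewrite ai_invK.
Qed.

(** The value L(psi) : L(A) -> L(A') of the linear part at x. *)
Definition lin_part (u : fibre (linearisation A) x) :
  fibre (linearisation A') x := Translation (lin_part_subproof u).

End LinPart.

Section MorphTheory.
Context {r s : nat} {E : vbundle X r} {E' : vbundle X s}.
Variable f : vmorph E E'.

Lemma vmorph_linear x (a : R[i]) (v w : fibre E x) :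
  f x (a *: v + w) = a *: f x v + f x w.
Proof.
have [t ta tx] := vcover E x; have [t' t'a t'x] := vcover E' x.
have [N _ h] := vm_holo f ta t'a.
apply: (tmap_inj t'x); rewrite tmapD// tmapZ// !h// tmapD// tmapZ//.
by rewrite mulmxDr scalemxAr.
Qed.

Lemma vmorphD x (v w : fibre E x) : f x (v + w) = f x v + f x w.
Proof. by rewrite -[v]scale1r vmorph_linear !scale1r. Qed.

End MorphTheory.
End Morphisms.

(** * Cohomology

   Sections are functions [s : forall x, fibre E x] that are only considered
   over an open set.  H^1(X, E) is Cech cohomology of the sheaf of holomorphic
   sections, i.e. the direct limit over all open covers. *)

Section Cohomology.
Context {R : realType} {X : compact_riemann_surface R}.

Definition hsec r (E : vbundle X r) (U : set X)
    (s : forall x, fibre E x) : Prop :=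
  forall t, vatlas E t -> mxholo (U `&` tdom t) (fun x => tmap t (s x)).

Record cocycle r (E : vbundle X r) := Cocycle {
  cidx : Type;
  ccov : cidx -> set X;
  ccov_open : forall i, open (ccov i);
  ccovP : forall x, exists i, ccov i x;
  cval : cidx -> cidx -> forall x, fibre E x;
  cval_holo : forall i j, hsec (ccov i `&` ccov j) (cval i j);
  cval_cocycle : forall i j k x, ccov i x -> ccov j x -> ccov k x ->
    cval i j x + cval j k x = cval i k x }.

Arguments ccov {r E}.
Arguments cval {r E}.

(* The restrictions to some common refinement differ by a coboundary. *)
Definition cohomologous r (E : vbundle X r) (c c' : cocycle E) : Prop :=
  exists (K : Type) (W : K -> set X) (tau : K -> cidx c) (tau' : K -> cidx c')
    (s : K -> forall x, fibre E x),
  [/\ forall k, open (W k) /\ hsec (W k) (s k),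
      forall x, exists k, W k x,
      forall k, W k `<=` ccov c (tau k) `&` ccov c' (tau' k) &
      forall k l x, W k x -> W l x ->
        cval c (tau k) (tau l) x - cval c' (tau' k) (tau' l) x = s l x - s k x].

Lemma hsec0 r (E : vbundle X r) U : hsec U (fun x => 0 : fibre E x).
Proof.
move=> t ta i j x [Ux tx].
apply: (holo_at_local (tdom_open t) tx _ (@holo_at_cst _ _ 0 x)) => y ty /=.
by rewrite tmap0// mxE.
Qed.

Lemma cocycle_glue (V : zmodType) (f1 f2 g2 g3 a a' b b' q q' : V) :
  f1 - f2 = a' - a -> g2 - g3 = b' - b -> f2 + q' = q + g2 ->
  f1 - g3 = a' + b' - q' - (a + b - q).
Proof.
move=> /(canRL (subrK _)) -> h /(canRL (addrK _)) ->.
have -> : g3 = g2 - (b' - b) by rewrite -h opprB addrC subrK.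
rewrite !opprD !opprK !addrA.
by rewrite [LHS](ACl ((1*7*5*2*8*3)*(4*6)))/= subrr addr0.
Qed.

Section CohomologousEquiv.
Context {r : nat} {E : vbundle X r}.

Lemma hsec_lin U (a : R[i]) (s s' : forall x, fibre E x) :
  hsec U s -> hsec U s' -> hsec U (fun x => a *: s x + s' x).
Proof.
move=> hs hs' t ta i j x [Ux tx].
have h : holo_at (fun y => a * tmap t (s y) i j + tmap t (s' y) i j) x.
  apply: (@holo_atD _ _ (fun y => a * tmap t (s y) i j)).
    exact: (holo_atM (@holo_at_cst _ _ a x) (hs t ta i j x (conj Ux tx))).
  exact: (hs' t ta i j x (conj Ux tx)).
apply: (holo_at_local (tdom_open t) tx _ h) => y ty.
by rewrite tmapD// tmapZ// !mxE.
Qed.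

Lemma hsecS U V (s : forall x, fibre E x) : V `<=` U -> hsec U s -> hsec V s.
Proof. by move=> VU hs t ta; apply: mxholoS (hs t ta) => x [/VU]. Qed.

Lemma cohomologous_refl (c : cocycle E) : cohomologous c c.
Proof.
exists (cidx c), (ccov c), id, id, (fun _ _ => 0); split.
- by move=> k; split; [exact: ccov_open|exact: hsec0].
- exact: ccovP.
- by move=> k x.
- by move=> k l x _ _; rewrite !subrr.
Qed.

Lemma cohomologous_sym (c c' : cocycle E) : cohomologous c c' -> cohomologous c' c.
Proof.
move=> [K [W [tau [tau' [s [hW cW sub h]]]]]].
exists K, W, tau', tau, (fun k x => (-1) *: s k x + 0); split.
- move=> k; have [oW hs] := hW k; split; first exact: oW.
  by apply: hsec_lin; [exact: hs|exact: hsec0].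
- exact: cW.
- by move=> k x /sub[].
- move=> k l x Wk Wl; rewrite !addr0 !scaleN1r opprK -[LHS]opprB h//.
  by rewrite opprB addrC.
Qed.

Lemma cohomologous_trans (c1 c2 c3 : cocycle E) :
  cohomologous c1 c2 -> cohomologous c2 c3 -> cohomologous c1 c3.
Proof.
move=> [K [W [f [g [s [hW cW sub h]]]]]] [L [V [g' [e [u [hV cV sub' h']]]]]].
exists (K * L)%type, (fun p => W p.1 `&` V p.2), (fun p => f p.1), (fun p => e p.2),
  (fun p x => (1 *: s p.1 x + u p.2 x) + (-1) *: cval c2 (g p.1) (g' p.2) x).
split.
- move=> [k l] /=; have [oW hs] := hW k; have [oV hu] := hV l.
  split; first exact: openI.
  have h1 : hsec (W k `&` V l) (fun x => 1 *: s k x + u l x).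
    apply: hsec_lin; first exact: hsecS hs.
    by apply: hsecS hu => x [].
  have h2 : hsec (W k `&` V l) (cval c2 (g k) (g' l)).
    apply: hsecS (@cval_holo _ _ c2 (g k) (g' l)) => x [Wk Vl].
    by have [_ ?] := sub _ _ Wk; have [? _] := sub' _ _ Vl.
  have -> : (fun x => 1 *: s k x + u l x + -1 *: cval c2 (g k) (g' l) x)
     = (fun x => -1 *: cval c2 (g k) (g' l) x + (1 *: s k x + u l x)).
    by apply/functional_extensionality_dep => x; rewrite addrC.
  by apply: hsec_lin; [exact: h2|exact: h1].
- by move=> x; have [k Wk] := cW x; have [l Vl] := cV x; exists (k, l).
- by move=> [k l] x /= [/sub[? _] /sub'[_ ?]].
- move=> [k l] [k' l'] x /= [Wk Vl] [Wk' Vl'].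
  rewrite !scale1r !scaleN1r.
  have [_ xk] := sub _ _ Wk; have [_ xk'] := sub _ _ Wk'.
  have [xl _] := sub' _ _ Vl; have [xl' _] := sub' _ _ Vl'.
  apply: (cocycle_glue (h k k' x Wk Wk') (h' l l' x Vl Vl')).
  by rewrite !cval_cocycle.
Qed.
End CohomologousEquiv.

Definition H1 r (E : vbundle X r) :=
  {h : cocycle E -> Prop | exists c, h = cohomologous c}.

Definition H1class r (E : vbundle X r) (c : cocycle E) : H1 E :=
  exist (fun h => exists c, h = cohomologous c) _ (ex_intro _ c erefl).

Definition H1repr r (E : vbundle X r) (h : H1 E) : cocycle E :=
  projT1 (cid (svalP h)).

Lemma H1reprK r (E : vbundle X r) (h : H1 E) : H1class (H1repr h) = h.
Proof. by case: h => h hP; apply: eq_exist; rewrite /H1repr; case: cid. Qed.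

Definition cocycle0 r (E : vbundle X r) : cocycle E :=
  @Cocycle _ E unit (fun=> setT) (fun=> openT) (fun x => ex_intro _ tt I)
    (fun _ _ x => 0) (fun _ _ => @hsec0 _ E _)
    (fun _ _ _ x _ _ _ => addr0 (0 : fibre E x)).

Definition H1zero r (E : vbundle X r) : H1 E := H1class (cocycle0 E).

Section Functoriality.
Context {r s : nat} {E : vbundle X r} {E' : vbundle X s}.
Variable f : vmorph E E'.

Lemma hsec_map U u : open U -> hsec U u -> hsec U (fun x => f x (u x)).
Proof.
move=> oU hu t' t'a i j x [Ux t'x]; have [t ta tx] := vcover E x.
have [N hN h] := vm_holo f ta t'a.
have hNu : mxholo (U `&` tdom t `&` tdom t') (fun y => N y *m tmap t (u y)).
  apply: mxholoM; first by apply: mxholoS hN => y [[? ?] ?].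
  by apply: mxholoS (hu t ta) => y [[? ?] ?].
have oV : open (U `&` tdom t `&` tdom t').
  by do 2![apply: openI; last exact: tdom_open].
have Vx : (U `&` tdom t `&` tdom t') x by [].
apply: (holo_at_local oV Vx _ (hNu i j x Vx)) => y [[Uy ty] t'y].
by rewrite h.
Qed.

Fact cocycle_map_holo (c : cocycle E) i j :
  hsec (ccov c i `&` ccov c j) (fun x => f x (cval c i j x)).
Proof. by apply: hsec_map; [apply: openI; exact: ccov_open|exact: cval_holo]. Qed.

Fact cocycle_map_cocycle (c : cocycle E) i j k x :
  ccov c i x -> ccov c j x -> ccov c k x ->
  f x (cval c i j x) + f x (cval c j k x) = f x (cval c i k x).
Proof. by move=> xi xj xk; rewrite -vmorphD cval_cocycle. Qed.

Definition cocycle_map (c : cocycle E) : cocycle E' :=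
  Cocycle (@ccov_open _ _ c) (@ccovP _ _ c) (@cocycle_map_holo c)
    (@cocycle_map_cocycle c).

Definition H1map (h : H1 E) : H1 E' := H1class (cocycle_map (H1repr h)).

End Functoriality.

(** The connecting morphism of a short exact sequence of bundles
    0 -> E' -> E -> E'' -> 0 given by i and p: for local lifts s_j of a section
    g of E'' one puts  i(c_jk) = s_k - s_j. *)
Definition connecting r' r r'' (E' : vbundle X r') (E : vbundle X r)
    (E'' : vbundle X r'') (i : vmorph E' E) (p : vmorph E E'')
    (g : forall x, fibre E'' x) (c : cocycle E') : Prop :=
  exists s : cidx c -> forall x, fibre E x,
  [/\ forall j, hsec (ccov c j) (s j),
      forall j x, ccov c j x -> p x (s j x) = g x &
      forall j k x, ccov c j x -> ccov c k x ->
        i x (cval c j k x) = s k x - s j x].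

Definition connecting_map r' r r'' (E' : vbundle X r') (E : vbundle X r)
    (E'' : vbundle X r'') (i : vmorph E' E) (p : vmorph E E'')
    (g : forall x, fibre E'' x) : H1 E' :=
  if pselect (exists c, connecting i p g c) is left ex
  then H1class (projT1 (cid ex)) else H1zero E'.

End Cohomology.

Arguments ccov {R X r E}.
Arguments cval {R X r E}.

(** ** The cohomology invariant h_A *)

Section Invariant.
Context {R : realType} {X : compact_riemann_surface R} {r : nat}.
Variable A : abundle X r.

(* The class of (p, v) is mapped to the first coordinate of v. *)
Definition assoc_to_O_fun x (c : fibre (assoc_bundle A) x) : fibre (trivial_bundle X 1) x :=
  xget 0 [set z : 'cV[R[i]]_1 |
    exists (p : aframe A x) (v : 'cV[R[i]]_(1 + r)), sval c p v /\ z = usubmx v].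

Lemma usubmx_rho (M : 'M[R[i]]_r) b (v : 'cV[R[i]]_(1 + r)) :
  usubmx (aff_rho M b *m v) = usubmx v.
Proof.
by rewrite -[v]vsubmxK /aff_rho mul_block_col !col_mxKu mul1mx mul0mx addr0.
Qed.

Lemma dsubmx_rho (M : 'M[R[i]]_r) b (v : 'cV[R[i]]_(1 + r)) :
  dsubmx (aff_rho M b *m v) = b *m usubmx v + M *m dsubmx v.
Proof. by rewrite -[v]vsubmxK /aff_rho mul_block_col !col_mxKd col_mxKu. Qed.

Lemma assoc_to_O_funE x (c : fibre (assoc_bundle A) x) (p : aframe A x) v :
  sval c p v -> assoc_to_O_fun c = usubmx v.
Proof.
case: c => c [p0 [v0 cE]] /= pv; apply: xget_unique; first by exists p, v.
move=> z [q [w [/= qw ->]]]; rewrite cE in pv qw.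
have [M [b [_ _ ->]]] := assoc_class_trans (assoc_class_sym pv) qw.
by rewrite usubmx_rho.
Qed.

Fact assoc_to_O_holo t t' : vatlas (assoc_bundle A) t ->
  vatlas (trivial_bundle X 1) t' -> lin_in assoc_to_O_fun t t'.
Proof.
move=> [l [la ->]] ->; exists (fun=> row_mx 1%:M 0); first exact: mxholo_cst.
move=> x /= lx _ c; have [q qK] := frame_of_subproof la lx.
have /(assoc_coordP _ lx qK) h := erefl (assoc_coord l c).
by rewrite (assoc_to_O_funE h) -[assoc_coord _ _ in RHS]vsubmxK mul_row_col mul1mx
  mul0mx addr0.
Qed.

Definition assoc_to_O : vmorph (assoc_bundle A) (trivial_bundle X 1) := VMorph assoc_to_O_holo.

(* In an affine frame q, the translation z |-> z + u corresponds to the class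
   of (q, (0, u)). *)
Definition lin_to_assoc_class x (u : translation A x) : aframe A x -> 'cV[R[i]]_(1 + r) -> Prop :=
  fun q w => exists z, w = col_mx 0 z /\ forall y, u (q y) = q (y + z).

Lemma aframe_inj x (q : aframe A x) : injective q.
Proof.
have [t ta tx] := acover A x; have [M [b [Mu h]]] := frP q ta tx.
move=> y z /(congr1 (@tmap _ _ _ _ t x)); rewrite !h => /addIr.
by move=> /(congr1 (mulmx (invmx M))); rewrite !mulmxA mulVmx// !mul1mx.
Qed.

Fact lin_to_assoc_subproof x (u : translation A x) :
  exists p v, lin_to_assoc_class u = @assoc_class _ _ _ A x p v.
Proof.
have [t ta tx] := acover A x; have [p pK] := frame_of_subproof ta tx.
have tpK y : tmap t (p y) = y.
  by have [a <-] := bij_surj y (tmap_bij tx); rewrite pK.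
have up y : u (p y) = p (y + tr_vec t u).
  by apply: (bij_inj (tmap_bij tx)); rewrite tpK (tr_vecE _ _ ta tx) tpK.
exists p, (col_mx 0 (tr_vec t u)).
have sub q w : assoc_class p (col_mx 0 (tr_vec t u)) q w -> lin_to_assoc_class u q w.
  move=> [M [b [Mu qE e]]]; exists (dsubmx w).
  have w0 : usubmx w = 0.
    by have := congr1 usubmx e; rewrite usubmx_rho col_mxKu => <-.
  split; first by rewrite -w0 vsubmxK.
  have := congr1 dsubmx e; rewrite dsubmx_rho col_mxKd w0 mulmx0 add0r => ue y.
  by rewrite !qE up ue mulmxDr addrAC.
apply/funext => q; apply/funext => w; apply/propext; split; last exact: sub.
move=> [z [-> h]].
have [w' /[dup] hw' /sub[z' [w'E h']]] := frames_transitive p q (col_mx 0 (tr_vec t u)).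
suff -> : z = z' by rewrite -w'E.
have : q (0 + z) = q (0 + z') by rewrite -h -h'.
by move/aframe_inj; rewrite !add0r.
Qed.

Definition lin_to_assoc_fun x (u : fibre (linearisation A) x) : fibre (assoc_bundle A) x :=
  exist (fun c => exists p v, c = assoc_class p v) (lin_to_assoc_class u) (lin_to_assoc_subproof u).

Fact lin_to_assoc_holo t t' : vatlas (linearisation A) t -> vatlas (assoc_bundle A) t' ->
  lin_in lin_to_assoc_fun t t'.
Proof.
move=> [l [la ->]] [l' [l'a ->]]; have [M [b [hM hb h]]] := acompat la l'a.
exists (fun x => col_mx 0 (M x)).
  move=> i j x Ux; rewrite /col_mx.
  rewrite (_ : (fun y => _) = fun y => match fintype.split i with
    | inl k => 0 | inr k => M y k j end).
    by case: (fintype.split i) => k; [exact: holo_at_cst|exact: hM].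
  by apply/funext => y; rewrite !mxE; case: fintype.split => k //; rewrite mxE.
move=> x /= lx l'x u; have [q qK] := frame_of_subproof l'a l'x.
apply/(assoc_coordP _ l'x qK) => /=.
exists (M x *m tr_vec l u); split; first by rewrite mul_col_mx mul0mx.
have lqK y : tmap l' (q y) = y.
  by have [a <-] := bij_surj y (tmap_bij l'x); rewrite qK.
move=> y; apply: (bij_inj (tmap_bij l'x)); rewrite lqK (tr_vecE _ _ l'a l'x) lqK.
by rewrite /tr_vec !h// opprD addrACA subrr addr0 -mulmxBr.
Qed.

Definition lin_to_assoc : vmorph (linearisation A) (assoc_bundle A) := VMorph lin_to_assoc_holo.

Definition aff_invariant : H1 (linearisation A) := connecting_map lin_to_assoc assoc_to_O (fun=> const_mx 1).

End Invariant.

(** * Line subbundles of rank 2 bundles *)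

Section Subbundles.
Context {R : realType} {X : compact_riemann_surface R}.

(* Locally, for a suitable holomorphic trivialisation, the fibres are
   C x {0} in C^2. *)
Definition adapted (E : vbundle X 2) (D : forall x, set (fibre E x))
    (t : ltriv (vfib E) 2) : Prop :=
  vtriv t /\ forall x, tdom t x -> forall v : fibre E x, D x v <-> tmap t v 1 0 = 0.

Record lsub (E : vbundle X 2) := LSub {
  ls_set :> forall x, set (fibre E x);
  ls_loc : forall x, exists2 t, adapted ls_set t & tdom t x }.

Context {E : vbundle X 2}.
Variable D : lsub E.

Lemma vtriv_linear t : vtriv t -> forall x, tdom t x ->
  forall a (v w : fibre E x),
  tmap t (a *: v + w : fibre E x) = a *: tmap t v + tmap t w.
Proof.
move=> ht x tx a v w; have [t' t'a t'x] := vcover E x.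
have [_ [N _ h]] := ht t' t'a.
by rewrite !h// tmapD// tmapZ// mulmxDr scalemxAr.
Qed.

Lemma vtriv_sub t : vtriv t -> forall x, tdom t x -> forall v w : fibre E x,
  tmap t (v - w : fibre E x) = tmap t v - tmap t w.
Proof.
move=> ht x tx v w; rewrite addrC -scaleN1r vtriv_linear// scaleN1r.
by rewrite addrC.
Qed.

Lemma colV2P (v w : 'cV[R[i]]_2) : v 0 0 = w 0 0 -> v 1 0 = w 1 0 -> v = w.
Proof.
move=> e0 e1; apply/colP => i.
case: i => -[|[|//]] h.
  by rewrite (_ : Ordinal h = 0)//; exact: val_inj.
by rewrite (_ : Ordinal h = 1)//; exact: val_inj.
Qed.

(** ** D as a line bundle *)

Definition sub_fib x := {v : vfib E x | D x v}.

Definition sub_coord (t : ltriv (vfib E) 2) x (v : sub_fib x) : 'cV[R[i]]_1 :=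
  const_mx (tmap t (sval v) 0 0).

Fact sub_coord_bij t : adapted D t -> forall x, tdom t x -> bijective (@sub_coord t x).
Proof.
move=> [ht Dt] x tx; apply: bij_of_inj_surj => [[v Dv] [w Dw] vw|z].
  apply: eq_exist; apply: (bij_inj (tmap_bij tx)); apply: colV2P.
    by have := congr1 (fun m : 'cV_1 => m 0 0) vw; rewrite !mxE.
  by rewrite (Dt x tx v).1 // (Dt x tx w).1.
have [v vE] := bij_surj (\col_(i < 2) if i == 0 then z 0 0 else 0) (tmap_bij tx).
have Dv : D x v by apply/(Dt x tx); rewrite vE mxE.
exists (exist _ v Dv); apply/colP => i.
by rewrite !mxE/= vE mxE eqxx ord1.
Qed.

Definition sub_ltriv t (ht : adapted D t) : ltriv sub_fib 1 :=
  LTriv (tdom_open t) (sub_coord_bij ht).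

Definition sub_atlas : set (ltriv sub_fib 1) :=
  [set l | exists t (ht : adapted D t), l = sub_ltriv ht].

Fact sub_cover x : exists2 l, sub_atlas l & tdom l x.
Proof.
have [t ht tx] := ls_loc D x.
by exists (sub_ltriv ht) => //; exists t, ht.
Qed.

Lemma mulmx2E (N : 'M[R[i]]_2) (v : 'cV[R[i]]_2) i :
  (N *m v) i 0 = N i 0 * v 0 0 + N i 1 * v 1 0.
Proof.
rewrite mxE big_ord_recl big_ord1; congr (_ + N i _ * v _ _); exact: val_inj.
Qed.

Fact sub_atlas_compat l l' : sub_atlas l -> sub_atlas l' -> lin_compat l l'.
Proof.
move=> [t [ht ->]] [t' [ht' ->]].
have [N hN h] := vtriv_compat ht.1 ht'.1.
exists (fun x => const_mx (N x 0 0)).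
  move=> i j x Ux; rewrite (_ : (fun y => _) = fun y => N y 0 0); first exact: hN.
  by apply/funext => y; rewrite mxE.
move=> x /= tx t'x [v Dv]; apply/colP => i.
rewrite !mxE big_ord1 !mxE/= h// mulmx2E.
by rewrite [tmap t v 1 0](ht.2 x tx v).1// mulr0 addr0.
Qed.

Definition sub_bundle : vbundle X 1 := VBundle sub_cover sub_atlas_compat.

(** ** The quotient E / D *)

Definition quot_fib x :=
  {c : vfib E x -> Prop |
    exists v : fibre E x, c = fun w : fibre E x => D x (w - v)}.

Definition quot_proj x (v : fibre E x) : quot_fib x :=
  exist (fun c => exists v : fibre E x, c = fun w : fibre E x => D x (w - v)) _
    (ex_intro _ v erefl).

Definition quot_repr x (c : quot_fib x) : fibre E x := projT1 (cid (svalP c)).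

Lemma quot_reprK x (c : quot_fib x) : quot_proj (quot_repr c) = c.
Proof. by case: c => c cP; apply: eq_exist; rewrite /quot_repr; case: cid. Qed.

Definition quot_coord (t : ltriv (vfib E) 2) x (c : quot_fib x) : 'cV[R[i]]_1 :=
  const_mx (tmap t (quot_repr c) 1 0).

Lemma quot_projP t x (v w : fibre E x) : adapted D t -> tdom t x ->
  quot_proj v = quot_proj w <-> tmap t v 1 0 = tmap t w 1 0.
Proof.
move=> [ht Dt] tx.
have DE (a b : fibre E x) : D x (a - b) <-> tmap t a 1 0 = tmap t b 1 0.
  rewrite Dt// vtriv_sub// !mxE; split; last by move=> ->; rewrite subrr.
  by move/eqP; rewrite subr_eq0 => /eqP.
split => [/(congr1 (fun c => sval c v))/= e|e].
  by apply/DE; rewrite -e; apply/DE.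
by apply: eq_exist; apply/funext => a; apply/propext; rewrite !DE e.
Qed.

Lemma quot_coordE t x (v : fibre E x) : adapted D t -> tdom t x ->
  quot_coord t (quot_proj v) = const_mx (tmap t v 1 0).
Proof.
move=> ht tx; rewrite /quot_coord; congr const_mx.
by apply/(quot_projP _ _ ht tx); rewrite quot_reprK.
Qed.

Fact quot_coord_bij t : adapted D t -> forall x, tdom t x -> bijective (@quot_coord t x).
Proof.
move=> ht x tx; apply: bij_of_inj_surj => [c c' cc'|z].
  rewrite -[c]quot_reprK -[c']quot_reprK; apply/(quot_projP _ _ ht tx).
  by have := congr1 (fun m : 'cV_1 => m 0 0) cc'; rewrite !mxE.
have [v vE] := bij_surj (const_mx (z 0 0) : 'cV_2) (tmap_bij tx).
exists (quot_proj v); rewrite quot_coordE// vE.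
by apply/colP => i; rewrite !mxE ord1.
Qed.

Definition quot_ltriv t (ht : adapted D t) : ltriv quot_fib 1 :=
  LTriv (tdom_open t) (quot_coord_bij ht).

Definition quot_atlas : set (ltriv quot_fib 1) :=
  [set l | exists t (ht : adapted D t), l = quot_ltriv ht].

Fact quot_cover x : exists2 l, quot_atlas l & tdom l x.
Proof.
have [t ht tx] := ls_loc D x.
by exists (quot_ltriv ht) => //; exists t, ht.
Qed.

Lemma adapted_triangular t t' x (N : 'M[R[i]]_2) :
  adapted D t -> adapted D t' -> tdom t x -> tdom t' x ->
  (forall v : fibre E x, tmap t' v = N *m tmap t v) -> N 1 0 = 0.
Proof.
move=> ht ht' tx t'x h.
have [v vE] := bij_surj (\col_(i < 2) if i == 0 then 1 else 0) (tmap_bij tx).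
have : D x v by apply/(ht.2 x tx); rewrite vE mxE.
by move/(ht'.2 x t'x); rewrite h mulmx2E vE !mxE/= mulr1 mulr0 addr0.
Qed.

Fact quot_atlas_compat l l' : quot_atlas l -> quot_atlas l' -> lin_compat l l'.
Proof.
move=> [t [ht ->]] [t' [ht' ->]].
have [N hN h] := vtriv_compat ht.1 ht'.1.
exists (fun x => const_mx (N x 1 1)).
  move=> i j x Ux; rewrite (_ : (fun y => _) = fun y => N y 1 1); first exact: hN.
  by apply/funext => y; rewrite mxE.
move=> x /= tx t'x c; rewrite -[c]quot_reprK !quot_coordE//.
apply/colP => i; rewrite !mxE big_ord1 !mxE h// mulmx2E.
by rewrite (adapted_triangular ht ht' tx t'x (h x tx t'x)) mul0r add0r.
Qed.

Definition quot_bundle : vbundle X 1 := VBundle quot_cover quot_atlas_compat.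

Fact quot_proj_holo t l : vatlas E t -> vatlas quot_bundle l ->
  lin_in (fun x (v : fibre E x) => quot_proj v : fibre quot_bundle x) t l.
Proof.
move=> ta [t' [ht' ->]]; have [_ [N hN h]] := ht'.1 t ta.
exists (fun x => row 1 (N x)).
  move=> i j x Ux; rewrite (_ : (fun y => _) = fun y => N y 1 j); first exact: hN.
  by apply/funext => y; rewrite mxE.
move=> x /= tx t'x v; rewrite quot_coordE// -row_mul.
by apply/colP => i; rewrite mxE [RHS]mxE h.
Qed.

Definition quot_map : vmorph E quot_bundle := VMorph quot_proj_holo.

End Subbundles.

(** * Degree and stability *)

Section Degree.
Context {R : realType} {X : compact_riemann_surface R}.

(* The function f is meromorphic of order k at p, i.e. f = z^k u around p for
   a local coordinate z centred at p and a holomorphic u with u(p) <> 0; the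
   value of f at p itself is irrelevant. *)
Definition mero_ord (f : X -> R[i]) (p : X) (k : int) : Prop :=
  exists (c : chart R X) (U : set X) (u : X -> R[i]),
  [/\ rs_atlas c, open U /\ U `<=` cdom c, U p, holo U u /\ u p != 0 &
      forall x, U x -> x <> p -> f x = (cfwd c x - cfwd c p) ^ k * u x].

(* The determinant line bundle of E has the determinants of the transition
   matrices of E as transition functions.  The family [s] is a non-zero
   meromorphic section of it, the function [n] is the divisor of this section
   and d is the degree of the divisor. *)
Definition has_degree r (E : vbundle X r) (d : int) : Prop :=
  exists (S : seq X) (n : X -> int) (s : ltriv (vfib E) r -> X -> R[i]),
  [/\ uniq S /\ (forall x, n x != 0 -> x \in S),
      forall t t', vatlas E t -> vatlas E t' ->
        forall x, tdom t x -> tdom t' x -> forall M : 'M_r,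
        (forall v : vfib E x, tmap t' v = M *m tmap t v) ->
        s t' x = \det M * s t x,
      forall t x, vatlas E t -> tdom t x -> mero_ord (s t) x (n x) &
      d = \sum_(x <- S) n x].

Definition degree r (E : vbundle X r) : int := xget 0 [set d | has_degree E d].

(* The slope of a rank 2 bundle is half of its degree. *)
Definition semistable (E : vbundle X 2) : Prop :=
  forall G : lsub E, degree (sub_bundle G) * 2 <= degree E.

Definition unstable (E : vbundle X 2) : Prop := ~ semistable E.

(** D is the maximal destabilising line subbundle of E: it destabilises E, its
    slope is maximal, and it contains every line subbundle of the same slope. *)
Definition max_destab (E : vbundle X 2) (D : lsub E) : Prop :=
  degree E < degree (sub_bundle D) * 2 /\
  forall G : lsub E, degree (sub_bundle G) <= degree (sub_bundle D) /\
    (degree (sub_bundle G) = degree (sub_bundle D) ->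
     forall x, G x `<=` D x).

(** * Classification

   Subsets of large types are written as predicates: the type of affine bundles
   does not fit in the universe of [set]. *)

(** The quotient S / e of the subset S of T by the equivalence relation e, as
    the type of the equivalence classes of the elements of S. *)
Definition quotient (T : Type) (S : T -> Prop) (e : T -> T -> Prop) :=
  {c : T -> Prop | exists2 x, S x & c = e x}.

Definition qclass (T : Type) (S : T -> Prop) (e : T -> T -> Prop) (x : T)
    (Sx : S x) : quotient S e :=
  exist (fun c => exists2 x, S x & c = e x) (e x) (ex_intro2 _ _ x Sx erefl).

(** H^1(X, E)_0 *)
Definition H1_0 (E : vbundle X 2) (D : lsub E) (h : H1 E) : Prop :=
  H1map (quot_map D) h <> H1zero (quot_bundle D).

Definition Aut (E : vbundle X 2) (g : viso E E) : Prop := True.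

(** Aut(E)_0 *)
Definition Aut0 (E : vbundle X 2) (D : lsub E) (g : viso E E) : Prop :=
  forall x v, D x v -> g x v = v.

(* h' belongs to the G-orbit of h; [same_orbit G h] is this orbit. *)
Definition same_orbit (E : vbundle X 2) (G : viso E E -> Prop) (h h' : H1 E) : Prop :=
  exists2 g, G g & h' = H1map g h.

Definition nondegenerate_abundle (A : abundle X 2) : Prop :=
  exists D : lsub (linearisation A), max_destab D /\ H1_0 D (aff_invariant A).

Definition isomorphic (A A' : abundle X 2) : Prop := inhabited (aiso A A').

(** Linear isomorphisms C -> D_x0 *)
Definition is_framing (E : vbundle X 2) (D : lsub E) (x0 : X)
    (eps : {linear R[i]^o -> fibre E x0}) : Prop :=
  set_bij setT (D x0) eps.

Record framed_abundle (x0 : X) := FramedABundle {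
  fa_bundle :> abundle X 2;
  fa_D : lsub (linearisation fa_bundle);
  fa_maxD : max_destab fa_D;
  fa_eps : {linear R[i]^o -> fibre (linearisation fa_bundle) x0};
  fa_framing : is_framing fa_D fa_eps }.

Definition framed_isomorphic x0 (A A' : framed_abundle x0) : Prop :=
  exists psi : aiso A A', forall z, lin_part psi (fa_eps A z) = fa_eps A' z.

End Degree.

(* Main.v *)
Require Import Defs.
From HB Require Import structures.
From mathcomp Require Import all_boot all_order all_algebra complex.
From mathcomp Require Import all_classical all_reals topology normedtype derive.
From mathcomp Require Import perm sequences realfun exp trigo.
From mathcomp Require Import measure lebesgue_measure lebesgue_integral.
From mathcomp Require Import ring lra.

(* Two local sections of an affine bundle A differ by a section of L(A), so a
   family of local sections has a difference cocycle, and this cocycle represents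
   h_A.  Hence an isomorphism g : L(A) -> L(A') with g h_A = h_A' lifts to an
   isomorphism A -> A', glued from the maps a |-> s'_k + g(a - s_k) for local
   sections s_k of A and s'_k of A' whose difference cocycles match under g, and
   every class in H^1(E) is the invariant of an affine bundle obtained by glueing
   copies of E by translations.

   The maximal destabilising subbundle is unique and degrees are invariant under
   isomorphism, so every isomorphism L(A) -> E respects these subbundles.  An
   automorphism of E acts on D_E by multiplication by a holomorphic function on C,
   which is constant; so it lies in Aut(E)_0 as soon as it fixes the framing at x_0.
   Constancy follows from the maximum principle for real parts: by Goursat's
   theorem in logarithmic polar coordinates, the mean of a holomorphic function over
   the circle of radius r around z does not depend on r, and by continuity it is the
   value at z. *)

Set Implicit Arguments.
Unset Strict Implicit.
Unset Printing Implicit Defensive.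

Import Order.TTheory GRing.Theory Num.Theory numFieldNormedType.Exports.
Local Open Scope classical_set_scope.
Local Open Scope ring_scope.

(** * The maximum principle and Liouville's theorem *)

(** [holo] gives complex differentiability at each point and says nothing about continuity of the
    derivative, so boundary integrals are shown to vanish by repeated quartering of rectangles
    instead of Green's formula. In the coordinates w = z + c e^(s+it) the circles around z become
    segments s = const, so rectangles and real integrals over segments suffice; the Cauchy-Riemann
    equations enter as closedness of the form Im F ds + Re F dt.

    Coordinates, local sections and glued maps are chosen point by point. Holomorphy is recovered
    locally: a fibrewise linear or affine map determines its matrices, because trivialisations are
    onto, so the pointwise choices agree with local holomorphic data.

    [degree] picks an element of the set of degrees of a bundle; an isomorphism transports the whole
    set, hence also the element picked. The class of A in H^1(E) depends on the isomorphism L(A) ->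
    E used, so the classifying maps are first described as relations and then descend to
    quotients. *)

Section Goursat.
Context {R : realType}.
Local Notation mu := (@lebesgue_measure R).
Implicit Types (f g : R -> R) (a b : R).

Definition seg_int f a b : R := \int[mu]_(x in `[a, b]) f x.

Definition cont_on f a b := forall x, a <= x <= b -> {for x, continuous f}.

Lemma cont_on_integrable f a b : cont_on f a b -> mu.-integrable `[a, b] (EFin \o f).
Proof.
move=> fc; apply: continuous_compact_integrable; first exact: segment_compact.
apply: continuous_in_subspaceT => x; rewrite inE /= in_itv /=; exact: fc.
Qed.

Lemma cont_onB f g a b : cont_on f a b -> cont_on g a b -> cont_on (fun x => f x - g x) a b.
Proof. by move=> fc gc x xab; apply: continuousB; [exact: fc|exact: gc]. Qed.

Lemma cont_onS f a b a' b' : a <= a' -> b' <= b -> cont_on f a b -> cont_on f a' b'.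
Proof. by move=> aa bb fc x /andP[h1 h2]; apply: fc; rewrite (le_trans aa h1) (le_trans h2 bb). Qed.

Lemma seg_intB f g a b : cont_on f a b -> cont_on g a b ->
  seg_int (fun x => f x - g x) a b = seg_int f a b - seg_int g a b.
Proof. by move=> fc gc; rewrite /seg_int RintegralB//; exact: cont_on_integrable. Qed.

Lemma seg_int_split f a m b : a <= m -> m <= b -> cont_on f a b ->
  seg_int f a b = seg_int f a m + seg_int f m b.
Proof.
move=> am mb fc; rewrite /seg_int.
have fi := cont_on_integrable fc.
have := @Rintegral_itvB R f (BLeft a) (BRight b) m fi.
rewrite !bnd_simp => /(_ am mb).
(* The difference of the integrals over [a, b] and [a, m] is the integral over ]m, b]; the point m
   has measure zero. *)
rewrite Rintegral_itv_obnd_cbnd; first by move=> <-; rewrite addrC subrK.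
apply: integrableS fi => // x /=; rewrite !in_itv /= => /andP[h1 h2].
by rewrite h2 (le_trans am (ltW h1)).
Qed.

Lemma seg_int_cst k a b : a <= b -> seg_int (fun=> k) a b = k * (b - a).
Proof.
move=> ab; rewrite /seg_int Rintegral_cst//= lebesgue_measure_itv/= lte_fin.
case: ltP => [_|ba]; first by rewrite /= .
have -> : a = b by apply/eqP; rewrite eq_le ab ba.
by rewrite subrr.
Qed.

Lemma le_seg_int f g a b : cont_on f a b -> cont_on g a b ->
  (forall x, a <= x <= b -> f x <= g x) -> seg_int f a b <= seg_int g a b.
Proof.
by move=> fc gc fg; apply: le_Rintegral => //; exact: cont_on_integrable.
Qed.

Lemma cont_on_cst k a b : cont_on (fun=> k) a b.
Proof. by move=> x _; exact: cst_continuous. Qed.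

Lemma seg_int_near_cst f k e a b : a <= b -> cont_on f a b ->
  (forall x, a <= x <= b -> `|f x - k| <= e) ->
  `|seg_int f a b - k * (b - a)| <= e * (b - a).
Proof.
move=> ab fc h; rewrite ler_norml; apply/andP; split.
  rewrite -mulNr lerBrDl -mulrDl -seg_int_cst//.
  apply: le_seg_int => // [|x /h]; first exact: cont_on_cst.
  by rewrite ler_norml => /andP[]; lra.
rewrite lerBlDr -mulrDl -seg_int_cst//.
apply: le_seg_int => // [|x /h]; first exact: cont_on_cst.
by rewrite ler_norml => /andP[]; lra.
Qed.

(** The supremum of the left end points works, since every right end point bounds them all. *)
Lemma nested_intervals (a b : nat -> R) :
  (forall n, a n <= a n.+1) -> (forall n, b n.+1 <= b n) -> (forall n, a n <= b n) ->
  exists s, forall n, a n <= s <= b n.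
Proof.
move=> am bm ab.
have a_mono : {homo a : m n / (m <= n)%N >-> m <= n} by apply/nondecreasing_seqP.
have b_mono n (l : nat) : b (n + l)%N <= b n.
  by elim: l => [|l IH]; rewrite ?addn0// addnS; apply: le_trans (bm _) IH.
have ab' m n : a m <= b n.
  exact: (le_trans (a_mono _ _ (leq_addl n m)) (le_trans (ab _) (b_mono n m))).
have ubn n : ubound (range a) (b n) by move=> _ [m _ <-].
have hs : has_sup (range a).
  by split; [exists (a 0%N), 0%N|exists (b 0%N); exact: ubn].
exists (sup (range a)) => n; apply/andP; split.
  by apply: ub_le_sup; [case: hs|exists n].
by apply: ge_sup; [case: hs|exact: ubn].
Qed.

Lemma halving_small (w del : R) : 0 < del -> exists n, w / 2 ^+ n < del.
Proof.
move=> d0; exists (Num.bound (w / del)).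
have h : w / del < 2 ^+ Num.bound (w / del).
  have [w0|w0] := leP 0 (w / del).
    apply: (lt_trans (archi_boundP w0)).
    by rewrite -natrX ltr_nat ltn_expl.
  by apply: (lt_trans w0); rewrite exprn_gt0.
by rewrite ltr_pdivrMr ?exprn_gt0// mulrC -ltr_pdivrMr.
Qed.

(** Compactness by bisection for an arbitrary property of rectangles: nested bad quarters shrink to
    a point (s, t), which thus lies in bad rectangles of arbitrarily small size. *)
Lemma quadrisection (Bad : R -> R -> R -> R -> Prop) a b c d :
  a <= b -> c <= d -> Bad a b c d ->
  (forall a b c d, a <= b -> c <= d -> Bad a b c d ->
    let m := (a + b) / 2 in let n := (c + d) / 2 in
    [\/ Bad a m c n, Bad m b c n, Bad a m n d | Bad m b n d]) ->
  exists s t, [/\ a <= s <= b, c <= t <= d &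
    forall del, 0 < del -> exists a' b' c' d', Bad a' b' c' d' /\
      [/\ a <= a' /\ b' <= b, c <= c' /\ d' <= d, a' <= s <= b', c' <= t <= d' &
       b' - a' < del /\ d' - c' < del]].
Proof.
move=> ab cd B0 Bstep.
(* A rectangle carries its badness with it, so that the choice of a bad quarter is a function that
   can be iterated. *)
pose rect := {r : (R * R) * (R * R) | [/\ r.1.1 <= r.1.2, r.2.1 <= r.2.2 &
  Bad r.1.1 r.1.2 r.2.1 r.2.2]}.
have step (r : rect) : exists r' : rect, let: ((x, y), (z, w)) := sval r in
    let: ((x', y'), (z', w')) := sval r' in
    [/\ x <= x' /\ y' <= y, z <= z' /\ w' <= w,
      y' - x' = (y - x) / 2 & w' - z' = (w - z) / 2].
  case: r => -[[x y] [z w]] [/= xy zw B].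
  by case: (Bstep _ _ _ _ xy zw B) => B';
    (unshelve eexists; [eexists (_, _, (_, _)); split; [| |exact: B'] => /=; lra |
     rewrite /=; split; lra]).
pose next r := projT1 (cid (step r)).
have r0P : [/\ (a, b, (c, d)).1.1 <= (a, b, (c, d)).1.2,
  (a, b, (c, d)).2.1 <= (a, b, (c, d)).2.2 & Bad a b c d] by [].
pose u n : rect := iter n next (exist _ (a, b, (c, d)) r0P).
pose ua n := (sval (u n)).1.1; pose ub n := (sval (u n)).1.2.
pose uc n := (sval (u n)).2.1; pose ud n := (sval (u n)).2.2.
have uS n : [/\ ua n <= ua n.+1 /\ ub n.+1 <= ub n, uc n <= uc n.+1 /\ ud n.+1 <= ud n,
    ub n.+1 - ua n.+1 = (ub n - ua n) / 2 & ud n.+1 - uc n.+1 = (ud n - uc n) / 2].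
  rewrite /ua /ub /uc /ud /u iterS -/(u n) /next; case: (cid (step (u n))) => r' /=.
  by case: (sval (u n)) => -[? ?] [? ?]; case: (sval r') => -[? ?] [? ?].
have uP n : [/\ ua n <= ub n, uc n <= ud n & Bad (ua n) (ub n) (uc n) (ud n)].
  exact: (svalP (u n)).
have [s sP] : exists s, forall n, ua n <= s <= ub n.
  by apply: nested_intervals => n; have [[? ?] [? ?] _ _] := uS n; have [] := uP n.
have [t tP] : exists t, forall n, uc n <= t <= ud n.
  by apply: nested_intervals => n; have [[? ?] [? ?] _ _] := uS n; have [] := uP n.
have sub n : [/\ a <= ua n, ub n <= b, c <= uc n & ud n <= d].
  elim: n => [|n [h1 h2 h3 h4]]; first by split.
  have [[? ?] [? ?] _ _] := uS n.
  by split; [apply: le_trans h1 _|apply: le_trans h2|apply: le_trans h3 _|apply: le_trans h4].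
have wE n : ub n - ua n = (b - a) / 2 ^+ n /\ ud n - uc n = (d - c) / 2 ^+ n.
  elim: n => [|n [h1 h2]]; first by rewrite expr0 !divr1.
  have [_ _ -> ->] := uS n.
  by rewrite h1 h2 exprSr invfM !mulrA.
exists s, t; split; [exact: (sP 0%N)|exact: (tP 0%N)|] => del d0.
(* The larger of the two widths makes one n serve both directions. *)
have [n nP] := halving_small (Num.max (b - a) (d - c)) d0.
have lt_max x : x <= Num.max (b - a) (d - c) -> x / 2 ^+ n < del.
  by move=> h; apply: le_lt_trans nP; rewrite ler_pM2r// invr_gt0 exprn_gt0.
have [_ _ B] := uP n; have [? ? ? ?] := sub n; have [w1 w2] := wE n.
exists (ua n), (ub n), (uc n), (ud n); split => //; split => //.
by rewrite w1 w2; split; apply: lt_max; rewrite le_max lexx ?orbT.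
Qed.

(* The 1-form P ds + Q dt is differentiable at (s0, t0), and closed there. *)
Definition closed_at (P Q : R -> R -> R) (s0 t0 : R) := exists a b d,
  forall e, 0 < e -> exists2 del, 0 < del & forall s t, `|s - s0| < del -> `|t - t0| < del ->
    `|P s t - P s0 t0 - a * (s - s0) - b * (t - t0)| <= e * (`|s - s0| + `|t - t0|) /\
    `|Q s t - Q s0 t0 - b * (s - s0) - d * (t - t0)| <= e * (`|s - s0| + `|t - t0|).

Lemma linear_approx_cont f x a : (forall e, 0 < e -> exists2 del, 0 < del &
    forall y, `|y - x| < del -> `|f y - f x - a * (y - x)| <= e * `|y - x|) ->
  {for x, continuous f}.
Proof.
move=> h; apply/(@cvgrPdist_lt R R^o) => e e0.
have [del d0 hd] := h 1 ltr01.
pose K := `|a| + 1 + 1; have K0 : 0 < K by rewrite /K; have := normr_ge0 a; lra.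
near=> y.
have yx : `|y - x| < Num.min del (e / K).
  rewrite distrC; near: y; apply/nbhs_ballP; exists (Num.min del (e / K)) => //=.
  by rewrite lt_min d0 divr_gt0.
move: yx; rewrite lt_min => /andP[/hd yd yK].
rewrite distrC -[f y - f x](subrK (a * (y - x))).
apply: (le_lt_trans (ler_normD _ _)); rewrite normrM.
apply: (@le_lt_trans _ _ (K * `|y - x|)).
  by move: yd; rewrite mul1r /K !mulrDl !mul1r; have := normr_ge0 (y - x); lra.
by rewrite mulrC -ltr_pdivlMr.
Unshelve. all: by end_near. Qed.

Lemma closed_at_cont P Q s0 t0 : closed_at P Q s0 t0 ->
  {for s0, continuous (P ^~ t0)} /\ {for t0, continuous (Q s0)}.
Proof.
move=> [a [b [d h]]]; split.
  apply: (@linear_approx_cont _ _ a) => e /h[del d0 hd]; exists del => // y yd.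
  have [] := hd y t0 yd; first by rewrite subrr normr0.
  by rewrite subrr normr0 mulr0 subr0 addr0.
apply: (@linear_approx_cont _ _ d) => e /h[del d0 hd]; exists del => // y yd.
have [|_] := hd s0 y _ yd; first by rewrite subrr normr0.
by rewrite subrr normr0 mulr0 subr0 add0r.
Qed.

(** The integral of P ds + Q dt along the boundary of [a, b] x [c, d], anticlockwise: bottom minus
    top, then right minus left. *)
Definition rect_int (P Q : R -> R -> R) a b c d :=
  seg_int (P ^~ c) a b - seg_int (P ^~ d) a b + (seg_int (Q b) c d - seg_int (Q a) c d).

(** P is integrated along horizontal sides and Q along vertical ones, so each is continuous in its
    own variable of integration. *)
Definition separately_cont (P Q : R -> R -> R) a b c d :=
  (forall t, c <= t <= d -> cont_on (P ^~ t) a b) /\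
  (forall s, a <= s <= b -> cont_on (Q s) c d).

Lemma separately_contS P Q a b c d a' b' c' d' :
  a <= a' -> b' <= b -> c <= c' -> d' <= d ->
  separately_cont P Q a b c d -> separately_cont P Q a' b' c' d'.
Proof.
move=> aa bb cc dd [hP hQ]; split=> [t /andP[t1 t2]|s /andP[s1 s2]].
  by apply: (cont_onS aa bb); apply: hP; rewrite (le_trans cc t1) (le_trans t2 dd).
by apply: (cont_onS cc dd); apply: hQ; rewrite (le_trans aa s1) (le_trans s2 bb).
Qed.

Lemma rect_int_splitl P Q a b c d m : a <= m -> m <= b -> c <= d ->
  separately_cont P Q a b c d ->
  rect_int P Q a b c d = rect_int P Q a m c d + rect_int P Q m b c d.
Proof.
move=> am mb cd [hP _]; have cc : c <= c <= d by rewrite lexx.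
have dd : c <= d <= d by rewrite lexx andbT.
rewrite /rect_int (seg_int_split am mb (hP c cc)) (seg_int_split am mb (hP d dd)).
by clear; lra.
Qed.

Lemma rect_int_splitr P Q a b c d n : a <= b -> c <= n -> n <= d ->
  separately_cont P Q a b c d ->
  rect_int P Q a b c d = rect_int P Q a b c n + rect_int P Q a b n d.
Proof.
move=> ab cn nd [_ hQ]; have aa : a <= a <= b by rewrite lexx.
have bb : a <= b <= b by rewrite lexx andbT.
rewrite /rect_int (seg_int_split cn nd (hQ a aa)) (seg_int_split cn nd (hQ b bb)).
by clear; lra.
Qed.

(** The boundary integral is the sum of those of the four quarters, while the square of the
    half-perimeter drops to a quarter; so some quarter keeps the ratio above k. *)
Lemma rect_int_quarter P Q a b c d k : a <= b -> c <= d ->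
  separately_cont P Q a b c d -> k * (b - a + (d - c)) ^+ 2 < `|rect_int P Q a b c d| ->
  exists a' b' c' d', [/\
    (a', b') = (a, (a + b) / 2) \/ (a', b') = ((a + b) / 2, b),
    (c', d') = (c, (c + d) / 2) \/ (c', d') = ((c + d) / 2, d) &
    k * (b' - a' + (d' - c')) ^+ 2 < `|rect_int P Q a' b' c' d'|].
Proof.
move=> ab cd PQ hk; apply: contrapT => nex.
have small a' b' c' d' : (a', b') = (a, (a + b) / 2) \/ (a', b') = ((a + b) / 2, b) ->
    (c', d') = (c, (c + d) / 2) \/ (c', d') = ((c + d) / 2, d) ->
    `|rect_int P Q a' b' c' d'| <= k * ((b - a + (d - c)) / 2) ^+ 2.
  move=> h1 h2; rewrite leNgt; apply/negP => h; apply: nex.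
  exists a', b', c', d'; split => //.
  suff -> : b' - a' + (d' - c') = (b - a + (d - c)) / 2 by [].
  by case: h1 => -[-> ->]; case: h2 => -[-> ->]; clear; lra.
have [am mb] : a <= (a + b) / 2 /\ (a + b) / 2 <= b by clear -ab; lra.
have [cn nd] : c <= (c + d) / 2 /\ (c + d) / 2 <= d by clear -cd; lra.
move: hk; apply/negP; rewrite -leNgt.
rewrite (rect_int_splitl am mb cd PQ).
rewrite (rect_int_splitr am cn nd (separately_contS (lexx a) mb (lexx c) (lexx d) PQ)).
rewrite (rect_int_splitr mb cn nd (separately_contS am (lexx b) (lexx c) (lexx d) PQ)).
apply: (le_trans (ler_normD _ _)).
apply: (le_trans (lerD (ler_normD _ _) (ler_normD _ _))).
have := small a ((a + b) / 2) c ((c + d) / 2) (or_introl erefl) (or_introl erefl).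
have := small a ((a + b) / 2) ((c + d) / 2) d (or_introl erefl) (or_intror erefl).
have := small ((a + b) / 2) b c ((c + d) / 2) (or_intror erefl) (or_introl erefl).
have := small ((a + b) / 2) b ((c + d) / 2) d (or_intror erefl) (or_intror erefl).
have -> : k * (b - a + (d - c)) ^+ 2 = 4 * (k * ((b - a + (d - c)) / 2) ^+ 2).
  by clear; field.
move: `|_| `|_| `|_| `|_| (k * _) => r1 r2 r3 r4 w; clear; lra.
Qed.

(** The affine parts contribute - be (d - c)(b - a) through P and be (b - a)(d - c) through Q. They
    cancel because closedness gives both the same [be]. What remains are the errors, one for each of
    two opposite sides, whence the factor 2. *)
Lemma rect_int_local (P Q : R -> R -> R) e al be de P0 Q0 s t a b c d : a <= b -> c <= d ->
  separately_cont P Q a b c d ->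
  (forall x y, a <= x <= b -> c <= y <= d ->
    `|P x y - P0 - al * (x - s) - be * (y - t)| <= e /\
    `|Q x y - Q0 - be * (x - s) - de * (y - t)| <= e) ->
  `|rect_int P Q a b c d| <= 2 * e * (b - a + (d - c)).
Proof.
move=> ab cd [hP hQ] h.
have [aa bb] : a <= a <= b /\ a <= b <= b by rewrite !lexx ab.
have [cc dd] : c <= c <= d /\ c <= d <= d by rewrite !lexx cd.
have Pest : `|seg_int (fun x => P x c - P x d) a b - (- be * (d - c)) * (b - a)|
    <= (2 * e) * (b - a).
  apply: seg_int_near_cst => // [|x xab]; first by apply: cont_onB; apply: hP.
  have [+ _] := h x c xab cc; have [+ _] := h x d xab dd.
  by clear; rewrite !ler_norml; lra.
have Qest : `|seg_int (fun y => Q b y - Q a y) c d - (be * (b - a)) * (d - c)|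
    <= (2 * e) * (d - c).
  apply: seg_int_near_cst => // [|y ycd]; first by apply: cont_onB; apply: hQ.
  have [_ +] := h b y bb ycd; have [_ +] := h a y aa ycd.
  by clear; rewrite !ler_norml; lra.
rewrite /rect_int -(seg_intB (hP c cc) (hP d dd)) -(seg_intB (hQ b bb) (hQ a aa)).
move: Pest Qest; move: (seg_int _ a b) (seg_int _ c d) => I1 I2; clear.
by rewrite !ler_norml => /andP[? ?] /andP[? ?]; apply/andP; split; lra.
Qed.

Theorem goursat (P Q : R -> R -> R) a b c d : a <= b -> c <= d ->
  (forall s t, a <= s <= b -> c <= t <= d -> closed_at P Q s t) ->
  rect_int P Q a b c d = 0.
Proof.
move=> ab cd PQ.
have PQc : separately_cont P Q a b c d.
  split=> [t tcd s sab|s sab t tcd].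
    by have [] := closed_at_cont (PQ s t sab tcd).
  by have [] := closed_at_cont (PQ s t sab tcd).
have [->//|Jn0] := eqVneq (rect_int P Q a b c d) 0.
have : 0 < `|rect_int P Q a b c d| by rewrite normr_gt0.
have w0 : 0 <= b - a + (d - c) by rewrite addr_ge0 ?subr_ge0.
set J := `|_|; set w := b - a + _ in w0 * => Jpos.
(* Dividing by w + 1 in place of w gives eta w^2 < J strictly, so the whole rectangle is bad, also
   when w = 0. *)
pose eta := J / (w + 1) ^+ 2.
have w1 : 0 < w + 1 by clear -w0; lra.
have eta0 : 0 < eta by rewrite divr_gt0// exprn_gt0.
pose Bad a' b' c' d' := [/\ a <= a' /\ b' <= b, c <= c' /\ d' <= d &
  eta * (b' - a' + (d' - c')) ^+ 2 < `|rect_int P Q a' b' c' d'|].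
have [||s [t [sab tcd st]]] := @quadrisection Bad a b c d ab cd.
- split => //; rewrite -/w -/J /eta mulrAC ltr_pdivrMr ?exprn_gt0// ltr_pM2l//.
  by clear -w0; rewrite !expr2; nra.
- move=> a' b' c' d' ab' cd' [[aa bb] [cc dd] B] m n.
  have [x [y [z [u [h1 h2 h3]]]]] :=
    rect_int_quarter ab' cd' (separately_contS aa bb cc dd PQc) B.
  have [am mb] : a <= m /\ m <= b by rewrite /m; clear -ab' aa bb; lra.
  have [cn nd] : c <= n /\ n <= d by rewrite /n; clear -cd' cc dd; lra.
  case: h1 => -[xE yE]; case: h2 => -[zE uE]; rewrite xE yE zE uE in h3.
  + by apply: Or41.
  + by apply: Or43.
  + by apply: Or42.
  + by apply: Or44.
have [al [be [de h]]] := PQ s t sab tcd.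
(* On a rectangle of half-perimeter p the error is at most (eta / 2) p, and the factor 2 of
   [rect_int_local] turns this into eta p^2, which contradicts badness. *)
have eta2 : 0 < eta / 2 by rewrite divr_gt0.
have [del d0 hd] := h (eta / 2) eta2.
have [a' [b' [c' [d' [[[aa bb] [cc dd] B] [_ _ sab' tcd' [wd hd']]]]]]] := st del d0.
have [ab' cd'] : a' <= b' /\ c' <= d'.
  by clear -sab' tcd'; case/andP: sab' => ? ?; case/andP: tcd' => ? ?; split; lra.
exfalso; move: B; apply/negP; rewrite -leNgt.
apply: le_trans.
  apply: (@rect_int_local P Q (eta / 2 * (b' - a' + (d' - c'))) al be de (P s t) (Q s t) s t) => //.
    exact: separately_contS PQc.
  move=> x y xab ycd.
  have xs : `|x - s| <= b' - a' by clear -xab sab'; rewrite ler_norml; lra.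
  have yt : `|y - t| <= d' - c' by clear -ycd tcd'; rewrite ler_norml; lra.
  have [h1 h2] := hd x y (le_lt_trans xs wd) (le_lt_trans yt hd').
  have le : eta / 2 * (`|x - s| + `|y - t|) <= eta / 2 * (b' - a' + (d' - c')).
    by rewrite ler_pM2l// lerD.
  by split; [exact: le_trans h1 le|exact: le_trans h2 le].
by clear; rewrite le_eqVlt; apply/orP; left; apply/eqP; field.
Qed.

End Goursat.

(** The field is left general: the estimate serves complex derivatives of f as well as real
    derivatives of exp, cos and sin. *)
Lemma derivable_approx (K : numFieldType) (f : K^o -> K^o) (z : K) : derivable f z 1 ->
  forall e : K, 0 < e -> exists2 del : K, 0 < del &
    forall h, `|h| < del -> `|f (z + h) - f z - 'D_1 f z * h| <= e * `|h|.
Proof.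
move=> fd e e0.
have /cvgrPdist_lt /(_ e e0) :
    (fun h : K^o => h^-1 *: ((f \o shift z) (h *: (1 : K^o)) - f z)) @ 0^' --> 'D_1 f z.
  exact: fd.
case/nbhs_ballP => del /= del0 hd; exists del => // h hh.
have [->|h0] := eqVneq h 0; first by rewrite addr0 mulr0 subr0 subrr normr0 mulr0.
have := hd h; rewrite /ball /= sub0r normrN => /(_ hh h0).
rewrite /= /GRing.scale /= mulr1 [h + z]addrC => lt.
have -> : f (z + h) - f z - 'D_1 f z * h = - (('D_1 f z - h^-1 * (f (z + h) - f z)) * h).
  by rewrite mulrBl mulrAC mulVf// mul1r opprB.
by rewrite normrN normrM ler_wpM2r// ltW.
Qed.

(** * Complex differentiability in real inequalities, and the exponential *)

Section Complex.
Context {R : realType}.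
Local Notation C := R[i].

(** The modulus on R[i] has values in R[i]. This equivalent, submultiplicative norm has values in R,
    where the estimates become real arithmetic. *)
Definition norm1 (z : C) : R := `|complex.Re z| + `|complex.Im z|.

Lemma norm1_ge0 z : 0 <= norm1 z.
Proof. by rewrite addr_ge0. Qed.

Lemma norm1D z w : norm1 (z + w) <= norm1 z + norm1 w.
Proof.
case: z w => [a b] [c d]; rewrite /norm1 /=.
by rewrite addrACA lerD// ler_normD.
Qed.

Lemma norm1M z w : norm1 (z * w) <= norm1 z * norm1 w.
Proof.
case: z w => [a b] [c d]; rewrite /norm1 /= mulrDl !mulrDr -!normrM.
have := ler_normB (a * c) (b * d); have := ler_normD (a * d) (b * c).
by clear; lra.
Qed.

Lemma norm_lt_norm1 z e : norm1 z < e -> `|z| < e%:C%C.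
Proof.
case: z => a b; rewrite /norm1 /= => h; rewrite normc_def ltcR/=.
have e0 : 0 < e by apply: le_lt_trans h; rewrite addr_ge0.
have eE : Num.sqrt (e ^+ 2) = e by rewrite sqrtr_sqr gtr0_norm.
rewrite -eE ltr_sqrt ?exprn_gt0//.
rewrite -(real_normK (num_real a)) -(real_normK (num_real b)).
have := normr_ge0 a; have := normr_ge0 b; move: h; move: `|a| `|b| => x y; rewrite !expr2; nra.
Qed.

Lemma norm1_lt_norm z e : `|z| < e%:C%C -> norm1 z < 2 * e.
Proof.
case: z => a b; rewrite normc_def ltcR /= /norm1 /= => h.
have aux x y : `|x| <= Num.sqrt (x ^+ 2 + y ^+ 2) :> R.
  by rewrite -sqrtr_sqr ler_wsqrtr// lerDl sqr_ge0.
have := aux a b; have := aux b a; rewrite addrC; move: h.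
by clear; lra.
Qed.

Lemma norm1_le_norm z : (norm1 z)%:C%C <= 2 * `|z|.
Proof.
case: z => a b; rewrite normc_def -(rmorph_nat (@real_complex R)) -rmorphM lecR /= /norm1 /=.
have aux x y : `|x| <= Num.sqrt (x ^+ 2 + y ^+ 2) :> R.
  by rewrite -sqrtr_sqr ler_wsqrtr// lerDl sqr_ge0.
have := aux a b; have := aux b a; rewrite addrC.
by clear; lra.
Qed.

Definition cdiff (f : C -> C) (z : C) := exists A : C, forall e : R, 0 < e ->
  exists2 del : R, 0 < del & forall h, norm1 h < del ->
    norm1 (f (z + h) - f z - A * h) <= e * norm1 h.

Lemma derivable_cdiff (f : C^o -> C^o) (z : C) : derivable f z 1 -> cdiff f z.
Proof.
move=> fd; exists ('D_1 f z) => e e0.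
(* Passing between the modulus and [norm1] costs a factor 2 on the remainder and, with a crude
   bound, another factor 2 on h. *)
have e4 : 0 < (e / 4)%:C%C by rewrite ltcR divr_gt0.
have [del del0 hd] := derivable_approx fd e4.
have delR : del = (complex.Re del)%:C%C by rewrite RRe_real// gtr0_real.
exists (complex.Re del); first by rewrite -ltcR -delR.
move=> h /norm_lt_norm1; rewrite -delR => /hd le.
rewrite -lecR; apply: (le_trans (norm1_le_norm _)).
apply: (@le_trans _ _ (2 * ((e / 4)%:C%C * `|h|))); first by rewrite ler_pM2l.
have hle : `|h| <= 2 * (norm1 h)%:C%C.
  case: h {le} => a b; rewrite normc_def -(rmorph_nat (@real_complex R)) -rmorphM lecR /= /norm1 /=.
  rewrite -[leRHS]ger0_norm; last by rewrite mulr_ge0 ?addr_ge0.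
  rewrite -sqrtr_sqr ler_wsqrtr// -(real_normK (num_real a)) -(real_normK (num_real b)).
  have := normr_ge0 a; have := normr_ge0 b; move: `|a| `|b| => x y; rewrite !expr2; nra.
apply: (@le_trans _ _ (2 * ((e / 4)%:C%C * (2 * (norm1 h)%:C%C)))).
  by rewrite ler_pM2l// ler_pM2l.
rewrite -!(rmorph_nat (@real_complex R)) -!rmorphM lecR.
by rewrite le_eqVlt; apply/orP; left; apply/eqP; field.
Qed.

Lemma cdiff_cont (f : C -> C) z : cdiff f z -> forall e : R, 0 < e ->
  exists2 del : R, 0 < del & forall h, norm1 h < del -> norm1 (f (z + h) - f z) < e.
Proof.
move=> [A h] e e0; have [del d0 hd] := h 1 ltr01.
have K0 : 0 < norm1 A + 1 by have := norm1_ge0 A; lra.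
exists (Num.min del (e / (norm1 A + 1))); first by rewrite lt_min d0 divr_gt0.
move=> k; rewrite lt_min => /andP[/hd kd]; rewrite ltr_pdivlMr// => kA.
rewrite -(subrK (A * k) (f (z + k) - f z)); apply: le_lt_trans (norm1D _ _) _.
by have := norm1M A k; move: kd kA; clear; lra.
Qed.

Lemma real_derive_approx (f : R -> R) x df : is_derive (x : R^o) (1 : R^o) (f : R^o -> R^o) df ->
  forall e, 0 < e -> exists2 del, 0 < del &
    forall h, `|h| < del -> `|f (x + h) - f x - df * h| <= e * `|h|.
Proof.
move=> [fd fE] e e0; have [del d0 hd] := derivable_approx fd e0.
by exists del => // h /hd; rewrite fE.
Qed.

(** The exponential e^(s+it): s is the logarithm of the modulus and t the argument. *)
Definition cexp (s t : R) : C := Complex (expR s * cos t) (expR s * sin t).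

Lemma cexpD s t h k : cexp (s + h) (t + k) = cexp s t * cexp h k.
Proof.
apply/eqP; rewrite eq_complex /= cosD sinD expRD.
by apply/andP; split; apply/eqP; ring.
Qed.

Lemma cexp0 : cexp 0 0 = 1.
Proof. by rewrite /cexp expR0 cos0 sin0 !mul1r. Qed.

(** The arithmetic of [cexp_approx]. The variables stand for absolute values: H and K of h and k, c
    of cos k, c1 of cos k - 1, E0 of exp h - 1 - h, S0 of sin k - k, E1 of exp h - 1, S1 of sin k,
    H1 of 1 + h. The bound H < e absorbs the second-order product E1 S1. *)
Lemma cexp_approx_aux (e H K c c1 E0 S0 E1 S1 H1 : R) :
  0 < e -> e <= 1 -> 0 <= H -> H < e -> 0 <= K -> 0 <= S1 -> 0 <= E1 -> 0 <= c1 -> 0 <= E0 ->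
  c <= 1 -> c1 <= e * K -> E0 <= e * H -> S0 <= e * K -> H1 <= 1 + H -> E1 <= E0 + H ->
  S1 <= S0 + K -> E0 * c + H1 * c1 + (E1 * S1 + S0) <= 8 * e * (H + K).
Proof.
move=> e0 e1 H0 He K0 S10 E10 c10 E00 c1' c1K E0H S0K H1H E1E S1S.
have b1 : E0 * c <= e * H by nra.
have b2 : H1 * c1 <= 2 * (e * K) by nra.
have H1' : H <= 1 by lra.
have E1le : E1 <= 2 * e by nra.
have S1le : S1 <= 2 * K by nra.
have b3 : E1 * S1 <= (2 * e) * (2 * K) by apply: ler_pM.
by clear -b1 b2 b3 S0K e0 H0 K0; nra.
Qed.

Lemma cexp_approx e : 0 < e -> exists2 del, 0 < del & forall h k, `|h| < del -> `|k| < del ->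
  norm1 (cexp h k - 1 - Complex h k) <= e * (`|h| + `|k|).
Proof.
(* The 8 is the constant of [cexp_approx_aux]. *)
move=> e0; have [e1 [e1p e11 e18]] : exists e1, [/\ 0 < e1, e1 <= 1 & e1 <= e / 8].
  exists (Num.min 1 (e / 8)); split; rewrite ?ge_min ?lexx ?orbT//.
  by rewrite lt_min ltr01 divr_gt0.
have [d1 d10 h1] := real_derive_approx (is_derive_expR 0) e1p.
have [d2 d20 h2] := real_derive_approx (is_derive_cos 0) e1p.
have [d3 d30 h3] := real_derive_approx (is_derive_sin 0) e1p.
exists (Num.min (Num.min d1 d2) (Num.min d3 e1)).
  by rewrite !lt_min d10 d20 d30.
move=> h k; rewrite !lt_min.
move=> /andP[/andP[/h1 Eh _] /andP[_ he]] /andP[/andP[_ /h2 Ck] /andP[/h3 Sk ke]].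
move: Eh Ck Sk; rewrite !add0r expR0 cos0 sin0 oppr0 mul0r mul1r mul1r !subr0 => Eh Ck Sk.
rewrite /norm1 /=.
have C1 : `|cos k| <= 1 by rewrite ler_norml cos_geN1 cos_le1.
(* Real and imaginary part are expanded so that each summand contains one of the remainders exp h -
   1 - h, cos k - 1, sin k - k or is a product of two small factors. *)
have ReE : expR h * cos k - 1 - h = (expR h - 1 - h) * cos k + (1 + h) * (cos k - 1) by ring.
have -> : expR h * sin k - 0 - k = (expR h - 1 - h + h) * (sin k - k + k) + (sin k - k) by ring.
rewrite ReE.
apply: (le_trans (lerD (ler_normD _ _) (ler_normD _ _))); rewrite !normrM.
apply: le_trans (_ : 8 * e1 * (`|h| + `|k|) <= _); last first.
  by rewrite ler_wpM2r ?addr_ge0//; clear -e18; lra.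
apply: cexp_approx_aux => //; try exact: normr_ge0.
- by move: Sk; rewrite addr0.
- by have := ler_normD 1 h; rewrite normr1.
- exact: ler_normD.
- exact: ler_normD.
Qed.

End Complex.

(** * The maximum principle for the real part on a disc *)

Section MaxPrinciple.
Context {R : realType}.
Local Notation C := R[i].

(** With A the derivative of f and B = c e^(s+it), the differential of f(z + c e^(s+it)) is A B (ds
    + i dt). The t-derivative of its imaginary part and the s-derivative of its real part are thus
    both Re(AB), which is closedness. *)
Lemma cdiff_polar (f : C -> C) (z c : C) s t : cdiff f (z + c * cexp s t) ->
  closed_at (fun s t => complex.Im (f (z + c * cexp s t)))
    (fun s t => complex.Re (f (z + c * cexp s t))) s t.
Proof.
set w := z + _; move=> [A fA]; pose B := c * cexp s t.
exists (complex.Im (A * B)), (complex.Re (A * B)), (- complex.Im (A * B)) => e e0.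
pose K := norm1 B + 1; pose N := norm1 A + 1.
have K1 : 1 <= K by rewrite /K lerDr norm1_ge0.
have N1 : 1 <= N by rewrite /N lerDr norm1_ge0.
have K0 : 0 < K by apply: lt_le_trans K1.
have N0 : 0 < N by apply: lt_le_trans N1.
(* Each of two errors gets e / 2. The remainder of f at w is at most e2 times [norm1 eta], which
   stays below 2 K (|h| + |k|) because e1 <= 1; the remainder of the exponential, multiplied by A B,
   is controlled by e1 N K. *)
pose e2 := e / (4 * K); have e20 : 0 < e2 by rewrite divr_gt0// mulr_gt0.
have [d2 d20 h2] := fA e2 e20.
pose e1 := Num.min 1 (e / (2 * (N * K))).
have [e10 e11 e12] : [/\ 0 < e1, e1 <= 1 & e1 * (N * K) <= e / 2].
  split.
  - by rewrite /e1 lt_min ltr01 divr_gt0// !mulr_gt0.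
  - by rewrite /e1 ge_min lexx.
  - rewrite -ler_pdivlMr ?mulr_gt0// /e1 ge_min; apply/orP; right.
    by rewrite invfM mulrA.
have [d1 d10 h1] := cexp_approx e10.
(* With |h| and |k| below d2 / (4 K), the increment [eta] stays below d2. *)
exists (Num.min d1 (d2 / (4 * K))).
  by rewrite lt_min d10 divr_gt0// mulr_gt0.
move=> s' t'; rewrite !lt_min => /andP[s1 s2] /andP[t1 t2].
pose h := s' - s; pose k := t' - t.
have E1 := h1 h k s1 t1.
pose eta := B * (cexp h k - 1).
have wE : z + c * cexp s' t' = w + eta.
  have -> : cexp s' t' = cexp s t * cexp h k by rewrite -cexpD /h /k ![_ + (_ - _)]addrC !subrK.
  by rewrite /w /eta /B; ring.
have hk0 : 0 <= `|h| + `|k| by rewrite addr_ge0.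
have etaE : norm1 (eta - B * Complex h k) <= e1 * K * (`|h| + `|k|).
  rewrite /eta -mulrBr; apply: (le_trans (norm1M _ _)).
  rewrite [e1 * K]mulrC -mulrA; apply: ler_pM => //; try exact: norm1_ge0.
  by rewrite /K lerDl.
have etaN : norm1 eta <= 2 * K * (`|h| + `|k|).
  rewrite -(subrK (B * Complex h k) eta); apply: (le_trans (norm1D _ _)).
  have -> : 2 * K * (`|h| + `|k|) = K * (`|h| + `|k|) + K * (`|h| + `|k|).
    by clear; move: (`|h| + `|k|) => u; ring.
  apply: lerD.
    by apply: (le_trans etaE); rewrite ler_wpM2r// ger_pMl//.
  apply: (le_trans (norm1M _ _)); by rewrite ler_wpM2r// /K lerDl.
have etad : norm1 eta < d2.
  apply: (le_lt_trans etaN).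
  have : `|h| + `|k| < d2 / (4 * K) + d2 / (4 * K) by rewrite ltrD.
  rewrite -(ltr_pM2l (_ : 0 < 2 * K)); last by rewrite mulr_gt0.
  move/lt_le_trans; apply.
  by rewrite le_eqVlt; apply/orP; left; apply/eqP; field; rewrite gt_eqF.
have E2 := h2 eta etad.
have key : norm1 (f (w + eta) - f w - A * B * Complex h k) <= e * (`|h| + `|k|).
  have -> : f (w + eta) - f w - A * B * Complex h k =
    (f (w + eta) - f w - A * eta) + A * (eta - B * Complex h k).
    by ring.
  apply: (le_trans (norm1D _ _)).
  have -> : e * (`|h| + `|k|) = e / 2 * (`|h| + `|k|) + e / 2 * (`|h| + `|k|).
    by clear; move: (`|h| + `|k|) => u; field.
  apply: lerD.
    apply: (le_trans E2).
    apply: (@le_trans _ _ (e2 * (2 * K * (`|h| + `|k|)))); first by rewrite ler_pM2l.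
    rewrite le_eqVlt; apply/orP; left; apply/eqP; rewrite /e2.
    by clear -K0; move: (`|h| + `|k|) => u; field; rewrite gt_eqF.
  apply: (le_trans (norm1M _ _)).
  apply: (@le_trans _ _ (N * (e1 * K * (`|h| + `|k|)))).
    apply: ler_pM => //; try exact: norm1_ge0.
    by rewrite /N lerDl.
  by rewrite mulrA ler_wpM2r// mulrCA.
rewrite wE -/w -/h -/k.
move: key; rewrite /norm1.
move: (f (w + eta)) (f w) (A * B) => [a b] [a' b'] [al be] /= key.
split.
  apply: le_trans key.
  apply: le_trans (_ : _ <= `|b - b' - (al * k + be * h)|) _; last by rewrite lerDr.
  by rewrite le_eqVlt; apply/orP; left; apply/eqP; congr `|_|; ring.
apply: le_trans key.
apply: le_trans (_ : _ <= `|a - a' - (al * h - be * k)|) _; last by rewrite lerDl.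
by rewrite le_eqVlt; apply/orP; left; apply/eqP; congr `|_|; ring.
Qed.

Lemma norm_cexp s t : `|cexp s t : C| = (expR s)%:C%C.
Proof.
rewrite normc_def /= !exprMn -mulrDr cos2Dsin2 mulr1 sqrtr_sqr.
by rewrite gtr0_norm// expR_gt0.
Qed.

(** Splitting at - del and del, the deficit e is collected on the middle piece, of length 2 del. *)
Lemma seg_int_lt (g : R -> R) (u e del : R) : 0 < del -> del <= pi ->
  cont_on g (- pi) pi -> (forall t, g t <= u) ->
  (forall t, `|t| <= del -> g t <= u - e) ->
  seg_int g (- pi) pi <= u * (pi + pi) - e * (del + del).
Proof.
move=> d0 dpi gc gu ge.
have p0 : - pi <= - del :> R by rewrite lerN2.
have p1 : - del <= del by lra.
rewrite (@seg_int_split _ _ _ (- del) pi)//; last by lra.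
rewrite (@seg_int_split _ _ (- del) del pi)//; last first.
  by apply: cont_onS gc.
have b1 : seg_int g (- pi) (- del) <= u * (- del - - pi).
  rewrite -seg_int_cst//; apply: le_seg_int => //; last exact: cont_on_cst.
  by apply: cont_onS gc => //; lra.
have b2 : seg_int g (- del) del <= (u - e) * (del - - del).
  rewrite -seg_int_cst//; apply: le_seg_int; [|exact: cont_on_cst|].
    by apply: cont_onS gc.
  by move=> t tt; apply: ge; rewrite ler_norml.
have b3 : seg_int g del pi <= u * (pi - del).
  rewrite -seg_int_cst//; apply: le_seg_int => //; last exact: cont_on_cst.
  by apply: cont_onS gc => //; lra.
clear -b1 b2 b3; lra.
Qed.

(* If Re f < Re f(z0) at z0 + c, then the mean of Re f over the circle through
   z0 + c is smaller than Re f(z0).  But by Goursat's theorem for the form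
   Im F ds + Re F dt, where F(s, t) = f(z0 + c e^(s+it)), on [s1, 0] x [-pi, pi] it
   equals the mean over a circle of arbitrarily small radius: the sides t = -pi and
   t = pi cancel. *)
Theorem Re_max_principle (f : C -> C) (z0 : C) (rho : R) :
  (forall w, `|w - z0| < rho%:C%C -> cdiff f w) ->
  (forall w, `|w - z0| < rho%:C%C -> complex.Re (f w) <= complex.Re (f z0)) ->
  forall w, `|w - z0| < rho%:C%C -> complex.Re (f w) = complex.Re (f z0).
Proof.
move=> fd fmax w hw; apply/eqP; rewrite eq_le fmax//= leNgt; apply/negP => lt.
pose c := w - z0; pose F s t := f (z0 + c * cexp s t).
have pi0 : 0 < pi :> R := pi_gt0 R.
have rho0 : 0 < rho by rewrite -ltcR; exact: le_lt_trans (normr_ge0 (w - z0)) hw.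
(* For s <= 0 the circle has radius |c| e^s <= |c| < rho. *)
have inball s t : s <= 0 -> `|z0 + c * cexp s t - z0| < rho%:C%C.
  move=> s0; rewrite addrC addKr normrM norm_cexp.
  apply: le_lt_trans hw; rewrite ler_piMr// lecR.
  by rewrite -expR0 ler_expR.
have clos s t : s <= 0 ->
    closed_at (fun s t => complex.Im (F s t)) (fun s t => complex.Re (F s t)) s t.
  by move=> s0; apply: cdiff_polar; apply: fd; exact: inball.
have F00 : F 0 0 = f w by rewrite /F cexp0 mulr1 addrC subrK.
pose eta := complex.Re (f z0) - complex.Re (f w).
have eta0 : 0 < eta by rewrite subr_gt0.
have Qc s : s <= 0 -> cont_on (fun t => complex.Re (F s t)) (- pi) pi.
  by move=> s0 t _; have [] := closed_at_cont (clos s t s0).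
have [del [del0 le_del hdel]] : exists del, [/\ 0 < del, del <= pi &
    forall t, `|t| <= del -> complex.Re (F 0 t) <= complex.Re (f z0) - eta / 2].
  have [_ ct] := closed_at_cont (clos 0 0 (lexx 0)).
  have /cvgrPdist_lt /(_ (eta / 2)) := ct.
  rewrite divr_gt0// => /(_ isT) /nbhs_ballP[d /= d0 hd].
  exists (Num.min (d / 2) pi); split.
  - by rewrite lt_min divr_gt0.
  - by rewrite ge_min lexx orbT.
  - move=> t; rewrite le_min => /andP[td _].
    have /hd : ball 0 d t by rewrite /ball /= sub0r normrN; move: td d0; lra.
    by rewrite /= F00 ltr_norml /eta; lra.
(* On the outer circle the arc |t| <= del loses at least (eta / 2)(2 del) = eta del. On the inner
   one a deficit of at most eta del / (4 pi), over the length 2 pi, loses at most eta del / 2. The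
   two integrals cannot be equal. *)
have [s1 [s10 hs1]] : exists s1, s1 <= 0 /\
    forall t, complex.Re (f z0) - eta * del / (2 * pi + 2 * pi) <= complex.Re (F s1 t).
  have e0 : 0 < eta * del / (2 * pi + 2 * pi) by rewrite divr_gt0 ?mulr_gt0// addr_gt0// mulr_gt0.
  have z0b : `|z0 - z0| < rho%:C%C by rewrite subrr normr0 ltcR.
  have [r r0 hr] := cdiff_cont (fd z0 z0b) e0.
  (* x is the ratio e^s1 of the radii. The bound 1 keeps s1 = ln x nonpositive, and the other bound
     puts the inner circle within r of z0, since [norm1] of e^(s1+it) is at most 2 x. *)
  pose x := Num.min 1 (r / (2 * (norm1 c + 1))).
  have c0 : 0 < norm1 c + 1 by have := norm1_ge0 c; lra.
  have x0 : 0 < x by rewrite /x lt_min ltr01 divr_gt0// mulr_gt0.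
  exists (ln x); split; first by apply: ln_le0; rewrite /x ge_min lexx.
  move=> t; have nle : norm1 (c * cexp (ln x) t) < r.
    apply: (le_lt_trans (norm1M _ _)).
    have : norm1 (cexp (ln x) t) <= 2 * x.
      rewrite /norm1 /= lnK ?posrE// !normrM gtr0_norm//.
      have c1 : `|cos t| <= 1 by rewrite ler_norml cos_geN1 cos_le1.
      have s1 : `|sin t| <= 1 by rewrite ler_norml sin_geN1 sin_le1.
      by clear -c1 s1 x0; nra.
    have : 2 * x * (norm1 c + 1) <= r.
      rewrite -ler_pdivlMr// [leRHS](_ : _ = 2 * (r / (2 * (norm1 c + 1)))); last first.
        by field; rewrite gt_eqF.
      by rewrite ler_pM2l// /x ge_min lexx orbT.
    move: (norm1_ge0 c) x0; clear; move: (norm1 _) (norm1 _) => p q; nra.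
  have := hr _ nle; rewrite -/(F _ t) /norm1 => /(le_lt_trans _) lt1.
  have : `|complex.Re (F (ln x) t - f z0)| < eta * del / (2 * pi + 2 * pi).
    by apply: lt1; rewrite lerDl.
  case: (F _ t) (f z0) => [a b] [a' b'] /=; rewrite ltr_norml => /andP[+ _].
  by clear; lra.
have npi : - pi <= pi :> R by lra.
have : rect_int (fun s t => complex.Im (F s t)) (fun s t => complex.Re (F s t))
    s1 0 (- pi) pi = 0.
  by apply: goursat => // s t /andP[_ s0] _; exact: clos.
rewrite /rect_int.
have -> : (fun s => complex.Im (F s (- pi))) = (fun s => complex.Im (F s pi)).
  by apply/funext => s; rewrite /F /cexp cosN sinN sinpi oppr0.
rewrite subrr add0r => /eqP; rewrite subr_eq0 => /eqP E.
have u1 : seg_int (fun t => complex.Re (F 0 t)) (- pi) pi <=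
    complex.Re (f z0) * (pi + pi) - eta / 2 * (del + del).
  apply: (seg_int_lt del0 le_del (Qc 0 (lexx 0)) _ hdel).
  by move=> t; apply: fmax; exact: inball.
have u2 : (complex.Re (f z0) - eta * del / (2 * pi + 2 * pi)) * (pi - - pi) <=
    seg_int (fun t => complex.Re (F s1 t)) (- pi) pi.
  rewrite -(seg_int_cst _ npi).
  by apply: (le_seg_int (@cont_on_cst _ _ _ _) (Qc s1 s10)) => t _; exact: hs1.
have eE (p : R) : 0 < p -> eta * del / (2 * p + 2 * p) * (p - - p) = eta * del / 2.
  by clear=> p0; field; rewrite gt_eqF// addr_gt0// mulr_gt0.
have : 0 < eta * del by rewrite mulr_gt0.
move: u1 u2; rewrite E [X in _ -> X <= _ -> _](mulrBl _ (complex.Re (f z0))) (eE _ pi0); clear.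
by move: pi (seg_int _ _ _) => p x; lra.
Qed.

End MaxPrinciple.

(** * Holomorphic functions on a compact Riemann surface are constant *)

Section Liouville.
Context {R : realType} {X : compact_riemann_surface R}.

Lemma holo_cdiff (f : X -> R[i]) (c : chart R X) (y : X) : rs_atlas c -> holo_at f y ->
  cdom c y -> cdiff (f \o cbwd c) (cfwd c y).
Proof. by move=> ca hf cy; apply: derivable_cdiff; exact: hf. Qed.

Lemma holo_Re_continuous (f : X -> R[i]) : holo setT f -> continuous (fun x => complex.Re (f x)).
Proof.
move=> hf x; apply/cvgrPdist_lt => e e0.
have [c ca cx] := rs_cover x.
have [del d0 hd] := cdiff_cont (holo_cdiff ca (hf x I) cx) e0.
have dC : 0 < (del / 2)%:C%C by rewrite ltcR divr_gt0.
have /cvgrPdist_lt /(_ _ dC) nc := cfwd_cont cx.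
have cN : \forall y \near x, cdom c y by apply: open_nbhs_nbhs; split => //; exact: cdom_open.
near=> y.
have cy : cdom c y by near: y.
have : `|cfwd c x - cfwd c y| < (del / 2)%:C%C by near: y.
rewrite distrC => /norm1_lt_norm; rewrite mulrC divfK ?pnatr_eq0// => /hd.
rewrite [cfwd c x + _]addrC subrK /= !cfwdK//.
rewrite /norm1 => /(le_lt_trans _) h; rewrite distrC.
have -> : complex.Re (f y) - complex.Re (f x) = complex.Re (f y - f x).
  by case: (f y) (f x) => [? ?] [? ?].
by apply: h; rewrite lerDl.
Unshelve. all: by end_near. Qed.

(** By compactness the real part attains its maximum. The set where it does is closed by continuity
    and open by the maximum principle in a chart, hence everything by connectedness. *)
Lemma holo_Re_constant (f : X -> R[i]) : holo setT f ->
  forall x y, complex.Re (f x) = complex.Re (f y).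
Proof.
move=> hf x y; pose g x := complex.Re (f x).
have gc : continuous g by exact: holo_Re_continuous.
have [p pmax] : exists p, forall x, g x <= g p.
  have [p _ pmax] := @compact_EVT_max X R g [set: X] (ex_intro _ x I)
    (@rs_compact R X) (@continuous_subspaceT X R _ g gc).
  by exists p => z; apply: pmax; rewrite inE.
have A : [set x | g x = g p] = setT.
  apply: (@rs_connected R X).
  - by exists p.
  - exists [set x | g x = g p]; last by rewrite setTI.
    rewrite openE => z /= gz; have [c ca cz] := rs_cover z.
    (* The inverse chart is under control on the image of the chart only, so the disc for the
       maximum principle is taken inside this open image. *)
    have : nbhs (cfwd c z) (cfwd c @` cdom c).
      by apply: open_nbhs_nbhs; split; [exact: cimg_open|exists z].
    case/nbhs_ballP => r /= r0 br.
    have rE : r = (complex.Re r)%:C%C by rewrite RRe_real// gtr0_real.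
    have inU w : `|w - cfwd c z| < r -> exists2 y, cdom c y & cfwd c y = w.
      by move=> h; have [|v ? <-] := br w; [rewrite /ball /= distrC|exists v].
    have loc w : `|w - cfwd c z| < r -> g (cbwd c w) = g z.
      have := @Re_max_principle R (f \o cbwd c) (cfwd c z) (complex.Re r).
      rewrite -rE /= cfwdK// => h; apply: h => v /inU[u cu <-].
        exact: (holo_cdiff ca (hf u I) cu).
      by rewrite cfwdK// -/(g u) -/(g z) gz.
    have cN : \forall y \near z, cdom c y by apply: open_nbhs_nbhs; split => //; exact: cdom_open.
    have /cvgrPdist_lt /(_ _ r0) nc := cfwd_cont cz.
    near=> v; have cv : cdom c v by near: v.
    rewrite /= -gz -(cfwdK cv); apply: loc; rewrite distrC; near: v.
    exact: nc.
  - exists [set x | g x = g p]; last by rewrite setTI.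
    rewrite (_ : [set x | _] = g @^-1` [set g p])//; apply: preimage_closed; last exact: closed_eq.
    by move=> z _; exact: gc.
have AE z : g z = g p by have : [set x | g x = g p] z by rewrite A.
by rewrite -/(g x) -/(g y) !AE.
Unshelve. all: by end_near. Qed.

(** The imaginary part of f is minus the real part of i f. *)
Theorem holo_constant (f : X -> R[i]) : holo setT f -> forall x y, f x = f y.
Proof.
move=> hf x y; have hif : holo setT (fun z => 'i%C * f z).
  by move=> z _; apply: holo_atM; [exact: holo_at_cst|exact: hf].
have := holo_Re_constant hf x y; have := holo_Re_constant hif x y.
case: (f x) (f y) => [a b] [a' b'] /=.
by rewrite !mul0r !mul1r !sub0r => /oppr_inj -> ->.
Qed.

End Liouville.

(** * Morphisms of vector bundles and cohomology *)

Section Linear.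
Context {R : realType} {X : compact_riemann_surface R}.

(** The condition is local on X, so the intermediate trivialisation may change from point to
    point. *)
Lemma lin_in_comp (F F' F'' : X -> Type) r s u (f : forall x, F x -> F' x)
    (g : forall x, F' x -> F'' x) (t : ltriv F r) (t'' : ltriv F'' u) :
  (forall x, tdom t x -> tdom t'' x -> exists t' : ltriv F' s,
    [/\ tdom t' x, lin_in f t t' & lin_in g t' t'']) ->
  lin_in (fun x v => g x (f x v)) t t''.
Proof.
move=> loc; apply: lin_in_local => x tx t''x.
have [t' [t'x [N hN Nf] [M hM Mg]]] := loc x tx t''x.
exists (tdom t `&` tdom t' `&` tdom t''), (fun x => M x *m N x); split => //.
- by do 2![apply: openI; last exact: tdom_open]; exact: tdom_open.
- apply: mxholoM; first by apply: mxholoS hM => y [[]].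
  by apply: mxholoS hN => y [[]].
- by move=> y [[_ t'y] _] ty t''y v; rewrite Mg// Nf// mulmxA.
Qed.

Lemma vatlas_vtriv r (E : vbundle X r) t : vatlas E t -> vtriv t.
Proof. by move=> ta t' t'a; split; exact: vcompat. Qed.

Definition vmorph_comp r s u (E : vbundle X r) (E' : vbundle X s) (E'' : vbundle X u)
  (g : vmorph E' E'') (f : vmorph E E') : vmorph E E''.
Proof.
apply: (@VMorph _ _ _ _ E E'' (fun x v => g x (f x v))) => t t'' ta t''a.
apply: lin_in_comp => x tx t''x; have [t' t'a t'x] := vcover E' x.
by exists t'; split => //; exact: vm_holo.
Defined.

(** Trivialisations adapted to a line subbundle need not belong to the atlas; this lets morphisms be
    read in them. *)
Lemma vmorph_vtriv r s (E : vbundle X r) (E' : vbundle X s) (f : vmorph E E') t t' :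
  vtriv t -> vtriv t' -> lin_in f t t'.
Proof.
move=> ht ht'.
apply: (@lin_in_comp _ _ _ _ _ _ (fun x => @id (vfib E x)) f) => x tx t'x.
have [u ua ux] := vcover E x; exists u; split => //; first exact: (ht u ua).1.
apply: (@lin_in_comp _ _ _ _ _ _ f (fun x => @id (vfib E' x))) => y uy t'y.
have [u' u'a u'y] := vcover E' y; exists u'; split => //; first exact: vm_holo.
exact: (ht' u' u'a).2.
Qed.

Definition vmorph_id r (E : vbundle X r) : vmorph E E :=
  @VMorph _ _ _ _ E E (fun x => @id (fibre E x)) (@vcompat _ _ _ E).

Definition viso_id r (E : vbundle X r) : viso E E :=
  @VIso _ _ _ E E (vmorph_id E) (vmorph_id E) (fun _ _ => erefl) (fun _ _ => erefl).

Definition viso_inv r (E E' : vbundle X r) (f : viso E E') : viso E' E :=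
  @VIso _ _ _ E' E (vi_inv f) f (@vi_invK _ _ _ _ _ f) (@vi_funK _ _ _ _ _ f).

Definition viso_comp r (E E' E'' : vbundle X r) (g : viso E' E'') (f : viso E E') : viso E E''.
Proof.
apply: (@VIso _ _ _ E E'' (vmorph_comp g f) (vmorph_comp (vi_inv f) (vi_inv g))).
  by move=> x v /=; rewrite !vi_funK.
by move=> x v /=; rewrite !vi_invK.
Defined.

Definition vmorph_scale r (E : vbundle X r) (a : R[i]) : vmorph E E.
Proof.
apply: (@VMorph _ _ _ _ E E (fun x (v : fibre E x) => a *: v)) => t t' ta t'a.
have [N hN h] := vcompat ta t'a; exists (fun x => a%:M *m N x).
  by apply: mxholoM; [exact: mxholo_cst|exact: hN].
move=> x tx t'x v; rewrite tmapZ//; have /= -> := h x tx t'x v.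
by rewrite -mulmxA mul_scalar_mx.
Defined.

(** Scalars serve to adjust an isomorphism L(A) -> E so that it matches the framings. *)
Definition viso_scale r (E : vbundle X r) (a : R[i]) (a0 : a != 0) : viso E E.
Proof.
apply: (@VIso _ _ _ E E (vmorph_scale E a) (vmorph_scale E a^-1)) => x v /=.
  by rewrite scalerA mulVf// scale1r.
by rewrite scalerA mulfV// scale1r.
Defined.

Lemma vmorph0 r s (E : vbundle X r) (E' : vbundle X s) (f : vmorph E E') x : f x 0 = 0.
Proof. by apply: (addrI (f x 0)); rewrite -vmorphD !addr0. Qed.

Lemma vmorphZ r s (E : vbundle X r) (E' : vbundle X s) (f : vmorph E E') x a v :
  f x (a *: v) = a *: f x v.
Proof. by rewrite -[a *: v]addr0 vmorph_linear vmorph0 addr0. Qed.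

Lemma vmorphN r s (E : vbundle X r) (E' : vbundle X s) (f : vmorph E E') x v :
  f x (- v) = - f x v.
Proof. by rewrite -scaleN1r vmorphZ scaleN1r. Qed.

Lemma vmorphB r s (E : vbundle X r) (E' : vbundle X s) (f : vmorph E E') x v w :
  f x (v - w) = f x v - f x w.
Proof. by rewrite vmorphD vmorphN. Qed.


Lemma H1class_eq r (E : vbundle X r) (c c' : cocycle E) :
  H1class c = H1class c' <-> cohomologous c c'.
Proof.
split=> [/(congr1 sval)/= ->|cc']; first exact: cohomologous_refl.
apply: eq_exist; apply/funext => d; apply/propext; split.
  exact/cohomologous_trans/cohomologous_sym.
exact: cohomologous_trans.
Qed.

(** The zero cochain is a witness. With [phi] the identity this compares cocycles on one cover with
    equal values, which is how functoriality of H^1 is obtained. *)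
Lemma cohomologous_refine r (E : vbundle X r) (c c' : cocycle E) (phi : cidx c -> cidx c') :
  (forall i, ccov c i `<=` ccov c' (phi i)) ->
  (forall i j x, ccov c i x -> ccov c j x -> cval c i j x = cval c' (phi i) (phi j) x) ->
  cohomologous c c'.
Proof.
move=> sub h; exists (cidx c), (ccov c), id, phi, (fun _ _ => 0); split.
- by move=> k; split; [exact: ccov_open|exact: hsec0].
- exact: ccovP.
- by move=> k x kx; split => //; exact: sub.
- by move=> k l x kx lx; rewrite h// !subrr.
Qed.

Lemma cohomologous_map r s (E : vbundle X r) (E' : vbundle X s)
    (f : vmorph E E') (c c' : cocycle E) :
  cohomologous c c' -> cohomologous (cocycle_map f c) (cocycle_map f c').
Proof.
move=> [K [W [tau [tau' [q [hW cW sub h]]]]]].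
exists K, W, tau, tau', (fun k x => f x (q k x)); split => //.
- by move=> k; have [oW hq] := hW k; split => //; exact: hsec_map.
- by move=> k l x Wk Wl /=; rewrite -!vmorphB h.
Qed.

Lemma H1mapE r s (E : vbundle X r) (E' : vbundle X s)
    (f : vmorph E E') (c : cocycle E) :
  H1map f (H1class c) = H1class (cocycle_map f c).
Proof.
rewrite /H1map; apply/H1class_eq; apply: cohomologous_map.
by apply/H1class_eq; rewrite H1reprK.
Qed.


Lemma H1_ind r (E : vbundle X r) (P : H1 E -> Prop) :
  (forall c, P (H1class c)) -> forall h, P h.
Proof. by move=> hP h; rewrite -(H1reprK h). Qed.

Lemma H1map_zero r s (E : vbundle X r) (E' : vbundle X s) (f : vmorph E E') :
  H1map f (H1zero E) = H1zero E'.
Proof.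
rewrite /H1zero H1mapE; apply/H1class_eq.
apply: (@cohomologous_refine _ _ (cocycle_map f (cocycle0 E)) (cocycle0 E') id) => //= *.
exact: vmorph0.
Qed.

(** The composite enters as any k with the right values, because morphisms with equal values may
    still carry different proofs. *)
Lemma H1map_comp r s u (E : vbundle X r) (E' : vbundle X s) (E'' : vbundle X u)
    (g : vmorph E' E'') (f : vmorph E E') (k : vmorph E E'') :
  (forall x v, k x v = g x (f x v)) -> forall h, H1map g (H1map f h) = H1map k h.
Proof.
move=> kE; apply: H1_ind => c; rewrite !H1mapE; apply/H1class_eq.
by apply: (@cohomologous_refine _ _ (cocycle_map g (cocycle_map f c)) (cocycle_map k c) id)
  => //= *.
Qed.

Lemma H1map_id r (E : vbundle X r) (f : vmorph E E) :
  (forall x v, f x v = v) -> forall h, H1map f h = h.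
Proof.
move=> fE; apply: H1_ind => c; rewrite !H1mapE; apply/H1class_eq.
by apply: (@cohomologous_refine _ _ (cocycle_map f c) c id) => //= *.
Qed.
End Linear.

(** * Affine bundles and their invariant *)

Section Affine.
Context {R : realType} {X : compact_riemann_surface R}.

Lemma mxholoB (U : set X) m n (M N : X -> 'M[R[i]]_(m, n)) :
  mxholo U M -> mxholo U N -> mxholo U (fun x => M x - N x).
Proof.
move=> hM hN i j x Ux.
rewrite (_ : (fun y => _) = fun y => M y i j + (-1) * N y i j).
  apply: (holo_atD (hM i j x Ux)).
  exact: (holo_atM (@holo_at_cst _ _ (-1) x) (hN i j x Ux)).
by apply/funext => y; rewrite !mxE mulN1r.
Qed.

Lemma mxholo_col_mx (U : set X) m1 m2 n (M : X -> 'M[R[i]]_(m1, n)) (N : X -> 'M[R[i]]_(m2, n)) :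
  mxholo U M -> mxholo U N -> mxholo U (fun x => col_mx (M x) (N x)).
Proof.
move=> hM hN i j x Ux.
rewrite (_ : (fun y => _) = fun y => match fintype.split i with
  | inl k => M y k j | inr k => N y k j end).
  by case: (fintype.split i) => k; [exact: hM|exact: hN].
by apply/funext => y; rewrite /col_mx !mxE; case: fintype.split.
Qed.

Lemma mxholo_dsubmx (U : set X) m1 m2 n (M : X -> 'M[R[i]]_(m1 + m2, n)) :
  mxholo U M -> mxholo U (fun x => dsubmx (M x)).
Proof.
move=> hM i j x Ux; rewrite (_ : (fun y => _) = fun y => M y (rshift m1 i) j).
  exact: hM.
by apply/funext => y; rewrite mxE.
Qed.

Lemma eq_affine_cV r s (N N' : 'M[R[i]]_(s, r)) (b b' : 'cV[R[i]]_s) :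
  (forall v, N *m v + b = N' *m v + b') -> N = N' /\ b = b'.
Proof.
move=> h; have bb : b = b' by have := h 0; rewrite !mulmx0 !add0r.
by split => //; apply: eq_mulmx_cV => v; apply: (addIr b); rewrite h bb.
Qed.

(** An affine map determines its linear part and its constant term, so the pair chosen at each point
    agrees with the local holomorphic pair. *)
Lemma aff_in_local (F F' : X -> Type) r s (f : forall x, F x -> F' x)
    (t : ltriv F r) (t' : ltriv F' s) :
  (forall x, tdom t x -> tdom t' x ->
    exists (W : set X) (N : X -> 'M[R[i]]_(s, r)) (b : X -> 'cV[R[i]]_s),
    [/\ open W /\ W x, mxholo W N, mxholo W b &
      forall y, W y -> tdom t y -> tdom t' y ->
      forall v, tmap t' (f y v) = N y *m tmap t v + b y]) ->
  aff_in f t t'.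
Proof.
move=> loc; pose U := tdom t `&` tdom t'.
have oU : open U by apply: openI; exact: tdom_open.
have pt x : exists Nb : 'M_(s, r) * 'cV_s, U x ->
    forall v, tmap t' (f x v) = Nb.1 *m tmap t v + Nb.2.
  have [Ux|nUx] := pselect (U x); last by exists 0.
  have [W [N [b [[_ Wx] _ _ h]]]] := loc x Ux.1 Ux.2.
  by exists (N x, b x) => _ v; exact: h Ux.1 Ux.2 _.
pose M x := projT1 (cid (pt x)).
have ME x : U x -> forall v, tmap t' (f x v) = (M x).1 *m tmap t v + (M x).2.
  by rewrite /M; case: cid.
have eqM x : U x -> exists (W : set X) (N : X -> 'M[R[i]]_(s, r)) (b : X -> 'cV[R[i]]_s),
    [/\ open W /\ W x, mxholo W N, mxholo W b &
      forall y, W y -> U y -> N y = (M y).1 /\ b y = (M y).2].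
  move=> Ux; have [W [N [b [oW hN hb h]]]] := loc x Ux.1 Ux.2.
  exists W, N, b; split => // y Wy Uy; apply: eq_affine_cV => z.
  have [v <-] := bij_surj z (tmap_bij Uy.1).
  by rewrite -ME// h//; case: Uy.
exists (fun x => (M x).1), (fun x => (M x).2); split.
- move=> i j x Ux; have [W [N [b [[oW Wx] hN hb h]]]] := eqM x Ux.
  apply: (holo_at_local (openI oW oU) _ _ (hN i j x Wx)) => // y [Wy Uy].
  by rewrite (h y Wy Uy).1.
- move=> i j x Ux; have [W [N [b [[oW Wx] hN hb h]]]] := eqM x Ux.
  apply: (holo_at_local (openI oW oU) _ _ (hb i j x Wx)) => // y [Wy Uy].
  by rewrite (h y Wy Uy).2.
- by move=> x tx t'x v; exact: ME.
Qed.

Lemma aff_in_comp (F F' F'' : X -> Type) r s u (f : forall x, F x -> F' x)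
    (g : forall x, F' x -> F'' x) (t : ltriv F r) (t'' : ltriv F'' u) :
  (forall x, tdom t x -> tdom t'' x -> exists t' : ltriv F' s,
    [/\ tdom t' x, aff_in f t t' & aff_in g t' t'']) ->
  aff_in (fun x v => g x (f x v)) t t''.
Proof.
move=> loc; apply: aff_in_local => x tx t''x.
have [t' [t'x [N [b [hN hb Nf]]] [M [c [hM hc Mg]]]]] := loc x tx t''x.
have S1 : tdom t `&` tdom t' `&` tdom t'' `<=` tdom t `&` tdom t' by move=> y [[]].
have S2 : tdom t `&` tdom t' `&` tdom t'' `<=` tdom t' `&` tdom t'' by move=> y [[]].
exists (tdom t `&` tdom t' `&` tdom t''), (fun x => M x *m N x),
  (fun x => M x *m b x + c x); split.
- by split => //; do 2![apply: openI; last exact: tdom_open]; exact: tdom_open.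
- by apply: mxholoM; [apply: mxholoS hM|apply: mxholoS hN].
- apply: mxholoD; last by apply: mxholoS hc.
  by apply: mxholoM; [apply: mxholoS hM|apply: mxholoS hb].
- by move=> y [[_ t'y] _] ty t''y v; rewrite Mg// Nf// mulmxDr mulmxA addrA.
Qed.

End Affine.

(** * The fibres of A as torsors under L(A) *)

Section Torsor.
Context {R : realType} {X : compact_riemann_surface R} {r : nat}.
Variable A : abundle X r.
Local Notation L := (linearisation A).

Definition act x (u : fibre L x) (a : A x) : A x := tr_fun (u : translation A x) a.

Lemma lin_atlas_ltriv t (ta : aatlas A t) : vatlas L (lin_ltriv ta).
Proof. by exists t, ta. Qed.

Lemma tmap_act t x (u : fibre L x) a : aatlas A t -> tdom t x ->
  tmap t (act u a) = tmap t a + tr_vec t u.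
Proof. exact: tr_vecE. Qed.

Lemma act_eq x (u u' : fibre L x) a : act u a = act u' a -> u = u'.
Proof.
have [t ta tx] := acover A x => /(congr1 (@tmap _ _ _ _ t x)).
rewrite !tmap_act// => /addrI; exact: (bij_inj (tr_vec_bij ta tx)).
Qed.

Fact vsub_subproof x (a b : A x) : exists u : fibre L x, act u b = a.
Proof.
have [t ta tx] := acover A x.
have [u uE] := bij_surj (tmap t a - tmap t b) (tr_vec_bij ta tx).
exists u; apply: (bij_inj (tmap_bij tx)); rewrite tmap_act// uE.
by rewrite addrC subrK.
Qed.

Definition vsub x (a b : A x) : fibre L x := projT1 (cid (vsub_subproof a b)).

Lemma act_vsub x (a b : A x) : act (vsub a b) b = a.
Proof. by rewrite /vsub; case: cid. Qed.

Lemma tr_vsub t x (a b : A x) : aatlas A t -> tdom t x ->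
  tr_vec t (vsub a b) = tmap t a - tmap t b.
Proof. by move=> ta tx; rewrite -{2}(act_vsub a b) tmap_act// addrC addKr. Qed.

Lemma actD x (u v : fibre L x) a : act (u + v) a = act u (act v a).
Proof.
have [t ta tx] := acover A x; apply: (bij_inj (tmap_bij tx)).
rewrite !tmap_act// -addrA [_ + tr_vec t u]addrC.
by rewrite -(tmapD (lin_atlas_ltriv ta) tx).
Qed.

Lemma vsub_act x (u : fibre L x) a b : vsub (act u a) b = u + vsub a b.
Proof. by apply: (@act_eq _ _ _ b); rewrite actD !act_vsub. Qed.

Lemma vsubD x (a b c : A x) : vsub a b + vsub b c = vsub a c.
Proof. by apply: (@act_eq _ _ _ c); rewrite actD !act_vsub. Qed.

Lemma vsubv x (a : A x) : vsub a a = 0.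
Proof. by apply: (addrI (vsub a a)); rewrite vsubD addr0. Qed.

Lemma vsubN x (a b : A x) : - vsub a b = vsub b a.
Proof. by apply: (addrI (vsub a b)); rewrite subrr vsubD vsubv. Qed.

Lemma vsub_act2 x (u v : fibre L x) a : vsub (act u a) (act v a) = u - v.
Proof. by rewrite vsub_act -(vsubN (act v a)) vsub_act vsubv addr0. Qed.

Definition ahsec (U : set X) (s : forall x, A x) : Prop :=
  forall t, aatlas A t -> mxholo (U `&` tdom t) (fun x => tmap t (s x)).

Lemma ahsecS U V s : V `<=` U -> ahsec U s -> ahsec V s.
Proof. by move=> VU hs t ta; apply: mxholoS (hs t ta) => x [/VU]. Qed.

Lemma ahsec_local U s : (forall x, U x -> exists2 W : set X, open W /\ W x &
    exists t, [/\ aatlas A t, tdom t x & mxholo (W `&` tdom t) (fun y => tmap t (s y))]) ->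
  ahsec U s.
Proof.
move=> loc t ta i j x [Ux tx]; have [W [oW Wx] [t' [t'a t'x h]]] := loc x Ux.
have [N [b [hN hb Nb]]] := acompat t'a ta.
have sub1 : W `&` tdom t' `&` tdom t `<=` tdom t' `&` tdom t by move=> y [[]].
have sub2 : W `&` tdom t' `&` tdom t `<=` W `&` tdom t' by move=> y [].
have hh : mxholo (W `&` tdom t' `&` tdom t) (fun y => N y *m tmap t' (s y) + b y).
  apply: mxholoD; last exact: mxholoS hb.
  by apply: mxholoM; [exact: mxholoS hN|exact: mxholoS h].
have oV : open (W `&` tdom t' `&` tdom t).
  by do 2![apply: openI; last exact: tdom_open].
have Vx : (W `&` tdom t' `&` tdom t) x by [].
apply: (holo_at_local oV Vx _ (hh i j x Vx)) => y [[Wy t'y] ty].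
by rewrite Nb.
Qed.

Lemma hsec_vsub U s s' : open U -> ahsec U s -> ahsec U s' ->
  hsec U (fun x => vsub (s x) (s' x) : fibre L x).
Proof.
move=> oU hs hs' l [t [ta ->]].
apply: (mxholo_local (openI oU (tdom_open t)) (@subset_refl _ _) _ (mxholoB (hs t ta) (hs' t ta))).
by move=> y [Uy ty]; rewrite /= tr_vsub.
Qed.

Lemma ahsec_act U (u : forall x, fibre L x) s : open U -> hsec U u -> ahsec U s ->
  ahsec U (fun x => act (u x) (s x)).
Proof.
move=> oU hu hs t ta.
apply: (mxholo_local (openI oU (tdom_open t)) (@subset_refl _ _) _
  (mxholoD (hs t ta) (hu _ (lin_atlas_ltriv ta)))).
by move=> y [Uy ty]; rewrite /= tmap_act.
Qed.

End Torsor.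

(** In charts the map a |-> p + f(a - q) reads N a + (p - N q), where N is the matrix of f. The
    sections q and p are needed only near each point. *)
Lemma aff_in_affine {R : realType} {X : compact_riemann_surface R} {r s : nat}
    (A : abundle X r) (A' : abundle X s) (f : vmorph (linearisation A) (linearisation A'))
    (psi : forall x, A x -> A' x) :
  (forall x, exists (W : set X) q p, [/\ open W /\ W x, @ahsec _ _ _ A W q, @ahsec _ _ _ A' W p &
    forall y, W y -> forall a, psi y a = act (f y (vsub a (q y))) (p y)]) ->
  forall t t', aatlas A t -> aatlas A' t' -> aff_in psi t t'.
Proof.
move=> loc t t' ta t'a; apply: aff_in_local => x tx t'x.
have [W [q [p [[oW Wx] hq hp psiE]]]] := loc x.
have [N hN NE] := vm_holo f (lin_atlas_ltriv ta) (lin_atlas_ltriv t'a).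
pose V := W `&` tdom t `&` tdom t'.
have s1 : V `<=` tdom t `&` tdom t' by move=> y [[]].
have s2 : V `<=` W `&` tdom t by move=> y [].
have s3 : V `<=` W `&` tdom t' by move=> y [[]].
exists V, N, (fun y => tmap t' (p y) - N y *m tmap t (q y)); split.
- by split => //; do 2![apply: openI; last exact: tdom_open].
- exact: mxholoS hN.
- apply: mxholoB; first exact: mxholoS (hp _ t'a).
  by apply: mxholoM; [exact: mxholoS hN|exact: mxholoS (hq _ ta)].
move=> y [[Wy ty] t'y] _ _ a; rewrite psiE// tmap_act//.
have /= -> := NE y ty t'y (vsub a (q y)).
by rewrite tr_vsub// mulmxBr addrC addrAC addrA.
Qed.

(** * Local sections of A and the class h_A *)

Section AffineInvariant.
Context {R : realType} {X : compact_riemann_surface R} {r : nat}.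
Variable A : abundle X r.
Local Notation L := (linearisation A).

(** The sign s_k - s_j is the one in [connecting]. *)
Definition torsor_sections (c : cocycle L) (s : cidx c -> forall x, A x) : Prop :=
  (forall j, ahsec (ccov c j) (s j)) /\
  forall j k x, ccov c j x -> ccov c k x -> cval c j k x = vsub (s k x) (s j x).

(** Each point has a chart around it, and over its domain the section with coordinates 0 is taken;
    the cover is indexed by the points of X. *)
Lemma torsor_sections_exist : exists (c : cocycle L) s, @torsor_sections c s.
Proof.
pose t x := projT1 (cid2 (acover A x)).
have ta x : aatlas A (t x) by rewrite /t; case: cid2.
have tx x : tdom (t x) x by rewrite /t; case: cid2.
have pt x y : exists a : A y, tdom (t x) y -> tmap (t x) a = 0.
  have [ty|nty] := pselect (tdom (t x) y); last by exists (abase A y).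
  by have [a aE] := bij_surj 0 (tmap_bij ty); exists a.
pose s x y := projT1 (cid (pt x y)).
have sE x y : tdom (t x) y -> tmap (t x) (s x y) = 0 by rewrite /s; case: cid.
have hs x : ahsec (tdom (t x)) (s x).
  apply: ahsec_local => y ty; exists (tdom (t x)); first by split => //; exact: tdom_open.
  exists (t x); split => //.
  apply: (mxholo_local _ (@subset_refl _ _) _ (@mxholo_cst _ _ _ _ _ 0)).
    by apply: openI; exact: tdom_open.
  by move=> z [tz _]; rewrite sE.
have ho i j : hsec (tdom (t i) `&` tdom (t j)) (fun x => vsub (s j x) (s i x) : fibre L x).
  apply: hsec_vsub; first by apply: openI; exact: tdom_open.
    by apply: ahsecS (hs j) => y [].
  by apply: ahsecS (hs i) => y [].
have co (i j k x : X) : tdom (t i) x -> tdom (t j) x -> tdom (t k) x ->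
    (vsub (s j x) (s i x) : fibre L x) + vsub (s k x) (s j x) = vsub (s k x) (s i x).
  by move=> _ _ _; rewrite addrC vsubD.
exists (@Cocycle _ _ _ L X (fun x => tdom (t x)) (fun x => tdom_open (t x))
  (fun x => ex_intro (fun y => tdom (t y) x) x (tx x))
  (fun i j x => vsub (s j x) (s i x)) ho co), s.
by split.
Qed.

(** On the intersections of the two covers the differences s_j - s'_j' form the required cochain. *)
Lemma torsor_sections_cohomologous c c' s s' :
  @torsor_sections c s -> @torsor_sections c' s' -> cohomologous c c'.
Proof.
move=> [hs cs] [hs' cs'].
exists (cidx c * cidx c')%type, (fun p => ccov c p.1 `&` ccov c' p.2), fst, snd,
  (fun p x => vsub (s p.1 x) (s' p.2 x)); split.
- move=> [j j'] /=; have oW : open (ccov c j `&` ccov c' j') by apply: openI; exact: ccov_open.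
  split => //; apply: hsec_vsub => //.
    by apply: ahsecS (hs j) => y [].
  by apply: ahsecS (hs' j') => y [].
- by move=> x; have [j jx] := ccovP c x; have [j' j'x] := ccovP c' x; exists (j, j').
- by move=> [j j'].
- move=> [j j'] [k k'] x /= [jx j'x] [kx k'x].
  rewrite cs// cs'// -(vsubD (s k x) (s' k' x) (s j x)) -addrA.
  rewrite -[vsub (s' k' x) (s j x)](vsubD _ (s' j' x)) [_ + vsub (s' j' x) _]addrC addrK.
  by rewrite -(vsubN (s j x)).
Qed.

(** [aff_rho] acts on (1, z) as the affine transformation acts on z, so the pairs (q, (1, z)) with
    q(z) = a form a single class. *)
Fact emb_subproof x (a : A x) : exists p v,
  (fun (q : aframe A x) w => exists z, w = col_mx (const_mx 1) z /\ q z = a) =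
  @assoc_class _ _ _ A x p v.
Proof.
have [t ta tx] := acover A x; have [p pK] := frame_of_subproof ta tx.
exists p, (col_mx (const_mx 1) (tmap t a)).
have sub q w : assoc_class p (col_mx (const_mx 1) (tmap t a)) q w ->
    exists z, w = col_mx (const_mx 1) z /\ q z = a.
  move=> [M [b [Mu qE e]]]; exists (dsubmx w).
  have w1 : usubmx w = const_mx 1.
    by have := congr1 usubmx e; rewrite usubmx_rho col_mxKu => <-.
  split; first by rewrite -w1 vsubmxK.
  have := congr1 dsubmx e; rewrite dsubmx_rho col_mxKd w1.
  have -> : (const_mx 1 : 'M[R[i]]_1) = 1%:M by apply/matrixP => i j; rewrite !mxE !ord1.
  by rewrite mulmx1 addrC qE => <-; rewrite pK.
apply/funext => q; apply/funext => w; apply/propext; split; last exact: sub.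
move=> [z [-> qz]].
have [w' /[dup] hw' /sub[z' [w'E qz']]] :=
  frames_transitive p q (col_mx (const_mx 1) (tmap t a)).
suff -> : z = z' by rewrite -w'E.
by apply: (@aframe_inj _ _ _ _ _ q); rewrite qz qz'.
Qed.

(* The point q(z) of A corresponds to the class of (q, (1, z)). *)
Definition emb x (a : A x) : fibre (assoc_bundle A) x :=
  exist (fun c => exists p v, c = assoc_class p v) _ (emb_subproof a).

Lemma assoc_ltriv_atlas t (ta : aatlas A t) : vatlas (assoc_bundle A) (assoc_ltriv ta).
Proof. by exists t, ta. Qed.

Lemma assoc_coord_emb t x (a : A x) : aatlas A t -> tdom t x ->
  assoc_coord t (emb a) = col_mx (const_mx 1) (tmap t a).
Proof.
move=> ta tx; have [q qK] := frame_of_subproof ta tx.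
by apply/(assoc_coordP _ tx qK); exists (tmap t a).
Qed.

Lemma assoc_coord_lin t x (u : fibre L x) : aatlas A t -> tdom t x ->
  assoc_coord t (lin_to_assoc A x u) = col_mx 0 (tr_vec t u).
Proof.
move=> ta tx; have [q qK] := frame_of_subproof ta tx.
have tqK y : tmap t (q y) = y by have [a <-] := bij_surj y (tmap_bij tx); rewrite qK.
apply/(assoc_coordP _ tx qK); exists (tr_vec t u); split => // y.
by apply: (bij_inj (tmap_bij tx)); rewrite tqK (tr_vecE _ _ ta tx) tqK.
Qed.

Lemma assoc_to_O_emb x (a : A x) : assoc_to_O A x (emb a) = const_mx 1.
Proof.
have [t ta tx] := acover A x; have [q qK] := frame_of_subproof ta tx.
rewrite /= (@assoc_to_O_funE _ _ _ A x (emb a) q (col_mx (const_mx 1) (tmap t a))).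
  by rewrite col_mxKu.
by exists (tmap t a).
Qed.

(** A sits in the associated bundle as the locus where the projection to O_X equals 1. *)
Lemma emb_surj x (c : fibre (assoc_bundle A) x) :
  assoc_to_O A x c = const_mx 1 -> exists a, c = emb a.
Proof.
have [t ta tx] := acover A x; have [q qK] := frame_of_subproof ta tx.
have /(assoc_coordP _ tx qK) cq := erefl (assoc_coord t c).
rewrite /= (assoc_to_O_funE cq) => u1.
have [a aE] := bij_surj (dsubmx (assoc_coord t c)) (tmap_bij tx).
exists a; apply: (bij_inj (assoc_coord_bij ta tx)).
by rewrite assoc_coord_emb// aE -u1 vsubmxK.
Qed.

Lemma lin_to_assoc_vsub x (a b : A x) : lin_to_assoc A x (vsub a b) = emb a - emb b.
Proof.
have [t ta tx] := acover A x; apply: (bij_inj (assoc_coord_bij ta tx)).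
rewrite assoc_coord_lin//.
have /= -> := tmapB (assoc_ltriv_atlas ta) tx (emb a) (emb b).
rewrite !assoc_coord_emb// opp_col_mx add_col_mx subrr; congr col_mx.
exact: tr_vsub.
Qed.

Lemma lin_to_assoc_inj x (u v : fibre L x) : lin_to_assoc A x u = lin_to_assoc A x v -> u = v.
Proof.
have [t ta tx] := acover A x => /(congr1 (@assoc_coord _ _ _ A t x)).
rewrite !assoc_coord_lin// => /(congr1 dsubmx); rewrite !col_mxKd.
exact: (bij_inj (tr_vec_bij ta tx)).
Qed.

(** Through [emb], a local lift of the function 1 is the same as a local section of A, and
    differences of lifts correspond to differences of sections. *)
Lemma connectingP (c : cocycle L) :
  connecting (lin_to_assoc A) (assoc_to_O A) (fun=> const_mx 1) c <->
  exists s, @torsor_sections c s.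
Proof.
split=> [[S [hS pS iS]]|[s [hs cs]]].
  have pt j x : exists a : A x, ccov c j x -> S j x = emb a.
    have [jx|njx] := pselect (ccov c j x); last by exists (abase A x).
    by have [a aE] := emb_surj (pS j x jx); exists a.
  pose s j x := projT1 (cid (pt j x)).
  have sE j x : ccov c j x -> S j x = emb (s j x) by rewrite /s; case: cid.
  exists s; split=> [j t ta|j k x jx kx].
    apply: (mxholo_local _ (@subset_refl _ _) _
      (mxholo_dsubmx (hS j _ (assoc_ltriv_atlas ta)))).
      by apply: openI; [exact: ccov_open|exact: tdom_open].
    by move=> y [jy ty]; rewrite sE//= assoc_coord_emb// col_mxKd.
  by apply: lin_to_assoc_inj; rewrite iS// lin_to_assoc_vsub !sE.
exists (fun j x => emb (s j x)); split.
- move=> j _ [t [ta ->]].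
  apply: (mxholo_local _ (@subset_refl _ _) _
    (mxholo_col_mx (@mxholo_cst _ _ _ _ _ (const_mx 1)) (hs j t ta))).
    by apply: openI; [exact: ccov_open|exact: tdom_open].
  by move=> y [jy ty]; rewrite /= assoc_coord_emb.
- by move=> j x _; exact: assoc_to_O_emb.
- by move=> j k x jx kx; rewrite cs// lin_to_assoc_vsub.
Qed.

(** A family of sections yields a connecting cocycle, so the default zero class is not taken; the
    cocycle chosen instead is a difference cocycle too, hence cohomologous to c. *)
Lemma aff_invariant_sections c s : @torsor_sections c s -> aff_invariant A = H1class c.
Proof.
move=> h; rewrite /aff_invariant /connecting_map; case: pselect => [ex|[]]; last first.
  by exists c; apply/connectingP; exists s.
case: (cid ex) => c1 /= /connectingP[s1 h1]; apply/H1class_eq.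
exact: torsor_sections_cohomologous h1 h.
Qed.

End AffineInvariant.

(** * Isomorphisms of affine bundles and their linear parts *)

Section AffineIso.
Context {R : realType} {X : compact_riemann_surface R} {r : nat}.

Definition aiso_id (A : abundle X r) : aiso A A :=
  @AIso _ _ _ A A (fun _ => id) (fun _ => id) (fun _ _ => erefl) (fun _ _ => erefl)
    (@acompat _ _ _ A) (fun t t' ta t'a => @acompat _ _ _ A t' t t'a ta).

Definition aiso_inv (A A' : abundle X r) (psi : aiso A A') : aiso A' A :=
  @AIso _ _ _ A' A (ai_inv psi) (ai_fun psi) (ai_invK psi) (ai_funK psi)
    (fun t t' ta t'a => @ai_inv_holo _ _ _ _ _ psi t' t t'a ta)
    (fun t t' ta t'a => @ai_holo _ _ _ _ _ psi t' t t'a ta).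

Definition aiso_comp (A A' A'' : abundle X r) (phi : aiso A' A'') (psi : aiso A A') : aiso A A''.
Proof.
apply: (@AIso _ _ _ A A'' (fun x a => phi x (psi x a)) (fun x a => ai_inv psi (ai_inv phi a))).
- by move=> x a; rewrite !ai_funK.
- by move=> x a; rewrite !ai_invK.
- move=> t t'' ta t''a; apply: aff_in_comp => x tx t''x; have [t' t'a t'x] := acover A' x.
  by exists t'; split => //; exact: ai_holo.
- move=> t t'' ta t''a; apply: aff_in_comp => x tx t''x; have [t' t'a t'x] := acover A' x.
  by exists t'; split => //; exact: ai_inv_holo.
Defined.

Lemma lin_part_vsub (A A' : abundle X r) (psi : aiso A A') x (a b : A x) :
  lin_part psi (vsub a b) = vsub (psi x a) (psi x b).
Proof.
apply: (@act_eq _ _ _ _ _ _ _ (psi x b)); rewrite act_vsub /act /= ai_funK.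
by congr (psi x _); exact: act_vsub.
Qed.

Lemma lin_part_holo (A A' : abundle X r) (psi : aiso A A') t t' :
  vatlas (linearisation A) t -> vatlas (linearisation A') t' ->
  lin_in (fun x (u : fibre (linearisation A) x) =>
    lin_part psi u : fibre (linearisation A') x) t t'.
Proof.
move=> [l [la ->]] [l' [l'a ->]]; have [N [b [hN _ h]]] := ai_holo psi la l'a.
exists N => // x lx l'x u /=.
pose a := abase A x; have -> : u = vsub (act u a) a by rewrite vsub_act vsubv addr0.
by rewrite lin_part_vsub !tr_vsub// !h// mulmxBr opprD addrACA subrr addr0.
Qed.

Definition lin_morph (A A' : abundle X r) (psi : aiso A A') :
  vmorph (linearisation A) (linearisation A') := VMorph (lin_part_holo psi).

Lemma lin_part_id (A : abundle X r) x (u : fibre (linearisation A) x) :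
  lin_part (aiso_id A) u = u.
Proof. by apply: translation_eq. Qed.

Lemma lin_part_comp (A A' A'' : abundle X r) (phi : aiso A' A'') (psi : aiso A A') x u :
  lin_part (aiso_comp phi psi) u = lin_part phi (@lin_part _ _ _ _ _ psi x u).
Proof. by apply: translation_eq. Qed.

Lemma lin_partK (A A' : abundle X r) (psi : aiso A A') x u :
  lin_part (aiso_inv psi) (@lin_part _ _ _ _ _ psi x u) = u.
Proof. by apply: translation_eq => a /=; rewrite !ai_funK. Qed.

Lemma lin_part_invK (A A' : abundle X r) (psi : aiso A A') x u :
  lin_part psi (@lin_part _ _ _ _ _ (aiso_inv psi) x u) = u.
Proof. by apply: translation_eq => a /=; rewrite !ai_invK. Qed.

Definition lin_iso (A A' : abundle X r) (psi : aiso A A') :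
    viso (linearisation A) (linearisation A') :=
  @VIso _ _ _ _ _ (lin_morph psi) (lin_morph (aiso_inv psi))
    (@lin_partK _ _ psi) (@lin_part_invK _ _ psi).

Lemma ahsec_aiso (A A' : abundle X r) (psi : aiso A A') U (s : forall x, A x) :
  open U -> ahsec U s -> ahsec U (fun x => psi x (s x)).
Proof.
move=> oU hs; apply: ahsec_local => x Ux.
have [t ta tx] := acover A x; have [t' t'a t'x] := acover A' x.
exists (U `&` tdom t); first by split => //; apply: openI => //; exact: tdom_open.
exists t'; split => //; have [N [b [hN hb h]]] := ai_holo psi ta t'a.
have s1 : U `&` tdom t `&` tdom t' `<=` tdom t `&` tdom t' by move=> y [[]].
have s2 : U `&` tdom t `&` tdom t' `<=` U `&` tdom t by move=> y [].
have hh : mxholo (U `&` tdom t `&` tdom t') (fun y => N y *m tmap t (s y) + b y).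
  apply: mxholoD; last exact: mxholoS hb.
  by apply: mxholoM; [exact: mxholoS hN|exact: mxholoS (hs t ta)].
apply: (mxholo_local _ (@subset_refl _ _) _ hh).
  by do 2![apply: openI; last exact: tdom_open].
by move=> y [[Uy ty] t'y]; rewrite h.
Qed.

(** The image under psi of a family of sections has as difference cocycle the image under L(psi). *)
Lemma aff_invariant_iso (A A' : abundle X r) (psi : aiso A A') :
  H1map (lin_morph psi) (aff_invariant A) = aff_invariant A'.
Proof.
have [c [s hs]] := torsor_sections_exist A.
rewrite (aff_invariant_sections hs) H1mapE; apply/esym.
apply: (@aff_invariant_sections _ _ _ A' (cocycle_map (lin_morph psi) c)
  (fun j x => psi x (s j x))); split => [j|j k x jx kx]; last first.
  by rewrite /= hs.2// lin_part_vsub.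
by apply: ahsec_aiso; [exact: ccov_open|exact: hs.1].
Qed.

Lemma aiso_of_invariant (A A' : abundle X r) (g : viso (linearisation A) (linearisation A')) :
  H1map g (aff_invariant A) = aff_invariant A' ->
  exists psi : aiso A A', forall x u, @lin_part _ _ _ _ _ psi x u = g x u.
Proof.
have [c [s [hs cs]]] := torsor_sections_exist A.
have [c' [s' [hs' cs']]] := torsor_sections_exist A'.
rewrite (aff_invariant_sections (conj hs cs)) (aff_invariant_sections (conj hs' cs')) H1mapE.
move=> /H1class_eq[K [W [tau [tau' [q [hW cW sub qE]]]]]].
(* The cochain q corrects the sections of A' so that p_l - p_k = g(s_l - s_k); this is what makes
   the local maps agree on overlaps. *)
pose p k x := act (q k x : fibre (linearisation A') x) (s' (tau' k) x).
have glue k l x : W k x -> W l x -> forall a,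
    act (g x (vsub a (s (tau k) x))) (p k x) = act (g x (vsub a (s (tau l) x))) (p l x).
  move=> kx lx a; have [kx1 kx2] := sub k x kx; have [lx1 lx2] := sub l x lx.
  have := qE k l x kx lx; rewrite /= cs// cs'// => e.
  rewrite /p -(act_vsub (s' (tau' l) x) (s' (tau' k) x)) -!actD; congr (act _ _).
  rewrite -(vsubD a (s (tau l) x) (s (tau k) x)) vmorphD -!addrA; apply: congr1.
  by rewrite -[g x _](subrK (vsub (s' (tau' l) x) (s' (tau' k) x))) e addrAC subrK.
(* Some member of the cover is picked at each point; by [glue] the value of the map does not depend
   on it. *)
pose kk x := projT1 (cid (cW x)).
have kkx x : W (kk x) x by rewrite /kk; case: cid.
pose psi x (a : A x) := act (g x (vsub a (s (tau (kk x)) x))) (p (kk x) x).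
pose psi' x (a : A' x) := act (vi_inv g x (vsub a (p (kk x) x))) (s (tau (kk x)) x).
have psiE k x : W k x -> forall a, psi x a = act (g x (vsub a (s (tau k) x))) (p k x).
  by move=> kx a; exact: glue.
have psi'K x : cancel (@psi' x) (@psi x).
  by move=> a; rewrite /psi /psi' vsub_act vsubv addr0 vi_invK act_vsub.
have psiK x : cancel (@psi x) (@psi' x).
  by move=> a; rewrite /psi /psi' vsub_act vsubv addr0 vi_funK act_vsub.
have psi'E k x : W k x -> forall a, psi' x a = act (vi_inv g x (vsub a (p k x))) (s (tau k) x).
  move=> kx a; apply: (can_inj (psiK x)); rewrite psi'K (psiE k x kx).
  by rewrite vsub_act vsubv addr0 vi_invK act_vsub.
have hsk k : ahsec (W k) (s (tau k)) by apply: ahsecS (hs (tau k)) => x /sub[].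
have hpk k : ahsec (W k) (p k).
  have [oW hq] := hW k; apply: ahsec_act => //.
  by apply: ahsecS (hs' (tau' k)) => x /sub[].
have holo_psi t t' : aatlas A t -> aatlas A' t' -> aff_in psi t t'.
  apply: (aff_in_affine (f := g)) => x; exists (W (kk x)), (s (tau (kk x))), (p (kk x)).
  by split => //; [split => //; exact: (hW _).1|exact: psiE].
have holo_psi' t t' : aatlas A t -> aatlas A' t' -> aff_in psi' t' t.
  move=> ta t'a; move: t' t t'a ta.
  apply: (aff_in_affine (f := vi_inv g)) => x; exists (W (kk x)), (p (kk x)), (s (tau (kk x))).
  by split => //; [split => //; exact: (hW _).1|exact: psi'E].
exists (AIso psiK psi'K holo_psi holo_psi') => x u.
set P := AIso _ _ _ _; pose a := abase A x.
have uE : u = vsub (act u a) a by rewrite vsub_act vsubv addr0.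
rewrite {1}uE lin_part_vsub /= /psi vsub_act2 -vmorphB.
by rewrite vsub_act addrK.
Qed.

End AffineIso.

(** * The maximal atlas of a compatible family of charts *)

Section MaximalAtlas.
Context {R : realType} {X : compact_riemann_surface R} {r : nat}.
Variables (F : X -> Type) (B : set (ltriv F r)).
Hypothesis Bcover : forall x, exists2 t, B t & tdom t x.
Hypothesis Bcompat : forall t t', B t -> B t' -> aff_compat t t'.

Definition maximal_atlas : set (ltriv F r) :=
  [set t | forall b, B b -> aff_compat t b /\ aff_compat b t].

Lemma sub_maximal_atlas : B `<=` maximal_atlas.
Proof. by move=> b Bb b' Bb'; split; exact: Bcompat. Qed.

Fact maximal_atlas_cover x : exists2 t, maximal_atlas t & tdom t x.
Proof. by have [t Bt tx] := Bcover x; exists t => //; exact: sub_maximal_atlas. Qed.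

Fact maximal_atlas_compat t t' : maximal_atlas t -> maximal_atlas t' -> aff_compat t t'.
Proof.
move=> ht ht'.
apply: (@aff_in_comp _ _ _ _ _ _ _ _ (fun x => @id (F x)) (fun x => @id (F x))) => x tx t'x.
have [b Bb bx] := Bcover x; exists b; split => //.
  exact: (ht b Bb).1.
exact: (ht' b Bb).2.
Qed.

Fact maximal_atlas_max t :
  (forall t', maximal_atlas t' -> aff_compat t t' /\ aff_compat t' t) -> maximal_atlas t.
Proof. by move=> h b Bb; apply: h; exact: sub_maximal_atlas. Qed.

Definition abundle_of_atlas : abundle X r :=
  ABundle maximal_atlas_cover maximal_atlas_compat maximal_atlas_max.

End MaximalAtlas.

(* The affine bundle with linearisation E and local sections s_j subject to
   s_k - s_j = c_jk: its fibre at x is a copy of E_x, in which s_j(x) is the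
   vector - c_ji, where i = i(x) is some index with x in U_i. *)
Section Twist.
Context {R : realType} {X : compact_riemann_surface R} {r : nat}.
Variables (E : vbundle X r) (c : cocycle E).

Definition base_idx x : cidx c := projT1 (cid (ccovP c x)).

Lemma base_idxP x : ccov c (base_idx x) x.
Proof. by rewrite /base_idx; case: cid. Qed.

(** The coordinates t(v - s_j) of the point v, with s_j placed at the origin. *)
Definition twist_map j (t : ltriv (vfib E) r) x (v : vfib E x) : 'cV[R[i]]_r :=
  tmap t ((v : fibre E x) + cval c j (base_idx x) x : fibre E x).

Fact twist_map_bij j t x : (ccov c j `&` tdom t) x -> bijective (@twist_map j t x).
Proof.
move=> [_ tx]; have [g tK gK] := tmap_bij tx.
exists (fun z => (g z : fibre E x) - cval c j (base_idx x) x : fibre E x) => v.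
  by rewrite /twist_map tK addrK.
by rewrite /twist_map subrK gK.
Qed.

Definition twist_ltriv j (t : ltriv (vfib E) r) : ltriv (vfib E) r :=
  LTriv (openI (ccov_open j) (tdom_open t)) (@twist_map_bij j t).

Definition twist_atlas : set (ltriv (vfib E) r) :=
  [set l | exists j t, vatlas E t /\ l = twist_ltriv j t].

Fact twist_cover x : exists2 l, twist_atlas l & tdom l x.
Proof.
have [t ta tx] := vcover E x; exists (twist_ltriv (base_idx x) t).
  by exists (base_idx x), t.
by split => //; exact: base_idxP.
Qed.

(** By the cocycle condition c_ki = c_kj + c_ji the transition is N followed by translation by c_kj.
    The index i(x), which varies arbitrarily with x, drops out. *)
Fact twist_compat l l' : twist_atlas l -> twist_atlas l' -> aff_compat l l'.
Proof.
move=> [j [t [ta ->]]] [k [t' [t'a ->]]]; have [N hN NE] := vcompat ta t'a.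
exists N, (fun x => tmap t' (cval c k j x)); split.
- by apply: mxholoS hN => x [[_ ?] [_ ?]].
- by apply: mxholoS (cval_holo (c := c) (i := k) (j := j) t'a) => x [[? _] [? ?]].
move=> x [/= jx tx] [kx t'x] v; rewrite /twist_map.
have /= <- := NE x tx t'x; rewrite -(tmapD t'a t'x); congr (tmap t' _).
rewrite -(cval_cocycle kx jx (base_idxP x)) -addrA; apply: congr1; exact: addrC.
Qed.

Definition twist : abundle X r := abundle_of_atlas twist_cover twist_compat.

Definition twist_chart j t : ltriv (afib twist) r := twist_ltriv j t.

Lemma twist_chart_atlas j t : vatlas E t -> aatlas twist (twist_chart j t).
Proof. by move=> ta; apply: (sub_maximal_atlas twist_compat); exists j, t. Qed.

(** A fibre of [twist] and a fibre of E are the same type; this map and the next record whether an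
    element is meant as a point or as a vector. *)
Definition twist_pt x (v : fibre E x) : twist x := v.
Definition twist_vec x (a : twist x) : fibre E x := a.

Lemma tr_vsub_twist j t x (a b : twist x) : vatlas E t -> ccov c j x -> tdom t x ->
  tr_vec (twist_chart j t) (vsub a b) = tmap t (twist_vec a - twist_vec b : fibre E x).
Proof.
move=> ta jx tx; rewrite tr_vsub//; last exact: twist_chart_atlas.
by rewrite /= /twist_map -(tmapB ta tx) opprD addrACA subrr addr0.
Qed.

Definition twist_lin x (u : fibre (linearisation twist) x) : fibre E x :=
  twist_vec (act u (twist_pt 0)).

Definition twist_lin_inv x (v : fibre E x) : fibre (linearisation twist) x :=
  vsub (twist_pt v) (twist_pt 0).

Lemma twist_linK x : cancel (@twist_lin x) (@twist_lin_inv x).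
Proof. by move=> u; rewrite /twist_lin_inv vsub_act vsubv addr0. Qed.

Lemma twist_lin_invK x : cancel (@twist_lin_inv x) (@twist_lin x).
Proof. by move=> v; rewrite /twist_lin /twist_lin_inv act_vsub. Qed.

Lemma tr_twist_lin_inv j t x (v : fibre E x) : vatlas E t -> ccov c j x -> tdom t x ->
  tr_vec (twist_chart j t) (twist_lin_inv v) = tmap t v.
Proof. by move=> ta jx tx; rewrite tr_vsub_twist// /twist_vec /twist_pt subr0. Qed.

Fact twist_lin_holo t t' : vatlas (linearisation twist) t -> vatlas E t' ->
  lin_in twist_lin t t'.
Proof.
move=> ta t'a; apply: (@lin_in_comp _ _ _ _ _ _ _ _ (fun x => @id (translation twist x)) twist_lin).
move=> x tx t'x; pose j := base_idx x.
have ba := lin_atlas_ltriv (twist_chart_atlas j t'a).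
exists (lin_ltriv (twist_chart_atlas j t'a)); split.
- by split => //; exact: base_idxP.
- exact: (vcompat ta ba).
exists (fun=> 1%:M); first exact: mxholo_cst.
move=> y [jy _] t'y u; rewrite mul1mx /=.
rewrite -[u in RHS](twist_linK (u : fibre (linearisation twist) y)).
by rewrite tr_twist_lin_inv.
Qed.

Fact twist_lin_inv_holo t t' : vatlas E t -> vatlas (linearisation twist) t' ->
  lin_in twist_lin_inv t t'.
Proof.
move=> ta t'a.
apply: (@lin_in_comp _ _ _ _ _ _ _ _ twist_lin_inv (fun x => @id (translation twist x))).
move=> x tx t'x; pose j := base_idx x.
have ba := lin_atlas_ltriv (twist_chart_atlas j ta).
exists (lin_ltriv (twist_chart_atlas j ta)); split.
- by split => //; exact: base_idxP.
- exists (fun=> 1%:M); first exact: mxholo_cst.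
  by move=> y ty [jy _] v; rewrite mul1mx /= tr_twist_lin_inv.
exact: (vcompat ba t'a).
Qed.

Definition twist_iso : viso (linearisation twist) E :=
  @VIso _ _ _ (linearisation twist) E (VMorph twist_lin_holo) (VMorph twist_lin_inv_holo)
    twist_linK twist_lin_invK.

(** The sections s_j = - c_ji have coordinates 0 in the j-th charts, hence are holomorphic, and s_k
    - s_j = c_ji - c_ki = c_jk. *)
Lemma twist_invariant : H1map twist_iso (aff_invariant twist) = H1class c.
Proof.
have -> : aff_invariant twist = H1map (vi_inv twist_iso) (H1class c); last first.
  rewrite (H1map_comp (k := vmorph_id E)) => [|x v]; first by rewrite H1map_id.
  by rewrite vi_invK.
rewrite H1mapE.
apply: (@aff_invariant_sections _ _ _ twist (cocycle_map (vi_inv twist_iso) c)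
  (fun j x => twist_pt (- cval c j (base_idx x) x))); split=> [j|j k x jx kx].
  apply: ahsec_local => x jx; exists (ccov c j); first by split => //; exact: ccov_open.
  have [t ta tx] := vcover E x; exists (twist_chart j t); split => //.
    exact: twist_chart_atlas.
  apply: (mxholo_local _ (@subset_refl _ _) _ (@mxholo_cst _ _ _ _ _ 0)).
    by apply: openI; [exact: ccov_open|exact: tdom_open].
  by move=> y [_ [jy ty]]; rewrite /= /twist_map /twist_pt addNr tmap0.
have [t ta tx] := vcover E x.
have tj : tdom (twist_chart j t) x by [].
apply: (bij_inj (tr_vec_bij (twist_chart_atlas j ta) tj)).
rewrite /= tr_twist_lin_inv// tr_vsub_twist// /twist_vec /twist_pt; congr (tmap t _).
by rewrite opprK -(cval_cocycle (c := c) jx kx (base_idxP x)) addrC addrK.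
Qed.

End Twist.

(** * Line subbundles and degrees *)

Section DegreeInvariance.
Context {R : realType} {X : compact_riemann_surface R}.

Lemma holo_at_prod (I : Type) (r : seq I) (F : I -> X -> R[i]) x :
  (forall i, holo_at (F i) x) -> holo_at (fun y => \prod_(i <- r) F i y) x.
Proof.
move=> hF; elim: r => [|i r IH].
  rewrite (_ : (fun y => _) = fun=> 1); first exact: holo_at_cst.
  by apply/funext => y; rewrite big_nil.
rewrite (_ : (fun y => _) = fun y => F i y * \prod_(j <- r) F j y).
  exact: (holo_atM (hF i) IH).
by apply/funext => y; rewrite big_cons.
Qed.

Lemma holo_det (U : set X) n (M : X -> 'M[R[i]]_n) :
  mxholo U M -> holo U (fun x => \det (M x)).
Proof.
move=> hM x Ux; pose F (s : 'S_n) y : R[i] := (-1) ^+ s * \prod_i M y i (s i).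
apply: (@holo_at_sum _ _ _ _ F) => s.
apply: (holo_atM (@holo_at_cst _ _ ((-1) ^+ s) x)).
by apply: holo_at_prod => i; exact: hM.
Qed.

Lemma mero_ord_mul (f g : X -> R[i]) p k (V : set X) (v : X -> R[i]) :
  open V -> V p -> holo V v -> v p != 0 -> (forall x, V x -> g x = v x * f x) ->
  mero_ord f p k -> mero_ord g p k.
Proof.
move=> oV Vp hv vp gE [c [U [u [ca [oU Uc] Up [hu up] fE]]]].
exists c, (U `&` V), (fun x => v x * u x); split => //.
- by split; [exact: openI|move=> x [/Uc]].
- split; last by rewrite mulf_neq0.
  by move=> x [Ux Vx]; apply: holo_atM; [exact: hv|exact: hu].
- by move=> x [Ux Vx] xp; rewrite gE// fE// mulrCA.
Qed.

Lemma viso_matrix_unit r (E E' : vbundle X r) (f : viso E E') t t' x (N : 'M_r) :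
  vatlas E t -> vatlas E' t' -> tdom t x -> tdom t' x ->
  (forall v, tmap t' (f x v) = N *m tmap t v) -> \det N != 0.
Proof.
move=> ta t'a tx t'x h; have [M _ ME] := vm_holo (vi_inv f) t'a ta.
suff /mulmx1_unit[_] : M x *m N = 1%:M by rewrite unitmxE unitfE.
apply: eq_mulmx_cV => z; have [v <-] := bij_surj z (tmap_bij tx).
by rewrite mul1mx -mulmxA -h -ME// vi_funK.
Qed.

(** A meromorphic section s of det E is carried to det N s, where N is the matrix of f in
    trivialisations t and t'. Multiplicativity of the determinant makes this independent of t, and
    the divisor is unchanged because det N is holomorphic without zeros. *)
Lemma has_degree_iso r (E E' : vbundle X r) (f : viso E E') d :
  has_degree E d -> has_degree E' d.
Proof.
move=> [S [n [s [Sn sE sm dE]]]].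
have pt (t' : ltriv (vfib E') r) x : exists z : R[i], vatlas E' t' -> tdom t' x ->
    forall t, vatlas E t -> tdom t x -> forall M : 'M_r,
    (forall v, tmap t' (f x v) = M *m tmap t v) -> z = \det M * s t x.
  have [[t'a t'x]|nt'] := pselect (vatlas E' t' /\ tdom t' x); last first.
    by exists 0 => t'a t'x; case: nt'.
  have [t0 t0a t0x] := vcover E x; have [M0 _ M0E] := vm_holo f t0a t'a.
  exists (\det (M0 x) * s t0 x) => _ _ t ta tx M ME.
  have [K _ KE] := vcompat t0a ta.
  rewrite (sE t0 t t0a ta x t0x tx (K x) (KE x t0x tx)) mulrA -det_mulmx.
  congr (\det _ * _); apply: eq_mulmx_cV => z.
  have [v <-] := bij_surj z (tmap_bij t0x).
  by rewrite -M0E// ME -mulmxA -KE.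
pose s' t' x := projT1 (cid (pt t' x)).
have s'E t' x : vatlas E' t' -> tdom t' x ->
    forall t, vatlas E t -> tdom t x -> forall M : 'M_r,
    (forall v, tmap t' (f x v) = M *m tmap t v) -> s' t' x = \det M * s t x.
  by rewrite /s'; case: cid.
exists S, n, s'; split => //.
- move=> t' t'' t'a t''a x t'x t''x M ME; have [t ta tx] := vcover E x.
  have [N _ NE] := vm_holo f ta t'a.
  rewrite (s'E t' x t'a t'x t ta tx _ (NE x tx t'x)) mulrA -det_mulmx.
  apply: (s'E t'' x t''a t''x t ta tx) => v.
  by rewrite ME NE// mulmxA.
- move=> t' x t'a t'x; have [t ta tx] := vcover E x.
  have [N hN NE] := vm_holo f ta t'a.
  apply: (@mero_ord_mul (s t) _ _ _ (tdom t `&` tdom t') (fun y => \det (N y))).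
  + by apply: openI; exact: tdom_open.
  + by [].
  + exact: holo_det.
  + exact: (viso_matrix_unit ta t'a tx t'x (NE x tx t'x)).
  + by move=> y [ty t'y]; apply: s'E => // v; exact: NE.
  + exact: sm.
Qed.

(** The two sets of degrees coincide, hence so do the elements that [xget] picks. *)
Lemma degree_iso r (E E' : vbundle X r) : viso E E' -> degree E = degree E'.
Proof.
move=> f; rewrite /degree; congr (xget _ _); apply/seteqP; split=> d.
  exact: has_degree_iso.
exact: (has_degree_iso (viso_inv f)).
Qed.

End DegreeInvariance.

(** * Line subbundles, their quotients and isomorphisms *)

Section LineSubbundles.
Context {R : realType} {X : compact_riemann_surface R}.
Implicit Types E : vbundle X 2.

Lemma vtrivZ E t (ht : vtriv (E := E) t) x (tx : tdom t x) (a : R[i]) (v : fibre E x) :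
  tmap t (a *: v : fibre E x) = a *: tmap t v.
Proof.
have [t' t'a t'x] := vcover E x; have [_ [N _ h]] := ht t' t'a.
by rewrite !h// tmapZ// scalemxAr.
Qed.

Lemma adapted_vec E (D : lsub E) t (ht : adapted D t) x (tx : tdom t x) :
  exists v : fibre E x, [/\ D x v, tmap t v 0 0 = 1 & tmap t v 1 0 = 0].
Proof.
have [v vE] := bij_surj (\col_(i < 2) if i == 0 then 1 else 0) (tmap_bij tx).
by exists v; split; rewrite ?vE ?mxE//; apply/(ht.2 x tx); rewrite vE mxE.
Qed.

Lemma lsub_line E (D : lsub E) x (v w : fibre E x) :
  D x v -> D x w -> v <> 0 -> exists a : R[i], w = a *: v.
Proof.
have [t ht tx] := ls_loc D x; move=> /(ht.2 x tx) v1 /(ht.2 x tx) w1 v0.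
have n0 : tmap t v 0 0 != 0.
  apply/eqP => e; apply: v0; apply: (bij_inj (tmap_bij tx)).
  have -> : tmap t (0 : fibre E x) = 0.
    by rewrite -[0 in LHS](scale0r (0 : fibre E x)) vtrivZ ?scale0r//; exact: ht.1.
  by apply: colV2P; rewrite ?e ?v1 mxE.
exists (tmap t w 0 0 / tmap t v 0 0); apply: (bij_inj (tmap_bij tx)).
rewrite vtrivZ//; last exact: ht.1.
by apply: colV2P; rewrite mxE ?divfK// v1 w1 mulr0.
Qed.

Lemma quot_proj_eq E (D : lsub E) x (v w : fibre E x) :
  quot_proj D v = quot_proj D w <-> D x (v - w).
Proof.
have [t ht tx] := ls_loc D x.
rewrite (quot_projP _ _ ht tx) (ht.2 x tx) (vtriv_sub ht.1 tx) !mxE.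
by split=> [->|/eqP]; rewrite ?subrr// subr_eq0 => /eqP.
Qed.

Section Morphisms.
Context {E E' : vbundle X 2}.
Variables (D : lsub E) (D' : lsub E') (f : vmorph E E').
Hypothesis fD : forall x v, D x v -> D' x (f x v).

Definition sub_fun x (w : fibre (sub_bundle D) x) : fibre (sub_bundle D') x :=
  exist (fun v => D' x v) (f x (sval w)) (fD (svalP w)).

Fact sub_fun_holo t t' : vatlas (sub_bundle D) t -> vatlas (sub_bundle D') t' ->
  lin_in sub_fun t t'.
Proof.
move=> [l [hl ->]] [l' [hl' ->]]; have [N hN NE] := vmorph_vtriv f hl.1 hl'.1.
exists (fun x => const_mx (N x 0 0)).
  move=> i j x Ux; rewrite (_ : (fun y => _) = fun y => N y 0 0); first exact: hN.
  by apply/funext => y; rewrite mxE.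
move=> x /= lx l'x [v Dv]; apply/colP => i.
rewrite !mxE big_ord1 !mxE /= NE// mulmx2E.
by rewrite [tmap l v 1 0](hl.2 x lx v).1// mulr0 addr0.
Qed.

Definition sub_morph : vmorph (sub_bundle D) (sub_bundle D') := VMorph sub_fun_holo.

Definition quot_fun x (c : fibre (quot_bundle D) x) : fibre (quot_bundle D') x :=
  quot_proj D' (f x (quot_repr c)).

Fact quot_fun_holo t t' : vatlas (quot_bundle D) t -> vatlas (quot_bundle D') t' ->
  lin_in quot_fun t t'.
Proof.
move=> [l [hl ->]] [l' [hl' ->]]; have [N hN NE] := vmorph_vtriv f hl.1 hl'.1.
exists (fun x => const_mx (N x 1 1)).
  move=> i j x Ux; rewrite (_ : (fun y => _) = fun y => N y 1 1); first exact: hN.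
  by apply/funext => y; rewrite mxE.
move=> x /= lx l'x c.
have N10 : N x 1 0 = 0.
  have [v [Dv v0 v1]] := adapted_vec hl lx.
  have /(hl'.2 x l'x) := fD Dv; rewrite NE// mulmx2E.
  by rewrite v0 v1 mulr1 mulr0 addr0.
rewrite quot_coordE//; apply/colP => i; rewrite !mxE big_ord1 !mxE NE// mulmx2E.
by rewrite N10 mul0r add0r.
Qed.

Definition quot_morph : vmorph (quot_bundle D) (quot_bundle D') := VMorph quot_fun_holo.

Lemma quot_morphE x (v : fibre E x) : quot_morph x (quot_map D x v) = quot_map D' x (f x v).
Proof.
apply/quot_proj_eq; rewrite -vmorphB; apply: fD; apply/quot_proj_eq.
exact: quot_reprK.
Qed.

(** f induces a morphism of the quotients, and the square with the two projections commutes; so a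
    class that dies in H^1(E / D) has an image that dies in H^1(E' / D'). *)
Lemma H1_0_morph (h : H1 E) : H1_0 D' (H1map f h) -> H1_0 D h.
Proof.
move=> + h0; apply.
rewrite (H1map_comp (k := vmorph_comp quot_morph (quot_map D))) => [|x v].
  by rewrite -(H1map_comp (g := quot_morph) (f := quot_map D))// h0 H1map_zero.
exact: quot_morphE.
Qed.

End Morphisms.

Definition sub_iso E E' (D : lsub E) (D' : lsub E') (f : viso E E')
  (fD : forall x v, D x v <-> D' x (f x v)) : viso (sub_bundle D) (sub_bundle D').
Proof.
have fD1 x v : D x v -> D' x (f x v) by move/fD.
have fD2 x v : D' x v -> D x (vi_inv f x v) by move=> Dv; apply/fD; rewrite vi_invK.
apply: (@VIso _ _ _ _ _ (sub_morph fD1) (sub_morph fD2)) => x [v Dv]; apply: eq_exist => /=.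
- exact: vi_funK.
- exact: vi_invK.
Defined.

Section Pullback.
Context {E E' : vbundle X 2}.
Variables (f : viso E E') (D' : lsub E').

Definition pull_map (t : ltriv (vfib E') 2) x (v : vfib E x) := tmap t (f x v).

Fact pull_map_bij t x : tdom t x -> bijective (@pull_map t x).
Proof.
move=> tx; have [g tK gK] := tmap_bij tx.
by exists (fun z => vi_inv f x (g z)) => v; rewrite /pull_map ?tK ?vi_funK// vi_invK gK.
Qed.

Definition pull_ltriv t : ltriv (vfib E) 2 := LTriv (tdom_open t) (@pull_map_bij t).

Lemma pull_vtriv t : vtriv t -> vtriv (pull_ltriv t).
Proof.
move=> ht u ua; have hu := vatlas_vtriv ua; split.
  have [N hN NE] := vmorph_vtriv (vi_inv f) ht hu; exists N => // x tx ux v.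
  by have := NE x tx ux (f x v); rewrite vi_funK.
by have [N hN NE] := vmorph_vtriv f hu ht; exists N.
Qed.

Definition pull_set x : set (fibre E x) := fun v => D' x (f x v).

Fact pull_loc x : exists2 t, adapted pull_set t & tdom t x.
Proof.
have [t ht tx] := ls_loc D' x; exists (pull_ltriv t) => //.
by split=> [|y ty v]; [exact: pull_vtriv ht.1|exact: ht.2].
Qed.

Definition pull_lsub : lsub E := LSub pull_loc.

End Pullback.

Lemma degree_pull E E' (f : viso E E') (D' : lsub E') :
  degree (sub_bundle (pull_lsub f D')) = degree (sub_bundle D').
Proof. by apply: degree_iso; apply: (@sub_iso _ _ _ _ f). Qed.

(** A competitor G in E is compared with D' after being carried to E' by the inverse of f. *)
Lemma max_destab_pull E E' (f : viso E E') (D' : lsub E') :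
  max_destab D' -> max_destab (pull_lsub f D').
Proof.
move=> [lt maxD]; split; first by rewrite degree_pull (degree_iso f).
move=> G; rewrite degree_pull -(degree_pull (viso_inv f) G).
have [le eqD] := maxD (pull_lsub (viso_inv f) G); split=> // e x v Gv.
by apply: (eqD e); rewrite /= /pull_set /= vi_funK.
Qed.

(** Each has maximal degree, so the degrees agree, and then each contains the other. *)
Lemma max_destab_unique E (D G : lsub E) : max_destab D -> max_destab G ->
  forall x v, D x v <-> G x v.
Proof.
move=> [_ maxD] [_ maxG] x v.
have [le1 sub1] := maxD G; have [le2 sub2] := maxG D.
have e : degree (sub_bundle G) = degree (sub_bundle D) by apply/eqP; rewrite eq_le le1.
by split; [exact: (sub2 (esym e))|exact: (sub1 e)].
Qed.

Lemma max_destab_iso E E' (f : viso E E') (D : lsub E) (D' : lsub E') :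
  max_destab D -> max_destab D' -> forall x v, D x v <-> D' x (f x v).
Proof. by move=> hD hD' x v; apply: (max_destab_unique hD (max_destab_pull f hD')). Qed.

Lemma H1_0_iso E E' (f : viso E E') (D : lsub E) (D' : lsub E') :
  max_destab D -> max_destab D' -> forall h, H1_0 D h <-> H1_0 D' (H1map f h).
Proof.
move=> hD hD' h; split; last first.
  by apply: H1_0_morph => x v /(max_destab_iso f hD hD').
have hE : H1map (viso_inv f) (H1map f h) = h.
  rewrite (H1map_comp (k := vmorph_id E)) ?H1map_id// => x v /=.
  by rewrite vi_funK.
rewrite -{1}hE; apply: H1_0_morph => x v.
by move/(max_destab_iso (viso_inv f) hD' hD).
Qed.

(** Non-degeneracy refers to some destabilising subbundle of L(A); uniqueness and invariance allow
    it to be tested in E, through any f. *)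
Lemma nondegenerateP (A : abundle X 2) E (D : lsub E) (f : viso (linearisation A) E) :
  max_destab D -> nondegenerate_abundle A <-> H1_0 D (H1map f (aff_invariant A)).
Proof.
move=> hD; split=> [[G [hG h]]|h]; first exact/(H1_0_iso f hG hD).
exists (pull_lsub f D); split; first exact: max_destab_pull.
by apply/(H1_0_iso f (max_destab_pull f hD) hD).
Qed.

End LineSubbundles.

(** * Classification *)

(** Phi is a relation because the class attached to an affine bundle depends on a chosen isomorphism
    L(A) -> E. The last hypothesis contains both well-definedness and injectivity on the
    quotients. *)
Lemma quotient_bijection (T T' : Type) (S : T -> Prop) (S' : T' -> Prop)
    (e : T -> T -> Prop) (e' : T' -> T' -> Prop) (Phi : T -> T' -> Prop) :
  (forall x, e x x) -> (forall x y, e x y -> e y x) ->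
  (forall x y z, e x y -> e y z -> e x z) ->
  (forall x, e' x x) -> (forall x y, e' x y -> e' y x) ->
  (forall x y z, e' x y -> e' y z -> e' x z) ->
  (forall x, S x -> exists2 y, S' y & Phi x y) ->
  (forall y, S' y -> exists2 x, S x & Phi x y) ->
  (forall x x' y y', Phi x y -> Phi x' y' -> e x x' <-> e' y y') ->
  exists F : quotient S e -> quotient S' e', bijective F /\
    forall x (Sx : S x) y, Phi x y -> sval (F (qclass e Sx)) = e' y.
Proof.
move=> er es et e'r e's e't tot surj compat.
have ext (U : Type) (d : U -> U -> Prop) : (forall x, d x x) -> (forall x y, d x y -> d y x) ->
    (forall x y z, d x y -> d y z -> d x z) -> forall x y, d x = d y <-> d x y.
  move=> dr ds dt x y; split=> [->|dxy]; first exact: dr.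
  apply/funext => z; apply/propext; split; first exact/dt/ds.
  exact: dt.
have eE := ext T e er es et; have e'E := ext T' e' e'r e's e't.
have pt (q : quotient S e) : exists q' : quotient S' e', forall x y,
    sval q = e x -> Phi x y -> sval q' = e' y.
  case: q => q [x Sx qx]; have [y Sy xy] := tot x Sx.
  exists (qclass e' Sy) => x' y' /= qx' xy'.
  by apply/e'E/(compat _ _ _ _ xy xy')/eE; rewrite -qx.
pose F q := projT1 (cid (pt q)).
have FE q x y : sval q = e x -> Phi x y -> sval (F q) = e' y.
  by rewrite /F; case: cid => q' /= h; exact: h.
exists F; split; last by move=> x Sx y xy; exact: (FE (qclass e Sx) x y).
apply: bij_of_inj_surj => [q1 q2 F12|[q [y Sy qE]]].
  have [x1 S1 E1] := svalP q1; have [x2 S2 E2] := svalP q2.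
  have [y1 _ P1] := tot x1 S1; have [y2 _ P2] := tot x2 S2.
  have : sval q1 = sval q2.
    rewrite E1 E2; apply/eE/(compat _ _ _ _ P1 P2)/e'E.
    by rewrite -(FE _ _ _ E1 P1) F12 (FE _ _ _ E2 P2).
  by case: q1 q2 {F12 E1 E2} => [q1 ?] [q2 ?] /= qq; exact: eq_exist.
have [x Sx xy] := surj y Sy; exists (qclass e Sx).
have := FE (qclass e Sx) x y erefl xy; case: (F _) => q' ? /= q'E.
by apply: eq_exist; rewrite q'E qE.
Qed.

(** * Orbits of a group of automorphisms on H^1(E) *)

Section Orbits.
Context {R : realType} {X : compact_riemann_surface R} {E : vbundle X 2}.
Variable G : viso E E -> Prop.
Hypothesis G1 : G (viso_id E).
Hypothesis GV : forall g, G g -> G (viso_inv g).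
Hypothesis GM : forall g g', G g -> G g' -> G (viso_comp g' g).

Lemma same_orbit_refl h : same_orbit G h h.
Proof. by exists (viso_id E) => //; rewrite H1map_id. Qed.

Lemma same_orbit_sym h h' : same_orbit G h h' -> same_orbit G h' h.
Proof.
move=> [g Gg ->]; exists (viso_inv g); first exact: GV.
by rewrite (H1map_comp (k := vmorph_id E)) ?H1map_id// => x v /=; rewrite vi_funK.
Qed.

Lemma same_orbit_trans h h' h'' :
  same_orbit G h h' -> same_orbit G h' h'' -> same_orbit G h h''.
Proof.
move=> [g Gg ->] [g' Gg' ->]; exists (viso_comp g' g); first exact: GM.
by rewrite (H1map_comp (k := viso_comp g' g)).
Qed.

End Orbits.

(** * Automorphisms acting as the identity on D *)

Section AutLine.
Context {R : realType} {X : compact_riemann_surface R} {E : vbundle X 2}.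
Variable D : lsub E.

Lemma Aut0_id : Aut0 D (viso_id E).
Proof. by []. Qed.

Lemma Aut0_inv g : Aut0 D g -> Aut0 D (viso_inv g).
Proof. by move=> hg x v Dv /=; rewrite -{1}(hg x v Dv) vi_funK. Qed.

Lemma Aut0_comp g g' : Aut0 D g -> Aut0 D g' -> Aut0 D (viso_comp g' g).
Proof. by move=> hg hg' x v Dv /=; rewrite hg// hg'. Qed.

(* g acts on D by multiplication by a holomorphic function on X, which is
   constant. *)
Lemma Aut0_of_point (g : viso E E) x0 (v0 : fibre E x0) :
  (forall x v, D x v -> D x (g x v)) -> D x0 v0 -> v0 <> 0 -> g x0 v0 = v0 -> Aut0 D g.
Proof.
move=> gD Dv0 v00 gv0.
have pt x : exists a : R[i], forall v, D x v -> g x v = a *: v.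
  have [t ht tx] := ls_loc D x; have [v [Dv e1 e0]] := adapted_vec ht tx.
  have vn0 : v <> 0.
    move=> v_0; move: e1; rewrite v_0.
    rewrite -[0 in LHS](scale0r (0 : fibre E x)) (vtrivZ ht.1 tx) scale0r mxE.
    by move/eqP; rewrite eq_sym oner_eq0.
  have [a aE] := lsub_line Dv (gD x v Dv) vn0.
  exists a => w Dw; have [b ->] := lsub_line Dv Dw vn0.
  by rewrite vmorphZ aE !scalerA mulrC.
pose lam x := projT1 (cid (pt x)).
have lamE x v : D x v -> g x v = lam x *: v by rewrite /lam; case: cid => a /= h; exact: h.
have hlam : holo setT lam.
  move=> x _; have [t ht tx] := ls_loc D x; have [N hN NE] := vmorph_vtriv g ht.1 ht.1.
  (* In an adapted trivialisation the factor is the upper left entry of the matrix of g, hence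
     holomorphic. *)
  apply: (holo_at_local (tdom_open t) tx _ (hN 0 0 x (conj tx tx))) => y ty.
  have [v [Dv e1 e0]] := adapted_vec ht ty.
  have := congr1 (fun z : 'cV_2 => z 0 0) (NE y ty ty v).
  rewrite mulmx2E e1 e0 mulr1 mulr0 addr0 lamE// (vtrivZ ht.1 ty) mxE e1 mulr1.
  by move=> ->.
move=> x v Dv; rewrite lamE// (holo_constant hlam x x0).
have lam0 : (lam x0 - 1) *: v0 = 0 by rewrite scalerBl -lamE// gv0 scale1r subrr.
have [/eqP|l1] := eqVneq (lam x0 - 1) 0; first by rewrite subr_eq0 => /eqP ->; rewrite scale1r.
by case: v00; rewrite -[v0]scale1r -(mulVf l1) -scalerA lam0 scaler0.
Qed.

End AutLine.

(** * Isomorphisms of affine bundles versus orbits in H^1(E) *)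

Section Classification.
Context {R : realType} {X : compact_riemann_surface R}.

Lemma isomorphic_refl (A : abundle X 2) : isomorphic A A.
Proof. by exists; exact: aiso_id. Qed.

Lemma isomorphic_sym (A A' : abundle X 2) : isomorphic A A' -> isomorphic A' A.
Proof. by case=> psi; exists; exact: aiso_inv. Qed.

Lemma isomorphic_trans (A A' A'' : abundle X 2) :
  isomorphic A A' -> isomorphic A' A'' -> isomorphic A A''.
Proof. by case=> psi [phi]; exists; exact: (aiso_comp phi psi). Qed.

Lemma framed_isomorphic_refl x0 (A : framed_abundle (X := X) x0) : framed_isomorphic A A.
Proof. by exists (aiso_id A) => z; exact: lin_part_id. Qed.

Lemma framed_isomorphic_sym x0 (A A' : framed_abundle (X := X) x0) :
  framed_isomorphic A A' -> framed_isomorphic A' A.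
Proof. by move=> [psi h]; exists (aiso_inv psi) => z; rewrite -h; exact: lin_partK. Qed.

Lemma framed_isomorphic_trans x0 (A A' A'' : framed_abundle (X := X) x0) :
  framed_isomorphic A A' -> framed_isomorphic A' A'' -> framed_isomorphic A A''.
Proof.
move=> [psi h] [phi h']; exists (aiso_comp phi psi) => z.
by rewrite lin_part_comp h h'.
Qed.

Lemma aiso_orbit (E : vbundle X 2) (A A' : abundle X 2) (f : viso (linearisation A) E)
    (f' : viso (linearisation A') E) (psi : aiso A A') :
  exists2 g : viso E E, (forall x u, g x (f x u) = f' x (@lin_part _ _ _ _ _ psi x u)) &
    H1map f' (aff_invariant A') = H1map g (H1map f (aff_invariant A)).
Proof.
pose g := viso_comp f' (viso_comp (lin_iso psi) (viso_inv f)).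
exists g; first by move=> x u; rewrite /= vi_funK.
rewrite -(aff_invariant_iso psi) (H1map_comp (k := vmorph_comp f' (lin_morph psi)))//.
rewrite (H1map_comp (k := vmorph_comp f' (lin_morph psi)))// => x u /=.
by rewrite vi_funK.
Qed.

(** The map f'^-1 g f respects the invariants and so is the linear part of an isomorphism. The
    equation is kept in the conclusion because the framed case reads the effect on framings from
    it. *)
Lemma orbit_aiso (E : vbundle X 2) (A A' : abundle X 2) (f : viso (linearisation A) E)
    (f' : viso (linearisation A') E) (g : viso E E) :
  H1map f' (aff_invariant A') = H1map g (H1map f (aff_invariant A)) ->
  exists psi : aiso A A', forall x u,
    g x (f x u) = f' x (@lin_part _ _ _ _ _ psi x u).
Proof.
move=> e; pose k := viso_comp (viso_inv f') (viso_comp g f).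
have [|psi psiE] := @aiso_of_invariant _ _ _ _ _ k.
  rewrite -(H1map_comp (g := vi_inv f') (f := vmorph_comp g f))//.
  rewrite -(H1map_comp (g := g) (f := f))// -e (H1map_comp (k := vmorph_id _)) ?H1map_id// => x u.
  by rewrite vi_funK.
by exists psi => x u; rewrite psiE /= vi_invK.
Qed.

Section Framing.
Context {E : vbundle X 2} {D : lsub E} {x0 : X} {eps0 : {linear R[i]^o -> fibre E x0}}.
Hypothesis hD : max_destab D.
Hypothesis heps0 : is_framing D eps0.

Lemma framing_linear (F : vbundle X 2) (eps : {linear R[i]^o -> fibre F x0}) (z : R[i]^o) :
  eps z = (z : R[i]) *: eps 1.
Proof. by rewrite -linearZ /GRing.scale /= mulr1. Qed.

Lemma framing_neq0 (F : vbundle X 2) (G : lsub F) (eps : {linear R[i]^o -> fibre F x0}) :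
  is_framing G eps -> G x0 (eps 1) /\ eps 1 <> 0.
Proof.
move=> [fun_eps inj_eps _]; split; first exact: fun_eps.
rewrite -(linear0 eps) => /inj_eps; rewrite !inE => /(_ I I) /eqP.
by rewrite oner_eq0.
Qed.

(** An isomorphism preserves the destabilising lines, so the images of 1 under f0 composed with the
    framing of A and under [eps0] span the same line of E at x0; a scalar makes them equal. *)
Lemma framed_iso_exists (A : framed_abundle x0) : viso (linearisation A) E ->
  exists f : viso (linearisation A) E, forall z, f x0 (fa_eps A z) = eps0 z.
Proof.
move=> f0; have [De e0] := framing_neq0 heps0.
have [Da a0] := framing_neq0 (fa_framing A).
have /(max_destab_iso f0 (fa_maxD A) hD) fDa := Da.
have fa0 : f0 x0 (fa_eps A 1) <> 0.
  by rewrite -(vmorph0 f0) => /(can_inj (vi_funK f0 (x := x0))).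
have [a aE] := lsub_line fDa De fa0.
have an0 : a != 0 by apply/eqP => az; apply: e0; rewrite aE az scale0r.
exists (viso_comp (viso_scale E an0) f0) => z /=.
by rewrite (framing_linear (fa_eps A)) (framing_linear eps0) vmorphZ aE !scalerA mulrC.
Qed.

Section PullFraming.
Variables (F : vbundle X 2) (f : viso F E).

Definition pull_eps (z : R[i]^o) : fibre F x0 := vi_inv f x0 (eps0 z).

Fact pull_eps_linear : linear pull_eps.
Proof. by move=> a z w; rewrite /pull_eps linearP vmorph_linear. Qed.

HB.instance Definition _ := GRing.isLinear.Build R[i] R[i]^o (fibre F x0) *:%R pull_eps
  pull_eps_linear.

Lemma pull_framing : is_framing (pull_lsub f D) pull_eps.
Proof.
have [fe ie se] := heps0; split=> [z _|z w _ _|v].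
- by rewrite /= /pull_set /pull_eps vi_invK; exact: fe.
- move/(can_inj (vi_invK f (x := x0))) => e; apply: ie => //; exact: in_setT.
- by move=> /se[z _ zE]; exists z => //; rewrite /= /pull_eps zE vi_funK.
Qed.

End PullFraming.

Definition framed_twist (c : cocycle E) : framed_abundle x0 :=
  @FramedABundle _ _ x0 (twist c) (pull_lsub (twist_iso c) D)
    (max_destab_pull (twist_iso c) hD) (pull_eps (twist_iso c) : {linear _ -> _})
    (pull_framing (twist_iso c)).

(** If psi respects the framings, then g = f' L(psi) f^-1 fixes [eps0 1], and this one vector puts g
    in Aut(E)_0. Conversely, an element of Aut(E)_0 fixes the image of [eps0], so the isomorphism it
    yields carries one framing to the other. *)
Lemma framed_isomorphic_orbit (A A' : framed_abundle x0) (f : viso (linearisation A) E)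
    (f' : viso (linearisation A') E) :
  (forall z, f x0 (fa_eps A z) = eps0 z) -> (forall z, f' x0 (fa_eps A' z) = eps0 z) ->
  framed_isomorphic A A' <->
  same_orbit (Aut0 D) (H1map f (aff_invariant A)) (H1map f' (aff_invariant A')).
Proof.
move=> fe f'e; have [De e0] := framing_neq0 heps0; split=> [[psi psie]|[g hg e]].
  have [g gE e] := aiso_orbit f f' psi; exists g => //.
  apply: (Aut0_of_point _ De e0); first by move=> x v /(max_destab_iso g hD hD).
  by rewrite -{1}fe gE psie f'e.
have [psi psiE] := orbit_aiso e; exists psi => z.
apply: (can_inj (vi_funK f' (x := x0))); rewrite -psiE fe f'e.
by apply: hg; have [h _ _] := heps0; exact: h.
Qed.

End Framing.
End Classification.

Theorem theorem1p10 (R : realType) (C : compact_riemann_surface R)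
    (E : vbundle C 2) (hE : unstable E)
    (D_E : lsub E) (hD : max_destab D_E)
    (x0 : C) (eps0 : {linear R[i]^o -> fibre E x0})
    (heps0 : is_framing D_E eps0) :
  (* (1) *)
  (let S (A : abundle C 2) :=
     nondegenerate_abundle A /\ inhabited (viso (linearisation A) E) in
   exists F : quotient S (@isomorphic R C) ->
              quotient (H1_0 D_E) (same_orbit (@Aut R C E)),
     bijective F /\
     forall A (SA : S A) (f : viso (linearisation A) E),
       sval (F (qclass _ SA)) =
       same_orbit (@Aut R C E) (H1map f (aff_invariant A)))
  /\
  (* (2) *)
  (let S (A : framed_abundle x0) := inhabited (viso (linearisation A) E) in
   let S_nd (A : framed_abundle x0) := nondegenerate_abundle A /\ S A in
   let framed (A : framed_abundle x0) (f : viso (linearisation A) E) :=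
     forall z, f x0 (fa_eps A z) = eps0 z in
   [/\ forall A, S A -> exists f, framed A f,
       exists F : quotient S (@framed_isomorphic R C x0) ->
                  quotient (fun _ : H1 E => True) (same_orbit (Aut0 D_E)),
         bijective F /\
         forall A (SA : S A) f, framed A f ->
           sval (F (qclass _ SA)) =
           same_orbit (Aut0 D_E) (H1map f (aff_invariant A)) &
       exists F : quotient S_nd (@framed_isomorphic R C x0) ->
                  quotient (H1_0 D_E) (same_orbit (Aut0 D_E)),
         bijective F /\
         forall A (SA : S_nd A) f, framed A f ->
           sval (F (qclass _ SA)) =
           same_orbit (Aut0 D_E) (H1map f (aff_invariant A))]).
Proof.
split=> [S|S S_nd framed].
  pose Phi (A : abundle C 2) h :=
    exists f : viso (linearisation A) E, h = H1map f (aff_invariant A).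
  have [|||||||||F [Fbij FE]] :=
      @quotient_bijection _ _ S (H1_0 D_E) (@isomorphic R C) (same_orbit (@Aut R C E)) Phi.
  - exact: isomorphic_refl.
  - exact: isomorphic_sym.
  - exact: isomorphic_trans.
  - exact: same_orbit_refl.
  - exact: same_orbit_sym.
  - exact: same_orbit_trans.
  - move=> A [ndA [f]]; exists (H1map f (aff_invariant A)); last by exists f.
    exact/(nondegenerateP f hD).
  - move=> h; rewrite -(H1reprK h) => hh; exists (twist (H1repr h)).
      split; last by exists; exact: twist_iso.
      by apply/(nondegenerateP (twist_iso _) hD); rewrite twist_invariant.
    by exists (twist_iso (H1repr h)); rewrite twist_invariant.
  - move=> A A' _ _ [f ->] [f' ->]; split=> [[psi]|[g _ e]].
      by have [g _ e] := aiso_orbit f f' psi; exists g.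
    by have [psi _] := orbit_aiso e; exists.
  exists F; split=> // A SA f; apply: FE; by exists f.
pose Phi (A : framed_abundle x0) h :=
  exists f : viso (linearisation A) E, framed A f /\ h = H1map f (aff_invariant A).
have Aorb A A' h h' : Phi A h -> Phi A' h' ->
    framed_isomorphic A A' <-> same_orbit (Aut0 D_E) h h'.
  by move=> [f [fe ->]] [f' [f'e ->]]; exact: (framed_isomorphic_orbit hD heps0 fe f'e).
have surj h : exists2 A, S A & Phi A h.
  rewrite -(H1reprK h); pose A := framed_twist (x0 := x0) hD heps0 (H1repr h).
  exists A; first by exists; exact: twist_iso.
  exists (twist_iso (H1repr h)); split; last by rewrite twist_invariant.
  (* The framing of [framed_twist] is [eps0] pulled back along [twist_iso], which therefore matches
     the framings. *)
  by move=> z; exact: vi_invK.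
have SE A : S A -> exists f, framed A f by case=> f; exact: (framed_iso_exists hD heps0 f).
have ndE A h : Phi A h -> nondegenerate_abundle A <-> H1_0 D_E h.
  by move=> [f [_ ->]]; exact: nondegenerateP.
split=> //.
- have [|||||||||F [Fbij FE]] := @quotient_bijection _ _ S (fun=> True)
      (@framed_isomorphic R C x0) (same_orbit (Aut0 D_E)) Phi.
  - exact: framed_isomorphic_refl.
  - exact: framed_isomorphic_sym.
  - exact: framed_isomorphic_trans.
  - exact: (same_orbit_refl (@Aut0_id _ _ _ D_E)).
  - exact: (same_orbit_sym (@Aut0_inv _ _ _ D_E)).
  - exact: (same_orbit_trans (@Aut0_comp _ _ _ D_E)).
  - by move=> A /SE[f fe]; exists (H1map f (aff_invariant A)) => //; exists f.
  - by move=> h _; exact: surj.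
  - exact: Aorb.
  by exists F; split=> // A SA f fe; apply: FE; exists f.
- have [|||||||||F [Fbij FE]] := @quotient_bijection _ _ S_nd (H1_0 D_E)
      (@framed_isomorphic R C x0) (same_orbit (Aut0 D_E)) Phi.
  - exact: framed_isomorphic_refl.
  - exact: framed_isomorphic_sym.
  - exact: framed_isomorphic_trans.
  - exact: (same_orbit_refl (@Aut0_id _ _ _ D_E)).
  - exact: (same_orbit_sym (@Aut0_inv _ _ _ D_E)).
  - exact: (same_orbit_trans (@Aut0_comp _ _ _ D_E)).
  - move=> A [ndA /SE[f fe]]; exists (H1map f (aff_invariant A)); last by exists f.
    by apply/(ndE A) => //; exists f.
  - move=> h hh; have [A SA Ah] := surj h; exists A => //; split => //.
    exact/(ndE A h Ah).
  - exact: Aorb.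
  by exists F; split=> // A SA f fe; apply: FE; exists f.
Qed.
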